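(* Let $k$ be an algebraically closed field and let $\mathfrak V=(V^{(i)},h^i,h_i\mid i\in\mathbb Z)$ be a linked sequence of $k$-vector spaces of dimension $n\ge1$. If $\mathfrak V$ is exact, then $\mathbb P(\mathfrak V)$ is a connected, Cohen--Macaulay subscheme of $\mathbb P^{1,1}(\mathfrak V)$ of pure dimension $n-1$ and bivariate Hilbert polynomial $$h^0\big(\mathbb P(\mathfrak V),\mathcal O_{\mathbb P(\mathfrak V)}(a,b)\big)=\binom{a+b+n-1}{n-1}\quad\text{for }a,b\gg0.$$ Conversely, if $\mathbb P(\mathfrak V)$ has bivariate Hilbert polynomial $\binom{a+b+n-1}{n-1}$, then $\mathfrak V$ is exact.
   Context: **Linked sequences.** A linked sequence of vector spaces of dimension $n$ consists of vector spaces $V^{(i)}$, $i\in\mathbb Z$, all of dimension $n$, and linear maps $h_i\colon V^{(i+1)}\to V^{(i)}$, $h^i\colon V^{(i)}\to V^{(i+1)}$ such that: (a) $h_ih^i=0$ and $h^ih_i=0$ for every $i$; (b) $\ker(h^i)\cap\ker(h_{i-1})=0$ for every $i$; (c) there are integers $i_0,i_\infty$ such that $h_i$ is an isomorphism for every $i<i_0$ and $h^i$ is an isomorphism for every $i\ge i_\infty$. It is exact if $\ker(h_i)=\mathrm{Im}(h^i)$ and $\ker(h^i)=\mathrm{Im}(h_i)$ for every $i$. The lower bound $i_0$ is the maximum integer such that $h_i$ is an isomorphism for all $i<i_0$; the upper bound $i_\infty$ is the minimum integer such that $h^i$ is an isomorphism for all $i\ge i_\infty$. **The scheme $\mathbb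 P(\mathfrak V)$.** Let $h_\ell^i\colon V^{(\ell)}\to V^{(i)}$ denote $h_ih_{i+1}\cdots h_{\ell-1}$ if $i<\ell$, $h^{i-1}\cdots h^{\ell+1}h^\ell$ if $i>\ell$, and the identity if $i=\ell$. Choose $i\le i_0$ and $j\ge i_\infty$ (with $i\le j$) and put $\mathbb P^{1,1}(\mathfrak V):=\mathbb P(V^{(i)})\times\mathbb P(V^{(j)})$, where $\mathbb P(V)$ is the projective space of one-dimensional subspaces of $V$; up to natural isomorphism everything below is independent of the choice of $i,j$. Let $$\mathbb P(\mathfrak V):=\bigcup_{\ell=i}^j\mathbb P(\mathfrak V_\ell)\subseteq\mathbb P^{1,1}(\mathfrak V),$$ where $\mathbb P(\mathfrak V_\ell)$ is the closure in $\mathbb P^{1,1}(\mathfrak V)$ of $\{([h_\ell^i(v)],[h_\ell^j(v)])\mid v\in V^{(\ell)}\setminus(\ker(h^\ell)\cup\ker(h_{\ell-1}))\}$; $\mathbb P(\mathfrak V)$ is a closed subscheme with its reduced structure. $\mathcal O_{\mathbb P(\mathfrak V)}(a,b)$ is the restriction of the sheaf $\mathcal O(a,b)$ on $\mathbb P(V^{(i)})\times\mathbb P(V^{(j)})$. The bivariate Hilbert polynomial of $\mathbb P(\mathfrak V)$ is the polynomial in $a,b$ giving $h^0(\mathbb P(\mathfrak V),\mathcal O_{\mathbb P(\mathfrak V)}(a,b))$ for $a,b\gg0$. *)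

(* Defs.v *)
(* Linked sequences of vector spaces, and the closed subscheme P(V) that such a
   sequence defines in a product of two projective spaces.

   Over an algebraically closed field a reduced closed subscheme of
   P(V) x P(W) is determined by its set of closed points.  It is represented
   here by that set, its topology by the Zariski topology, and its structure
   sheaf and twists by sheaves of functions on cones that are locally quotients
   of bihomogeneous polynomials.  Points of the scheme correspond to the
   irreducible closed subsets. *)
From HB Require Import structures.
From mathcomp Require Import all_boot all_order all_algebra ring_quotient.
From mathcomp Require Import boolp classical_sets functions.
From mathcomp Require Import topology_structure.
From mathcomp Require Import mpoly.
Set Implicit Arguments.
Unset Strict Implicit.
Unset Printing Implicit Defensive.
Import Order.TTheory GRing.Theory Num.Theory.
Local Open Scope classical_set_scope.
Local Open Scope ring_scope.

(* [ls_up L i] is h^i and [ls_dn L i] is h_i.  Condition (b) is stated at the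
   index i + 1, where h_i and h^(i+1) have syntactically the same domain. *)
Record linked_seq (k : fieldType) (n : nat) := LinkedSeq {
  ls_sp :> int -> vectType k;
  ls_up : forall i, 'Hom(ls_sp i, ls_sp (i + 1));
  ls_dn : forall i, 'Hom(ls_sp (i + 1), ls_sp i);
  ls_dim : forall i, \dim {: ls_sp i} = n;
  ls_dn_up : forall i v, ls_dn i (ls_up i v) = 0;
  ls_up_dn : forall i v, ls_up i (ls_dn i v) = 0;
  ls_ker : forall i, (lker (ls_up (i + 1)) :&: lker (ls_dn i) = 0)%VS;
  ls_bounded : exists i0 iinf : int,
    (forall i, i < i0 -> bijective (ls_dn i)) /\
    (forall i, iinf <= i -> bijective (ls_up i))
}.

Section LinkedSeqTheory.
Variables (k : fieldType) (n : nat) (L : linked_seq k n).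

Definition ls_exact : Prop := forall i,
  lker (ls_dn L i) = limg (ls_up L i) /\ lker (ls_up L i) = limg (ls_dn L i).

Definition ls_lower_bound (i0 : int) : Prop :=
  (forall i, i < i0 -> bijective (ls_dn L i)) /\
  (forall i1, (forall i, i < i1 -> bijective (ls_dn L i)) -> i1 <= i0).

Definition ls_upper_bound (iinf : int) : Prop :=
  (forall i, iinf <= i -> bijective (ls_up L i)) /\
  (forall i1, (forall i, i1 <= i -> bijective (ls_up L i)) -> iinf <= i1).

Definition ls_cast (i i' : int) (e : i = i') : 'Hom(L i, L i') :=
  match e with erefl => \1%VF end.

Fact ls_up_idx (l : int) (m : nat) : l + m%:Z + 1 = l + m.+1%:Z.
Proof. by rewrite -addrA -addn1 PoszD. Qed.

Fact ls_dn_idx (l : int) (m : nat) : l - m%:Z = l - m.+1%:Z + 1.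
Proof. by rewrite -addn1 PoszD opprD addrA subrK. Qed.

Fixpoint ls_raise (l : int) (m : nat) : 'Hom(L l, L (l + m%:Z)) :=
  match m with
  | 0%N => ls_cast (esym (addr0 l))
  | m'.+1 =>
      (ls_cast (ls_up_idx l m') \o (ls_up L (l + m'%:Z) \o ls_raise l m'))%VF
  end.

Fixpoint ls_lower (l : int) (m : nat) : 'Hom(L l, L (l - m%:Z)) :=
  match m with
  | 0%N => ls_cast (esym (subr0 l))
  | m'.+1 =>
      (ls_dn L (l - m'.+1%:Z) \o (ls_cast (ls_dn_idx l m') \o ls_lower l m'))%VF
  end.

Fact ls_map_idx (l i d : int) : i - l = d -> l + d = i.
Proof. by move=> <-; rewrite addrC subrK. Qed.

Definition ls_shift (l i d : int) : i - l = d -> 'Hom(L l, L i) :=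
  match d with
  | Posz m => fun e => (ls_cast (ls_map_idx e) \o ls_raise l m)%VF
  | Negz m => fun e => (ls_cast (ls_map_idx e) \o ls_lower l m.+1)%VF
  end.

(* [ls_map l i] is h_l^i; it is characterized by the lemmas [ls_mapxx],
   [ls_mapS] and [ls_map_dn] below. *)
Definition ls_map (l i : int) : 'Hom(L l, L i) := ls_shift (erefl (i - l)).

Lemma ls_mapE (l i d : int) (e : i - l = d) : ls_map l i = ls_shift e.
Proof. by case: _ / e. Qed.

Lemma ls_cast_id (i : int) (e : i = i) : ls_cast e = \1%VF.
Proof. by rewrite (eq_irrelevance e erefl). Qed.

Lemma ls_cast_comp (a b c : int) (e : a = b) (e' : b = c) :
  (ls_cast e' \o ls_cast e)%VF = ls_cast (etrans e e').
Proof. by case: _ / e'; case: _ / e; rewrite /= comp_lfun1l. Qed.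

Lemma ls_cast_up (a b : int) (e : a = b) (e' : a + 1 = b + 1) :
  (ls_cast e' \o ls_up L a)%VF = (ls_up L b \o ls_cast e)%VF.
Proof.
by case: _ / e e' => e'; rewrite !ls_cast_id comp_lfun1l comp_lfun1r.
Qed.

Lemma ls_cast_dn (a b : int) (e : a = b) (e' : a + 1 = b + 1) :
  (ls_cast e \o ls_dn L a)%VF = (ls_dn L b \o ls_cast e')%VF.
Proof.
by case: _ / e e' => e'; rewrite !ls_cast_id comp_lfun1l comp_lfun1r.
Qed.

Lemma ls_map_raise (l i : int) (m : nat) (e : l + m%:Z = i) :
  ls_map l i = (ls_cast e \o ls_raise l m)%VF.
Proof.
have e1 : i - l = m by rewrite -e addrC addKr.
by rewrite (ls_mapE e1); congr (ls_cast _ \o _)%VF; apply: eq_irrelevance.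
Qed.

Lemma ls_map_lower (l i : int) (m : nat) (e : l - m.+1%:Z = i) :
  ls_map l i = (ls_cast e \o ls_lower l m.+1)%VF.
Proof.
have e1 : i - l = Negz m by rewrite -e addrC addKr NegzE.
by rewrite (ls_mapE e1); congr (ls_cast _ \o _)%VF; apply: eq_irrelevance.
Qed.

Lemma ls_mapxx (l : int) : ls_map l l = \1%VF.
Proof.
by rewrite (@ls_map_raise l l 0 (addr0 l)) /= ls_cast_comp ls_cast_id.
Qed.

Lemma ls_mapS (l i : int) :
  l <= i -> ls_map l (i + 1) = (ls_up L i \o ls_map l i)%VF.
Proof.
move=> li; have [m e] : exists m : nat, l + m%:Z = i.
  by exists (absz (i - l)%R); rewrite gez0_abs ?subr_ge0 // subrKC.
case: _ / e {li} => {i}.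
rewrite (ls_map_raise (esym (ls_up_idx l m))) (ls_map_raise erefl) /=.
by rewrite !comp_lfunA ls_cast_comp ls_cast_id comp_lfun1l comp_lfun1r.
Qed.

Lemma ls_map_dn (l i : int) :
  i < l -> ls_map l i = (ls_dn L i \o ls_map l (i + 1))%VF.
Proof.
move=> il; have [m e] : exists m : nat, l - m.+1%:Z = i.
  exists (absz (l - i - 1)%R).
  have h : 0 <= l - i - 1 by rewrite subr_ge0 -gtz0_ge1 subr_gt0.
  by rewrite -addn1 PoszD gez0_abs // subrK subKr.
case: _ / e {il} => {i}; rewrite (ls_map_lower erefl) /= comp_lfun1l.
congr (_ \o _)%VF; case: m => [|m].
  rewrite /= ls_cast_comp.
  by rewrite (@ls_map_raise _ _ 0 (etrans (addr0 l)
       (etrans (esym (subr0 l)) (ls_dn_idx l 0)))) /= ls_cast_comp;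
     congr ls_cast; apply: eq_irrelevance.
by rewrite (ls_map_lower (ls_dn_idx l m.+1)).
Qed.

End LinkedSeqTheory.

Section Dimension.
Variable T : topologicalType.
Implicit Types X Y : set T.

Definition irreducible X : Prop := X !=set0 /\
  forall A B, closed A -> closed B -> X `<=` A `|` B -> X `<=` A \/ X `<=` B.

Definition irr_component X Y : Prop :=
  [/\ closed Y, irreducible Y, Y `<=` X &
    forall Z, closed Z -> irreducible Z -> Z `<=` X -> Y `<=` Z -> Z = Y].

Definition irr_chain X (d : nat) (Z : nat -> set T) : Prop :=
  (forall m, (m <= d)%N -> [/\ closed (Z m), irreducible (Z m) & Z m `<=` X]) /\
  (forall m, (m < d)%N -> Z m `<=` Z m.+1 /\ Z m <> Z m.+1).

(* Here and in the next definition X is meant to be closed, so that its closed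
   subsets are the closed subsets of the ambient space contained in it. *)
Definition has_dimension X (d : nat) : Prop :=
  (exists Z, irr_chain X d Z) /\ (forall Z, ~ irr_chain X d.+1 Z).

Definition pure_dimension X (d : nat) : Prop :=
  forall Y, irr_component X Y -> has_dimension Y d.

End Dimension.

Section CohenMacaulayRing.
Variable A : comNzRingType.
Implicit Types s : seq A.

Definition prime_chain (d : nat) (P : nat -> {pred A}) : Prop :=
  (forall m, (m <= d)%N -> idealr_closed (P m) /\ prime_idealr_closed (P m)) /\
  (forall m, (m < d)%N -> {subset P m <= P m.+1} /\ ~ {subset P m.+1 <= P m}).

Definition krull_dimension (d : nat) : Prop :=
  (exists P, prime_chain d P) /\ (forall P, ~ prime_chain d.+1 P).

Definition generated s (x : A) : Prop :=
  exists c : 'I_(size s) -> A, x = \sum_t c t * s`_t.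

Definition regular_sequence s : Prop := ~ generated s 1 /\
  forall t, (t < size s)%N -> forall x,
    generated (take t s) (s`_t * x) -> generated (take t s) x.

Definition nonunit (x : A) : Prop := ~ exists y, x * y = 1.

(* In a local ring the nonunits form the maximal ideal. *)
Definition has_depth (d : nat) : Prop :=
  let in_max s := forall x, x \in s -> nonunit x in
  (exists s, [/\ size s = d, in_max s & regular_sequence s]) /\
  (forall s, in_max s -> regular_sequence s -> (size s <= d)%N).

(* Meaningful for noetherian local rings, such as the stalks below. *)
Definition cohen_macaulay_ring : Prop :=
  exists d, krull_dimension d /\ has_depth d.

End CohenMacaulayRing.

Definition proj (k : fieldType) (V : vectType k) : Type :=
  {U : {vspace V} | \dim U == 1%N}.
HB.instance Definition _ (k : fieldType) (V : vectType k) :=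
  Choice.on (proj V).

(* Not a product for the topology: it will carry the Zariski topology. *)
Definition biproj (k : fieldType) (V W : vectType k) : Type :=
  (proj V * proj W)%type.
HB.instance Definition _ (k : fieldType) (V W : vectType k) :=
  Choice.on (biproj V W).

Section BiProj.
Variables (k : fieldType) (V W : vectType k).
Implicit Types (P Q : biproj V W) (f : {mpoly k[\dim {:V} + \dim {:W}]}).

Definition rep P : set (V * W) :=
  [set x | [/\ x.1 \in val P.1, x.1 != 0, x.2 \in val P.2 & x.2 != 0]].

Definition bihomog (a b : nat) f : Prop := forall m, m \in msupp f ->
  (\sum_(s < \dim {:V}) m (lshift _ s) = a)%N /\
  (\sum_(t < \dim {:W}) m (rshift _ t) = b)%N.

Definition peval f (x : V * W) : k :=
  f.@[fun r => match fintype.split r with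
               | inl s => coord (vbasis {:V}) s x.1
               | inr t => coord (vbasis {:W}) t x.2
               end].

Definition zariski_open (U : set (biproj V W)) : Prop :=
  exists F : set {mpoly k[\dim {:V} + \dim {:W}]},
    (forall f, F f -> exists a b, bihomog a b f) /\
    U = [set P | exists2 f, F f & forall x, rep P x -> peval f x != 0].

Lemma rep_neq0 P : exists x, rep P x.
Proof.
case: P => [[U dU] [U' dU']].
have pick (X : vectType k) (Z : {vspace X}) : \dim Z == 1%N ->
    vpick Z \in Z /\ vpick Z != 0.
  by move=> dZ; rewrite memv_pick vpick0 -dimv_eq0 (eqP dZ).
have [h1 h2] := pick _ _ dU; have [h3 h4] := pick _ _ dU'.
by exists (vpick U, vpick U'); split.
Qed.

Lemma bihomog1 : bihomog 0 0 1.
Proof.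
move=> m; rewrite msupp1 inE => /eqP ->.
by split; apply: big1 => i _; rewrite mnm0E.
Qed.

Lemma bihomogM a b c d f g :
  bihomog a b f -> bihomog c d g -> bihomog (a + c) (b + d) (f * g).
Proof.
move=> hf hg m /msuppM_le /allpairsP [[m1 m2] /= [/hf [h1 h2] /hg [h3 h4] ->]].
split; [rewrite -h1 -h3|rewrite -h2 -h4]; rewrite -big_split /=.
  by apply: eq_bigr => i _; rewrite mnmDE.
by apply: eq_bigr => i _; rewrite mnmDE.
Qed.

Lemma bihomogB a b f g : bihomog a b f -> bihomog a b g -> bihomog a b (f - g).
Proof.
by move=> hf hg m /msuppB_le; rewrite mem_cat => /orP[/hf|/hg].
Qed.

Lemma peval1 x : peval 1 x = 1.
Proof. by rewrite /peval meval1. Qed.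

Lemma pevalM f g x : peval (f * g) x = peval f x * peval g x.
Proof. by rewrite /peval mevalM. Qed.

Lemma pevalB f g x : peval (f - g) x = peval f x - peval g x.
Proof. by rewrite /peval mevalB. Qed.

Fact zariski_openT : zariski_open setT.
Proof.
exists [set 1]; split=> [_ ->|]; first by exists 0%N, 0%N; apply: bihomog1.
apply/seteqP; split=> // P _; exists 1 => // x _.
by rewrite peval1 oner_eq0.
Qed.

Fact zariski_openI : setI_closed zariski_open.
Proof.
move=> _ _ [F [hF ->]] [G [hG ->]].
exists [set f * g | f in F & g in G]; split.
  move=> _ [f /hF [a [b hf]]] [g /hG [c [d hg]]] <-.
  by exists (a + c)%N, (b + d)%N; apply: bihomogM.
apply/seteqP; split=> P /=.
  case=> -[f Ff hf] [g Gg hg]; exists (f * g); first by exists f => //; exists g.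
  by move=> x Px; rewrite pevalM mulf_neq0 ?hf ?hg.
case=> _ [f Ff [g Gg <-]] h; split; [exists f|exists g] => // x /h;
  by rewrite pevalM mulf_eq0 => /norP[].
Qed.

Fact zariski_open_bigU (I : Type) (U : I -> set (biproj V W)) :
  (forall i, zariski_open (U i)) -> zariski_open (\bigcup_i U i).
Proof.
move=> hU; pose G i := projT1 (cid (hU i)).
have hG i : _ /\ _ := projT2 (cid (hU i)).
exists (\bigcup_i G i); split=> [f [i _]|]; first exact: (hG i).1.
apply/seteqP; split=> P.
  by case=> i _; rewrite (hG i).2 => -[f Gf hf]; exists f => //; exists i.
by case=> f [i _ Gf] hf; exists i => //; rewrite (hG i).2; exists f.
Qed.

HB.instance Definition _ := isOpenTopological.Build (biproj V W)
  zariski_openT zariski_openI zariski_open_bigU.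

Variable X : set (biproj V W).

(* [s] restricts to a section over X `&` U of the restriction of O(a, b) to
   the reduced subscheme X.  Only the values of s at the representatives of
   points of X `&` U matter. *)
Definition is_section (U : set (biproj V W)) (a b : nat) (s : V * W -> k) :=
  forall P, X P -> U P -> exists c d f g,
    [/\ bihomog (a + c) (b + d) f, bihomog c d g &
      nbhs P [set Q | X Q -> U Q -> forall x, rep Q x ->
        peval g x != 0 /\ s x = peval f x / peval g x]].

(* dim_k H^0(X, O_X(a, b)) = N: there is a family of N global sections in which
   every global section has unique coordinates. *)
Definition has_h0 (a b N : nat) : Prop :=
  exists e : 'I_N -> V * W -> k,
    (forall t, is_section setT a b (e t)) /\
    (forall s, is_section setT a b s -> exists! c : 'rV[k]_N,
      forall P x, X P -> rep P x -> s x = \sum_t c 0 t * e t x).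

(* H is eventually equal to the bivariate Hilbert function of X. *)
Definition eventual_hilbert_function (H : nat -> nat -> nat) : Prop :=
  exists N, forall a b, (N <= a)%N -> (N <= b)%N -> has_h0 a b (H a b).

Record scheme_point := SchemePoint {
  sp_set :> set (biproj V W);
  sp_closed : closed sp_set;
  sp_irr : irreducible sp_set;
  sp_sub : sp_set `<=` X
}.

Section LocalRing.
Variable Y : scheme_point.

(* The open sets containing the generic point of Y are those meeting Y.
   The stalk of O_X at this point is the quotient of the ring of the functions
   that are sections over some such set by the ideal of those that vanish on
   some such set. *)
Definition regular_at : {pred V * W -> k} := fun s =>
  `[< exists U, [/\ open U, Y `&` U !=set0 & is_section U 0 0 s] >].

Definition zero_germ (s : V * W -> k) : Prop :=
  exists U, [/\ open U, Y `&` U !=set0 &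
    forall P x, X P -> U P -> rep P x -> s x = 0].

Lemma scheme_point_openI (U1 U2 : set (biproj V W)) : open U1 -> open U2 ->
  Y `&` U1 !=set0 -> Y `&` U2 !=set0 -> Y `&` (U1 `&` U2) !=set0.
Proof.
move=> o1 o2 [P [YP UP]] [Q [YQ UQ]]; apply: contrapT => h.
case: (sp_irr Y) => _ /(_ (~` U1) (~` U2)) [||||].
- exact: open_closedC.
- exact: open_closedC.
- move=> R YR; rewrite -setCI => UR; apply: h; by exists R.
- by move=> /(_ P YP).
- by move=> /(_ Q YQ).
Qed.

Lemma is_sectionS (U U' : set (biproj V W)) a b s :
  U' `<=` U -> is_section U a b s -> is_section U' a b s.
Proof.
move=> sU hs P XP UP; have [c [d [f [g [hf hg h]]]]] := hs P XP (sU _ UP).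
exists c, d, f, g; split=> //; apply: filterS h => Q h XQ UQ.
exact: h XQ (sU _ UQ).
Qed.

Fact regular_at_subring : GRing.subring_closed regular_at.
Proof.
split.
- apply/asboolP; exists setT; split; first exact: openT.
    by rewrite setIT; apply: (sp_irr Y).1.
  move=> P _ _; exists 0%N, 0%N, 1, 1; split; try exact: bihomog1.
  apply: filterE => Q _ _ x _; rewrite peval1 oner_eq0 divr1; by split.
- move=> s s' /asboolP[U [oU YU hs]] /asboolP[U' [oU' YU' hs']].
  apply/asboolP; exists (U `&` U'); split; first exact: openI.
    exact: scheme_point_openI.
  move=> P XP [UP UP'].
  have [c [d [f [g [hf hg h]]]]] := hs P XP UP.
  have [c' [d' [f' [g' [hf' hg' h']]]]] := hs' P XP UP'.
  exists (c + c')%N, (d + d')%N, (f * g' - f' * g), (g * g'); split.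
  + apply: bihomogB; first by rewrite !add0n; exact: bihomogM hf hg'.
    by rewrite !add0n (addnC c) (addnC d); exact: bihomogM hf' hg.
  + exact: bihomogM.
  + apply: filterS2 h h' => Q h h' XQ [UQ UQ'] x Qx.
    have [g0 sE] := h XQ UQ x Qx; have [g0' sE'] := h' XQ UQ' x Qx.
    rewrite !(pevalM, pevalB) mulf_neq0 //; split=> //.
    by rewrite -mulNr -addf_div ?mulNr // -sE -sE'.
- move=> s s' /asboolP[U [oU YU hs]] /asboolP[U' [oU' YU' hs']].
  apply/asboolP; exists (U `&` U'); split; first exact: openI.
    exact: scheme_point_openI.
  move=> P XP [UP UP'].
  have [c [d [f [g [hf hg h]]]]] := hs P XP UP.
  have [c' [d' [f' [g' [hf' hg' h']]]]] := hs' P XP UP'.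
  exists (c + c')%N, (d + d')%N, (f * f'), (g * g'); split.
  + by rewrite !add0n; exact: bihomogM hf hf'.
  + exact: bihomogM.
  + apply: filterS2 h h' => Q h h' XQ [UQ UQ'] x Qx.
    have [g0 sE] := h XQ UQ x Qx; have [g0' sE'] := h' XQ UQ' x Qx.
    rewrite !pevalM mulf_neq0 //; split=> //.
    by rewrite -mulf_div -sE -sE'.
Qed.

Record regular_fun : Type := RegularFun {
  rf_val :> V * W -> k;
  rf_regular : rf_val \in regular_at
}.
HB.instance Definition _ := [isSub for rf_val].
HB.instance Definition _ := [Choice of regular_fun by <:].
HB.instance Definition _ := GRing.SubChoice_isSubComPzRing.Build
  (V * W -> k : comPzRingType) regular_at regular_fun regular_at_subring.

Lemma zero_germN1 : ~ zero_germ (fun=> 1).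
Proof.
case=> U [_ [P [YP UP]] h]; have [x Px] := rep_neq0 P.
by have /eqP := h P x (sp_sub YP) UP Px; rewrite oner_eq0.
Qed.

Fact regular_fun_neq0 : (1 : regular_fun) != 0.
Proof.
apply/eqP => /(congr1 val) E; apply: zero_germN1.
have E' (x : V * W) : 1 = 0 :> k by have := congr1 (fun s : V * W -> k => s x) E.
by exists setT; split=> [||P x _ _ _]; [exact: openT
  |rewrite setIT; apply: (sp_irr Y).1|exact: E'].
Qed.
HB.instance Definition _ :=
  GRing.PzSemiRing_isNonZero.Build regular_fun regular_fun_neq0.

Definition zero_germ_ideal : {pred regular_fun} := fun s => `[< zero_germ s >].

Fact zero_germ_idealr_closed : idealr_closed zero_germ_ideal.
Proof.
split.
- apply/asboolP; exists setT; split=> //; first exact: openT.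
  by rewrite setIT; apply: (sp_irr Y).1.
- by apply/asboolP; apply: zero_germN1.
- move=> r s s' /asboolP[U [oU YU h]] /asboolP[U' [oU' YU' h']].
  apply/asboolP; exists (U `&` U'); split; first exact: openI.
    exact: scheme_point_openI.
  move=> P x XP [UP UP'] Px.
  have -> : (r * s + s' : regular_fun) x = r x * s x + s' x by [].
  by rewrite (h P) // (h' P) // mulr0 addr0.
Qed.
HB.instance Definition _ :=
  isIdealr.Build regular_fun zero_germ_ideal zero_germ_idealr_closed.

Definition stalk : comNzRingType := {ideal_quot zero_germ_ideal}.

End LocalRing.

Definition cohen_macaulay : Prop :=
  forall Y : scheme_point, cohen_macaulay_ring (stalk Y).

End BiProj.

Section LinkedProj.
Variables (k : fieldType) (n : nat) (L : linked_seq k n) (i j : int).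

(* For v in V^(l), [ls_map L l (l - 1) v] is h_(l-1)(v). *)
Definition ls_proj_open (l : int) : set (biproj (L i) (L j)) :=
  [set P | exists v : L l,
    [/\ ls_up L l v != 0, ls_map L l (l - 1) v != 0,
        val P.1 = <[ls_map L l i v]>%VS & val P.2 = <[ls_map L l j v]>%VS]].

Definition ls_proj_comp (l : int) : set (biproj (L i) (L j)) :=
  closure (ls_proj_open l).

Definition ls_proj : set (biproj (L i) (L j)) :=
  \bigcup_(l in [set l : int | i <= l <= j]) ls_proj_comp l.

End LinkedProj.

Arguments ls_proj_open {k n} L i j l _.
Arguments ls_proj_comp {k n} L i j l _.
Arguments ls_proj {k n} L i j _.

(* Main.v *)
(* For i <= l <= j let E_l be the image of V^(l) in V^(i) x V^(j) under
   (h_l^i, h_l^j).  The relations between E_l and E_(l+1) make the domains and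
   kernels of these relations two opposite flags, so there are bases (a_s) of
   V^(i) and (b_s) of V^(j), and a nondecreasing function pos of s < n, with
     E_(i+p) = {(sum_(pos s >= 2p) w_s a_s, sum_(pos s <= 2p) w_s b_s)}.
   The sequence is exact if and only if pos takes only even values.  In the
   coordinates x, y of these bases, the component of index i + p is given by
   x_s = 0 for pos s < 2p, y_s = 0 for pos s > 2p, and x_s y_t = x_t y_s for
   pos s = pos t = 2p.

   If all values of pos are even, then the ring of the chart x_s = y_t = 1 is a
   free module of finite rank over the polynomial ring in the n - 1 elements y_q
   (q < t), x_q + y_(q+1) (t <= q < s) and x_q (q > s).  This bounds the lengths
   of chains of primes.
   Given a prime P, take a maximal set of the variables in which no nonzero
   polynomial lies in P: for every other variable, P contains a polynomial in it
   whose leading coefficient is invertible at P, and these form a regular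
   sequence.  Hence the dimension and the Cohen-Macaulay property.

   The restriction of a section of O(a, b) to a component is a polynomial in w,
   homogeneous of degree a + b, since it is polynomial along enough lines.  So every
   section is a combination of the standard monomials
   y_(s_1) .. y_(s_b) x_(s_(b+1)) .. x_(s_(a+b)) with s_1 <= .. <= s_(a+b), and
   those that do not vanish on P(V) are independent.  There are
   binomial(a+b+n-1, n-1) standard monomials; if pos r is odd, the one with all
   indices equal to r vanishes on P(V). *)
Require Import Defs.
From HB Require Import structures.
From mathcomp Require Import all_boot all_order all_algebra generic_quotient ring_quotient.
From mathcomp Require Import boolp classical_sets functions topology_structure connected.
From mathcomp Require Import fingroup perm mpoly zify ring.
Import Defs.
Set Implicit Arguments.
Unset Strict Implicit.
Unset Printing Implicit Defensive.
Import Order.TTheory GRing.Theory Num.Theory.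
Local Open Scope classical_set_scope.
Local Open Scope quotient_scope.
Local Open Scope ring_scope.

(** * Polynomial functions *)

(** Doubling the indices makes room for the failure of exactness: a basis vector of position
    [2p + 1] sits strictly between the neighbours E_(i+p) and E_(i+p+1), where there is no
    component. Exactness enters everywhere in one form: each value of [pos] is the index of a
    component.

    Ideals are handled through values at points, which is sound because the scheme is reduced and a
    polynomial over k is determined by its values. The delicate point is the freeness of the chart
    ring. Spanning is a rewriting with the equations common to all components. Independence needs
    enough points of X over a general value of the n - 1 parameters. For a class of m equal
    positions strictly between those of t and s, such points come from the m roots of a polynomial
    whose coefficients are m + 1 consecutive parameters; this is where algebraic closure is
    essential.

    Dimension theory is replaced by counting: each strict inclusion in a chain of primes multiplies
    the number of linearly independent elements by m, while a finite free module over N variables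
    has room for a multiple of m^N only. *)

Section PolynomialFunctions.
Variable k : closedFieldType.

(** If p is nonzero, ['X * p + 1] is not constant; at one of its roots p does not vanish. *)
Lemma poly_eval_eq0 (p : {poly k}) : (forall x, p.[x] = 0) -> p = 0.
Proof.
move=> h; apply/eqP/negPn/negP => p0.
have : size ('X * p + 1) != 1%N.
  rewrite size_polyDl mulrC size_mulX // ?size_poly1 ?eqSS ?size_poly_eq0 //.
  by rewrite ltnS lt0n size_poly_eq0.
by case/closed_rootP=> x; rewrite rootE !hornerE h mulr0 add0r oner_eq0.
Qed.

Lemma poly_eval_eq0_off (q p : {poly k}) : q != 0 ->
  (forall x, q.[x] != 0 -> p.[x] = 0) -> p = 0.
Proof.
move=> q0 h; apply/eqP; have /eqP : p * q = 0.
  apply: poly_eval_eq0 => x; rewrite hornerM.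
  by have [->|/h->] := eqVneq q.[x] 0; rewrite ?mulr0 ?mul0r.
by rewrite mulf_eq0 (negPf q0) orbF.
Qed.

Lemma poly_eval_inj (p q : {poly k}) : (forall x, p.[x] = q.[x]) -> p = q.
Proof.
move=> h; apply/eqP; rewrite -subr_eq0; apply/eqP/poly_eval_eq0 => x.
by rewrite !hornerE h subrr.
Qed.

Lemma neq0_outside (s : seq k) : exists2 x, x != 0 & x \notin s.
Proof.
pose q : {poly k} := 'X * \prod_(a <- s) ('X - a%:P).
have q0 : q != 0 by rewrite mulf_neq0 ?polyX_eq0 // monic_neq0 // monic_prod_XsubC.
have [x qx] : exists x, q.[x] != 0.
  apply: contrapT => h; move/eqP: q0; apply; apply: poly_eval_eq0 => x.
  by apply: contrapT => /eqP hx; apply: h; exists x.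
exists x; first by apply: contraNneq qx => ->; rewrite hornerM hornerX mul0r.
apply: contraNN qx => xs; rewrite hornerM [X in _ * X](_ : _ = 0) ?mulr0 //.
by apply/eqP; rewrite -[_ == 0]/(root _ x) root_prod_XsubC.
Qed.

Section Multivariate.
Variable n : nat.
Implicit Types (p : {mpoly k[n]}) (w : 'I_n -> nat) (v : 'I_n -> k).

Definition wdeg w (m : 'X_{1..n}) : nat := (\sum_s w s * m s)%N.

Definition wpart w (e : nat) p : {mpoly k[n]} :=
  \sum_(m <- msupp p | wdeg w m == e) p@_m *: 'X_[m].

Lemma mcoeff_wpart w e p m :
  (wpart w e p)@_m = if wdeg w m == e then p@_m else 0.
Proof.
rewrite /wpart raddf_sum /=.
have [ms|ms] := boolP (m \in msupp p); last first.
  rewrite big1_seq => [|m' /andP[_ m's]].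
    by rewrite (memN_msupp_eq0 ms); case: ifP.
  rewrite mcoeffZ mcoeffX; case: eqP => [e'|]; last by rewrite mulr0.
  by rewrite -e' m's in ms.
rewrite big_mkcond (bigD1_seq m) ?msupp_uniq //= big1 ?addr0 => [|m' m'm].
  by case: ifP; rewrite // mcoeffZ mcoeffX eqxx mulr1.
by case: ifP; rewrite // mcoeffZ mcoeffX (negPf m'm) mulr0.
Qed.

(** Along the curve with coordinates [t ^+ w s * v s] a monomial m contributes a multiple of
    [t ^+ wdeg w m], so the coefficients of the restriction are the values of the weighted parts. *)
Lemma wpart_eval w p v (F : {poly k}) :
  (forall t, p.@[fun s => t ^+ w s * v s] = F.[t]) ->
  forall e, (wpart w e p).@[v] = F`_e.
Proof.
move=> h e.
have -> : F = \sum_(m <- msupp p) (p@_m * \prod_i v i ^+ m i) *: 'X^(wdeg w m).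
  apply: poly_eval_inj => t; rewrite -h mevalE horner_sum.
  apply: eq_bigr => m _; rewrite hornerZ hornerXn -mulrA; congr (_ * _).
  rewrite mulrC /wdeg -prodrXr -big_split /=; apply: eq_bigr => s _.
  by rewrite exprMn exprM.
rewrite coef_sum /wpart raddf_sum /= [RHS](bigID (fun m => wdeg w m == e)) /=.
rewrite [X in _ = _ + X]big1 ?addr0 => [|m me].
  apply: eq_bigr => m /eqP me.
  by rewrite mevalZ mevalX coefZ coefXn me eqxx mulr1.
by rewrite coefZ coefXn eq_sym (negPf me) mulr0.
Qed.

Lemma mpoly_eval_eq0 p : (forall v, p.@[v] = 0) -> p = 0.
Proof.
(* Induction on the number i of variables whose exponent may vary over the support; the weight of a
   single variable splits p into parts where its exponent is fixed. *)
suff h i : (i <= n)%N -> forall p, (forall v, p.@[v] = 0) ->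
    (forall m m', m \in msupp p -> m' \in msupp p ->
       forall s : 'I_n, (i <= s)%N -> m s = m' s) -> p = 0.
  by move=> p0; apply: (h n) => // m m' _ _ s; rewrite leqNgt ltn_ord.
elim: i => [_|i IH lin] q q0 hq.
  have [->//|nz] := eqVneq q 0; have ms := mlead_supp nz.
  have := q0 (fun=> 1).
  rewrite mevalE (bigD1_seq (mlead q)) ?msupp_uniq //= [X in _ + X]big1_seq.
    rewrite addr0 big1 => [|s _]; last exact: expr1n.
    by rewrite mulr1 => /eqP; rewrite mleadc_eq0 => /eqP.
  by move=> m /andP[/eqP mm sm]; case: mm; apply/mnmP => s; apply: hq.
pose s0 := Ordinal lin; pose w (s : 'I_n) := (s == s0 : nat).
have wE m : wdeg w m = m s0.
  rewrite /wdeg (bigD1 s0) //= /w eqxx mul1n big1 ?addn0 // => s /negPf->.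
  by rewrite mul0n.
apply/mpolyP => m; rewrite mcoeff0.
have : wpart w (m s0) q = 0.
  apply: IH; first exact: ltnW.
    move=> v; rewrite (@wpart_eval w q v 0) ?coef0 // => t.
    by rewrite q0 horner0.
  move=> m1 m2; rewrite !mcoeff_msupp !mcoeff_wpart !wE.
  case: ifP => [/eqP e1|_]; last by rewrite eqxx.
  case: ifP => [/eqP e2|_]; last by rewrite eqxx.
  rewrite -!mcoeff_msupp => h1 h2 s.
  rewrite leq_eqVlt => /orP[/eqP si|]; last exact: hq.
  by have -> : s = s0; [exact: val_inj|rewrite e1 e2].
by move/mpolyP/(_ m); rewrite mcoeff_wpart mcoeff0 wE eqxx.
Qed.

Lemma mpoly_eval_inj p q : (forall v, p.@[v] = q.@[v]) -> p = q.
Proof.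
move=> h; apply/eqP; rewrite -subr_eq0; apply/eqP/mpoly_eval_eq0 => x.
by rewrite mevalB h subrr.
Qed.

(** Degree bounds are read off from values: if no restriction to a weighted curve has a coefficient
    in a [bad] degree, the weighted parts of these degrees vanish as functions, hence as
    polynomials. *)
Lemma msupp_wdeg w p (bad : pred nat) :
  (forall v, exists F : {poly k}, (forall e, bad e -> F`_e = 0) /\
     forall t, p.@[fun s => t ^+ w s * v s] = F.[t]) ->
  forall m, m \in msupp p -> ~~ bad (wdeg w m).
Proof.
move=> h m; rewrite mcoeff_msupp => pm; apply: contraNN pm => bm.
have : wpart w (wdeg w m) p = 0.
  apply: mpoly_eval_eq0 => v; have [F [F0 hF]] := h v.
  by rewrite (wpart_eval hF) F0.
by move/mpolyP/(_ m); rewrite mcoeff_wpart mcoeff0 eqxx => ->.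
Qed.

Lemma mpoly_curve p (c : 'I_n -> {poly k}) :
  exists F : {poly k}, forall t, p.@[fun s => (c s).[t]] = F.[t].
Proof.
exists (mmap polyC c p) => t; rewrite mevalE /mmap horner_sum.
apply: eq_bigr => m _; rewrite hornerM hornerC /mmap1 horner_prod.
by congr (_ * _); apply: eq_bigr => s _; rewrite horner_exp.
Qed.

Lemma mpoly_line p v v' :
  exists F : {poly k}, forall t, p.@[fun s => v s + t * v' s] = F.[t].
Proof.
have [F hF] := mpoly_curve p (fun s => (v s)%:P + v' s *: 'X).
exists F => t; rewrite -hF; apply: meval_eq => s.
by rewrite !hornerE mulrC.
Qed.

Definition upd v (s : 'I_n) (t : k) : 'I_n -> k :=
  fun r => if r == s then t else v r.

Lemma upd_upd v s t t' : upd (upd v s t) s t' = upd v s t'.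
Proof. by apply/funext => r; rewrite /upd; case: eqP. Qed.

Lemma updC v s s' t t' : s != s' ->
  upd (upd v s t) s' t' = upd (upd v s' t') s t.
Proof.
move=> ss; apply/funext => r; rewrite /upd.
case: (eqVneq r s') => // ->; by rewrite eq_sym (negPf ss).
Qed.

Lemma upd_same v s : upd v s (v s) = v.
Proof. by apply/funext => r; rewrite /upd; case: eqP => // ->. Qed.

Lemma lagrange (d : nat) (c : 'I_d.+1 -> k) : injective c ->
  exists l : 'I_d.+1 -> {poly k}, forall F : {poly k}, (size F <= d.+1)%N ->
    F = \sum_j F.[c j] *: l j.
Proof.
move=> inj.
pose q j : {poly k} := \prod_(j' | j' != j) ('X - (c j')%:P).
have qE j j' : (q j).[c j'] = (j == j')%:R * (q j).[c j].
  case: eqVneq => [->|jj']; first by rewrite mul1r.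
  rewrite mul0r /q horner_prod; apply/eqP; rewrite prodf_seq_eq0.
  apply/hasP; exists j'; rewrite ?mem_index_enum //= eq_sym jj'.
  by rewrite !hornerE subrr eqxx.
have q0 j : (q j).[c j] != 0.
  rewrite /q horner_prod prodf_seq_neq0; apply/allP => j' _.
  apply/implyP => jj; rewrite !hornerE subr_eq0; apply: contraNneq jj.
  by move/inj->.
exists (fun j => (q j).[c j]^-1 *: q j) => F sF.
have szq j : (size (q j) <= d.+1)%N.
  rewrite /q -big_filter size_prod_XsubC ltnS size_filter.
  by rewrite -sum1_count (eq_bigl (mem (predC1 j))) // sum1_card cardC1 card_ord.
apply/eqP; rewrite -subr_eq0; apply/eqP.
apply: (@roots_geq_poly_eq0 _ _ [seq c j | j <- enum 'I_d.+1]).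
- apply/allP => _ /mapP[j _ ->]; rewrite rootE hornerD hornerN horner_sum.
  rewrite (bigD1 j) //= !hornerZ mulVf // mulr1 big1 ?addr0 ?subrr //.
  by move=> j' jj; rewrite !hornerZ (qE j' j) (negPf jj) mul0r !mulr0.
- by rewrite map_inj_uniq ?enum_uniq.
- rewrite size_map size_enum_ord; apply: leq_trans (size_polyD _ _) _.
  rewrite geq_max sF size_polyN; apply: leq_trans (size_sum _ _ _) _.
  apply/bigmax_leqP => j _; do 2 apply: leq_trans (size_scale_leq _ _) _.
  exact: szq.
Qed.

Lemma exists_distinct d : exists c : 'I_d -> k, injective c.
Proof.
have [s [us ss]] : exists s : seq k, uniq s /\ size s = d.
  elim: d => [|d [s [us ss]]]; first by exists [::].
  by have [x _ xs] := neq0_outside s; exists (x :: s); rewrite /= xs us ss.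
exists (fun j => s`_j) => j j' /eqP; rewrite nth_uniq ?ss //.
by move/eqP/val_inj.
Qed.

(** The uniform bound d allows interpolation in one variable at fixed nodes; the values at the nodes
    are functions of one variable less. *)
Lemma poly_in_each_variable (d : nat) (f : ('I_n -> k) -> k) :
  (forall v s, exists F : {poly k}, (size F <= d.+1)%N /\
     forall t, f (upd v s t) = F.[t]) ->
  exists p, forall v, f v = p.@[v].
Proof.
have [c injc] := exists_distinct d.+1; have [l hl] := lagrange injc.
suff h i : (i <= n)%N -> forall f,
    (forall v s, exists F : {poly k}, (size F <= d.+1)%N /\
       forall t, f (upd v s t) = F.[t]) ->
    (forall v (s : 'I_n) t, (i <= s)%N -> f (upd v s t) = f v) ->
    exists p, forall v, f v = p.@[v].
  move=> hf; apply: (h n) => // v s t; by rewrite leqNgt ltn_ord.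
elim: i => [_|i IH lin] {}f hf hi.
  (* No variable matters any more, so all of them can be set to 0, one after the other. *)
  exists (f (fun=> 0))%:MP => v; rewrite mevalC.
  suff hs : forall s : seq 'I_n, f v = f (fun r => if r \in s then 0 else v r).
    rewrite (hs (enum 'I_n)); congr f; apply/funext => r.
    by rewrite mem_enum.
  elim=> [|s ss IHs]; first by congr f; apply/funext.
  rewrite IHs -(hi _ s 0) //; congr f; apply/funext => r.
  by rewrite /upd inE; case: eqP.
pose s0 := Ordinal lin.
have /choice[p hp] : forall j, exists q : {mpoly k[n]},
    forall v, f (upd v s0 (c j)) = q.@[v].
  move=> j; apply: (IH (ltnW lin)) => [v s|v s t ls].
    have [ss|ss] := eqVneq s s0.
      exists (f (upd v s0 (c j)))%:P; split=> [|t].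
        exact: leq_trans (size_polyC_leq1 _) _.
      by rewrite ss upd_upd hornerC.
    have [F [sF hF]] := hf (upd v s0 (c j)) s.
    by exists F; split=> // t; rewrite updC // hF.
  have [ss|ss] := eqVneq s s0; first by rewrite ss upd_upd.
  rewrite updC // hi // ltn_neqAle ls andbT; apply: contraNneq ss => e.
  by apply/eqP/val_inj.
(* Lagrange's formula in the variable [s0]; the inner sum is [l j] evaluated at ['X_s0]. *)
exists (\sum_j p j *
         \sum_(e < size (l j)) (l j)`_e *: 'X_s0 ^+ e) => v.
have [F [sF hF]] := hf v s0.
rewrite -{1}(upd_same v s0) hF (hl F sF) horner_sum raddf_sum /=.
apply: eq_bigr => j _; rewrite hornerZ -hF hp mevalM.
congr (_ * _); rewrite horner_coef raddf_sum /=; apply: eq_bigr => e _.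
by rewrite mevalZ rmorphXn /= mevalXU.
Qed.

End Multivariate.
End PolynomialFunctions.

(** * Prime ideals and regular sequences *)

Section PrimeIdeals.
Variable A : comNzRingType.
Implicit Types (I J P : set A) (s : seq A).

Definition is_ideal I : Prop :=
  I 0 /\ forall r x y, I x -> I y -> I (r * x + y).

Definition is_prime P : Prop :=
  [/\ is_ideal P, ~ P 1 & forall x y, P (x * y) -> P x \/ P y].

Lemma ideal_add I x y : is_ideal I -> I x -> I y -> I (x + y).
Proof. by move=> [_ h] Ix Iy; have := h 1 x y Ix Iy; rewrite mul1r. Qed.

Lemma ideal_mul I r x : is_ideal I -> I x -> I (r * x).
Proof. by move=> [I0 h] Ix; have := h r x 0 Ix I0; rewrite addr0. Qed.

Lemma ideal_sub I x y : is_ideal I -> I x -> I y -> I (x - y).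
Proof.
by move=> [_ h] Ix Iy; have := h (- 1) y x Iy Ix; rewrite mulN1r addrC.
Qed.

Lemma ideal_sum I (T : Type) (r : seq T) (D : pred T) (F : T -> A) :
  is_ideal I -> (forall t, D t -> I (F t)) -> I (\sum_(t <- r | D t) F t).
Proof.
move=> hI hF; elim/big_ind: _ => //; first exact: hI.1.
by move=> x y; apply: ideal_add.
Qed.

Lemma ideal_generated s : is_ideal (generated s).
Proof.
split; first by exists (fun=> 0); rewrite big1 // => t _; rewrite mul0r.
move=> r x y [c ->] [d ->]; exists (fun t => r * c t + d t).
rewrite big_distrr -big_split /=; apply: eq_bigr => t _.
by rewrite mulrDl mulrA.
Qed.

Lemma generated_mem s x : x \in s -> generated s x.
Proof.
move=> xs; have ls : (index x s < size s)%N by rewrite index_mem.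
exists (fun t => (val t == index x s)%:R); rewrite (bigD1 (Ordinal ls)) //=.
rewrite eqxx mul1r nth_index // big1 ?addr0 // => t /negPf.
by rewrite -val_eqE /= => ->; rewrite mul0r.
Qed.

Lemma generated_min J s :
  is_ideal J -> (forall x, x \in s -> J x) -> generated s `<=` J.
Proof.
move=> hJ h x [c ->]; apply: ideal_sum => // t _.
by apply: ideal_mul => //; apply/h/mem_nth.
Qed.

(** An ideal maximal among those that contain I and miss the multiplicative set M is prime. *)
Lemma prime_avoiding (M I : set A) : is_ideal I -> M 1 ->
  (forall x y, M x -> M y -> M (x * y)) -> (forall x, M x -> ~ I x) ->
  exists P, [/\ is_prime P, I `<=` P & forall x, M x -> ~ P x].
Proof.
move=> hI M1 MM MI.
(* The union with I, not J itself, is required to be an ideal, so that the empty union of the empty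
   chain is admissible in Zorn's lemma. *)
pose good J := is_ideal (I `|` J) /\ forall x, M x -> ~ (I `|` J) x.
have [F Fg Ftot|J [[hJ MJ] Jmax]] := @Zorn_bigcup A good.
  split; last first.
    by move=> x Mx [/(MI _ Mx)//|[X FX Xx]]; apply: (Fg _ FX).2 Mx _; right.
  split; first by left; exact: hI.1.
  move=> r x y [Ix|[X FX Xx]] [Iy|[Y FY Yy]].
  - by left; apply: hI.2.
  - have [||z|z] := (Fg _ FY).1.2 r x y; [by left|by right|by left|].
    by right; exists Y.
  - have [||z|z] := (Fg _ FX).1.2 r x y; [by right|by left|by left|].
    by right; exists X.
  - have [Z [FZ Zx Zy]] : exists Z, [/\ F Z, Z x & Z y].
      have [XY|YX] := Ftot _ _ FX FY; first by exists Y; split=> //; apply: XY.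
      by exists X; split=> //; apply: YX.
    have [||z|z] := (Fg _ FZ).1.2 r x y; [by right|by right|by left|].
    by right; exists Z.
pose K := I `|` J; exists K; split=> //; last by move=> x; left.
split=> //; first exact: MJ.
move=> x y Kxy; apply: contrapT => /not_orP[nKx nKy].
(* By maximality the ideal generated by K and an element z outside it meets M. Two such elements of
   M, for x and y, have their product in K as soon as K contains x * y. *)
have ext z : ~ K z -> exists a b, K b /\ M (a * z + b).
  move=> nKz; pose Q : set A := [set w | exists a b, K b /\ w = a * z + b].
  have KQ : K `<=` Q by move=> w Kw; exists 0, w; rewrite mul0r add0r.
  have hQ : is_ideal Q.
    split; first by apply: KQ; apply: hJ.1.
    move=> r _ _ [a [b [Kb ->]]] [a' [b' [Kb' ->]]].
    exists (r * a + a'), (r * b + b'); split; first exact: hJ.2.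
    by rewrite mulrDr mulrDl !mulrA addrACA.
  have IQ : I `|` Q = Q.
    apply/seteqP; split=> w; last by right.
    by case=> // Iw; apply: KQ; left.
  apply: contrapT => h; apply: (Jmax Q).
    split; first by move=> w Jw; apply: KQ; right.
    move=> QJ; apply: nKz; right; apply: QJ; exists 1, 0.
    by rewrite mul1r addr0; split=> //; apply: hJ.1.
  rewrite /good IQ; split=> // w Mw [a [b [Kb wE]]]; apply: h.
  by exists a, b; rewrite -wE.
have [a [b [Kb Mx]]] := ext _ nKx; have [c [d [Kd My]]] := ext _ nKy.
apply: (MJ _ (MM _ _ Mx My)); rewrite mulrDl; apply: ideal_add => //; last first.
  by rewrite mulrC; apply: ideal_mul.
rewrite mulrDr; apply: ideal_add => //; last exact: ideal_mul.
by rewrite mulrACA; apply: ideal_mul.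
Qed.

(* Q is obtained by avoiding the products of a power of [s`_t] with an element
   outside P; regularity says that they do not lie in the ideal generated by
   the first t elements. *)
Lemma regular_prime_step s t P : regular_sequence s -> (t < size s)%N ->
  is_prime P -> generated (take t.+1 s) `<=` P ->
  exists Q, [/\ is_prime Q, generated (take t s) `<=` Q, Q `<=` P &
                exists2 x, P x & ~ Q x].
Proof.
move=> [_ reg] ts [hP P1 Pp] sP.
have gs : generated (take t s) `<=` P.
  move=> x hx; apply: sP; move: hx; apply: generated_min.
    exact: ideal_generated.
  move=> z zs; apply: generated_mem; rewrite (take_nth 0 ts) mem_rcons inE zs.
  by rewrite orbT.
pose M : set A := [set z | exists y m, ~ P y /\ z = y * s`_t ^+ m].
have [||z [y [m [nPy ->]]]|Q [hQ IQ MQ]] :=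
    @prime_avoiding M _ (ideal_generated (take t s)).
- by exists 1, 0%N; rewrite mulr1.
- move=> _ _ [y [m [nPy ->]]] [y' [m' [nPy' ->]]].
  exists (y * y'), (m + m')%N; rewrite exprD mulrACA; split=> //.
  by case/Pp.
- elim: m => [|m IH]; first by rewrite mulr1 => /gs.
  by rewrite exprS mulrCA => /(reg _ ts).
exists Q; split=> // [x Qx|].
  apply: contrapT => nPx; apply: (MQ x) => //.
  by exists x, 0%N; rewrite mulr1.
exists s`_t.
  apply: sP; apply: generated_mem; rewrite (take_nth 0 ts) mem_rcons inE.
  by rewrite eqxx.
by apply: MQ; exists 1, 1%N; rewrite mul1r.
Qed.

Lemma prime_chain_sets d (P : nat -> set A) :
  (forall m, (m <= d)%N -> is_prime (P m)) ->
  (forall m, (m < d)%N -> P m `<=` P m.+1 /\ exists2 x, P m.+1 x & ~ P m x) ->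
  prime_chain d (fun m x => `[< P m x >]).
Proof.
move=> hP hS; split=> m /[dup] md; last first.
  move=> /hS[sub [x Px nPx]]; split.
    by move=> y /asboolP Py; apply/asboolP; apply: sub.
  by move/(_ x) => h; apply: nPx; apply/asboolP/h/asboolP.
move=> /hP[hI P1 Pp]; split; last first.
  move=> x y /asboolP/Pp[Px|Py]; apply/orP; [left|right]; exact/asboolP.
split; first by apply/asboolP; apply: hI.1.
  by apply/negP => /asboolP.
by move=> r x y /asboolP Px /asboolP Py; apply/asboolP/hI.2.
Qed.

(** The chain is built downwards from a prime containing all of s; j counts the steps made, and the
    prime of index m contains the first m elements, which makes the next step possible. *)
Lemma regular_prime_chain s : regular_sequence s ->
  exists P : nat -> {pred A}, prime_chain (size s) P.
Proof.
move=> reg.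
have h j : (j <= size s)%N -> exists P : nat -> set A,
    (forall m, (size s - j <= m <= size s)%N ->
       is_prime (P m) /\ generated (take m s) `<=` P m) /\
    (forall m, (size s - j <= m < size s)%N ->
       P m `<=` P m.+1 /\ exists2 x, P m.+1 x & ~ P m x).
  elim: j => [_|j IH js].
    have [|_ _ -> ->|x ->|Q [hQ IQ _]] :=
        @prime_avoiding [set 1] _ (ideal_generated s).
    - by [].
    - by rewrite /= mulr1.
    - exact: reg.1.
    exists (fun=> Q); split=> m; rewrite subn0 => /andP[h1 h2].
      have -> : m = size s by apply/eqP; rewrite eqn_leq h1 h2.
      by rewrite take_size.
    by move: (leq_trans h2 h1); rewrite ltnn.
  have [P [hP hS]] := IH (ltnW js).
  pose t := (size s - j.+1)%N; have tE : t.+1 = (size s - j)%N by rewrite subnSK.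
  have ts : (t < size s)%N by rewrite tE leq_subr.
  have [|h1 h2] := hP t.+1; first by rewrite tE leqnn leq_subr.
  have [Q [hQ IQ QP [x Px nQx]]] := regular_prime_step reg ts h1 h2.
  exists (fun m => if m == t then Q else P m); split=> m.
    rewrite -/t leq_eqVlt => /andP[/orP[/eqP<-|tm] ms]; first by rewrite eqxx.
    by rewrite gtn_eqF //; apply: hP; rewrite -tE tm.
  rewrite -/t leq_eqVlt => /andP[/orP[/eqP<-|tm] ms].
    by rewrite eqxx gtn_eqF //; split=> //; exists x.
  by rewrite !gtn_eqF ?(ltnW tm) //; [apply: hS; rewrite -tE tm|exact: ltnW].
have [P [hP hS]] := h _ (leqnn _).
exists (fun m x => `[< P m x >]); rewrite subnn in hP hS.
apply: prime_chain_sets => m ms; last exact: hS.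
exact: (hP _ ms).1.
Qed.

(** Every regular sequence yields a chain of primes of its own length, so a regular sequence as long
    as the bound on chains computes both the dimension and the depth. *)
Lemma cohen_macaulay_criterion s :
  (forall x, x \in s -> nonunit x) -> regular_sequence s ->
  (forall P : nat -> {pred A}, ~ prime_chain (size s).+1 P) -> cohen_macaulay_ring A.
Proof.
move=> su reg nch; exists (size s); split; split=> //.
- exact: regular_prime_chain.
- by exists s.
move=> s' _ reg'; rewrite leqNgt; apply/negP => ls.
have [P [h1 h2]] := regular_prime_chain reg'; apply: (nch P); split=> m ms.
  exact: h1 (leq_trans ms ls).
exact: h2 (leq_trans ms ls).
Qed.

End PrimeIdeals.

(** * Algebras that are free over a polynomial ring *)

Section FreeModulo.
Variables (k : fieldType) (N r : nat) (S : comNzRingType).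
Variables (eta : {rmorphism {mpoly k[N]} -> S}) (om : 'I_r -> S) (I : set S).
Implicit Types (f g : S) (b : 'I_r -> {mpoly k[N]}) (p : {mpoly k[N]}).

Definition expands f b : Prop := I (f - \sum_j eta (b j) * om j).

(** S modulo I is a free module over the polynomial ring with basis [om], expressed by congruences
    without forming the quotient. *)
Definition free_modulo : Prop :=
  [/\ is_ideal I, forall f, exists b, expands f b &
      forall b, I (\sum_j eta (b j) * om j) -> forall j, b j = 0].

Hypothesis fm : free_modulo.
Let hI : is_ideal I. Proof. by case: fm. Qed.

Lemma expands_uniq f b b' : expands f b -> expands f b' -> b =1 b'.
Proof.
case: fm => _ _ free h h' j; apply/eqP; rewrite -subr_eq0; apply/eqP.
apply: (free (fun j => b j - b' j)).
have := ideal_sub hI h' h; rewrite opprB addrCA [f - _ - f]addrAC subrr sub0r -sumrB.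
by congr I; apply: eq_bigr => i _; rewrite rmorphB mulrBl.
Qed.

Lemma expands_scale p f b : expands f b -> expands (eta p * f) (fun j => p * b j).
Proof.
move=> h; have := ideal_mul (eta p) hI h; congr I.
rewrite mulrBr; congr (_ - _); rewrite big_distrr /=; apply: eq_bigr => j _.
by rewrite rmorphM mulrA.
Qed.

Lemma expands_sum (T : finType) (F : T -> S) (b : T -> 'I_r -> {mpoly k[N]}) :
  (forall t, expands (F t) (b t)) -> expands (\sum_t F t) (fun j => \sum_t b t j).
Proof.
move=> h; rewrite /expands.
rewrite (_ : _ - _ = \sum_t (F t - \sum_j eta (b t j) * om j)).
  by apply: ideal_sum => // t _; apply: h.
rewrite big_split /= sumrN; congr (_ - _); rewrite exchange_big /=.
by apply: eq_bigr => j _; rewrite rmorph_sum big_distrl.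
Qed.

Lemma expands_cong f f' b : I (f' - f) -> expands f b -> expands f' b.
Proof.
by move=> h h'; have := ideal_add hI h h'; rewrite addrA subrK.
Qed.

(** An increasing filtration of S modulo I by finite-dimensional subspaces, given by the degrees of
    the coordinates. *)
Definition fdeg f (d : nat) : Prop :=
  exists2 b, expands f b & forall j, (msize (b j) <= d)%N.

Lemma fdeg_scale p f d : fdeg f d -> fdeg (eta p * f) (msize p + d).+1.
Proof.
case=> b hb hd; exists (fun j => p * b j); first exact: expands_scale.
move=> j; apply: leq_trans (msizeM_le _ _) _.
by rewrite ltnS leq_add2l.
Qed.

Lemma fdeg_exists f : exists d, fdeg f d.
Proof.
case: fm => _ /(_ f)[b hb] _; exists (\max_j msize (b j))%N; exists b => // j.
exact: leq_bigmax.
Qed.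

(** Multiplication by g has a matrix of polynomials in the basis [om]; the sizes of its entries
    bound the shift, independently of f. *)
Lemma fdeg_mul g : exists c, forall f d, fdeg f d -> fdeg (g * f) (d + c).
Proof.
case: fm => _ span _.
have /choice[be hbe] j : exists b, expands (g * om j) b by apply: span.
pose c := (\max_(p : 'I_r * 'I_r) msize (be p.1 p.2))%N.
exists c.+1 => f d [b hb hd].
exists (fun i => \sum_j b j * be j i).
  apply: (@expands_cong (\sum_j eta (b j) * (g * om j))); last first.
    by apply: expands_sum => j; apply: expands_scale.
  have := ideal_mul g hI hb; congr I; rewrite mulrBr; congr (_ - _).
  by rewrite big_distrr /=; apply: eq_bigr => j _; rewrite mulrCA.
move=> i; apply: leq_trans (msize_sum _ _ _) _; apply/bigmax_leqP => j _.
apply: leq_trans (msizeM_le _ _) _.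
rewrite addnS ltnS leq_add //.
exact: (@leq_bigmax _ (fun x : 'I_r * 'I_r => msize (be x.1 x.2)) (j, i)).
Qed.

Definition lin_indep (Q : set S) (T : finType) (F : T -> S) : Prop :=
  forall c : T -> k, Q (\sum_t eta (c t)%:MP * F t) -> forall t, c t = 0.

(** In a relation modulo Q, the lowest power of g can be cancelled because Q is prime; modulo Q',
    which contains g, only its cofactor remains, and that is a relation of the original family. *)
Lemma lin_indep_powers (Q Q' : set S) g (T : finType) (F : T -> S) m :
  is_prime Q -> is_ideal Q' -> Q `<=` Q' -> Q' g -> ~ Q g -> lin_indep Q' F ->
  lin_indep Q (fun p : 'I_m * T => g ^+ p.1 * F p.2).
Proof.
move=> [hQ Q1 Qp] hQ' QQ' Q'g Qg li c.
move=> h [j0 t]; pose G (j : 'I_m) := \sum_t eta (c (j, t))%:MP * F t.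
have {}h : Q (\sum_(j < m) g ^+ j * G j).
  have -> : \sum_(j < m) g ^+ j * G j =
      \sum_(j < m) \sum_t eta (c (j, t))%:MP * (g ^+ j * F t).
    apply: eq_bigr => j _; rewrite big_distrr /=.
    by apply: eq_bigr => t' _; rewrite mulrCA.
  rewrite pair_bigA /= (eq_bigr (fun x => eta (c x)%:MP * (g ^+ x.1 * F x.2))) //.
  by case.
have [e] := ubnP (val j0); elim: e j0 t => // e IH j0 t; rewrite ltnS => je.
have G0 (j : 'I_m) : (j < j0)%N -> G j = 0.
  move=> jj; rewrite /G big1 // => t' _.
  by rewrite IH ?(leq_trans jj) // raddf0 mul0r.
have {}h : Q (g ^+ j0 * \sum_(j < m | (j0 <= j)%N) g ^+ (j - j0) * G j).
  move: h; congr Q; rewrite (bigID (fun j : 'I_m => (j0 <= j)%N)) /= addrC big1.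
    rewrite add0r big_distrr /=; apply: eq_bigr => j jj.
    by rewrite mulrA -exprD subnKC.
  by move=> j; rewrite -ltnNge => /G0->; rewrite mulr0.
have powQ a z : Q (g ^+ a * z) -> Q z.
  elim: a => [|a IHa]; first by rewrite mul1r.
  by rewrite exprS -mulrA => /Qp[].
move/powQ/QQ' : h; rewrite (bigD1 j0) //= subnn mul1r => h.
apply: (li (fun t => c (j0, t))).
have {1}-> : \sum_t eta (c (j0, t))%:MP * F t = (G j0 +
    \sum_(i < m | (j0 <= i)%N && (i != j0)) g ^+ (i - j0) * G i) -
    \sum_(i < m | (j0 <= i)%N && (i != j0)) g ^+ (i - j0) * G i.
  by rewrite addrK.
apply: ideal_sub => //; apply: ideal_sum => // i /andP[ji ij].
have -> : (i - j0)%N = (i - j0).-1.+1.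
  by rewrite prednK // subn_gt0 ltn_neqAle ji andbT eq_sym.
by rewrite exprSr -mulrA [g * _]mulrC mulrA; apply: ideal_mul.
Qed.

Lemma card_bmultinom d : (#|{: 'X_{1..N < d}}| <= d ^ N)%N.
Proof.
have hm (m : 'X_{1..N < d}) i : (m i < d)%N.
  by apply: leq_ltn_trans (bmdeg m); rewrite mdegE (bigD1 i) //= leq_addr.
pose F (m : 'X_{1..N < d}) : {ffun 'I_N -> 'I_d} := [ffun i => Ordinal (hm m i)].
have injF : injective F.
  move=> m m' /ffunP h; apply/val_inj/mnmP => i.
  by have := h i; rewrite !ffunE => /(congr1 val).
by have := leq_card F injF; rewrite card_ffun !card_ord.
Qed.

(** The level d of the filtration has dimension at most [r * d ^ N]: a larger family has a
    coordinate matrix with more rows than columns, hence a linear relation. *)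
Lemma lin_indep_card (T : finType) (F : T -> S) d :
  lin_indep I F -> (forall t, fdeg (F t) d) -> (#|T| <= r * d ^ N)%N.
Proof.
move=> li hd.
have /choice[b hb] t : exists b, expands (F t) b /\ forall j, (msize (b j) <= d)%N.
  by have [b h1 h2] := hd t; exists b.
pose U := ('I_r * 'X_{1..N < d})%type.
apply: (@leq_trans #|{: U}|); last first.
  by rewrite card_prod card_ord leq_mul2l card_bmultinom orbT.
pose M : 'M[k]_(#|T|, #|{: U}|) :=
  \matrix_(i, j) (b (enum_val i) (enum_val j).1)@_(val (enum_val j).2).
rewrite leqNgt; apply/negP => lt.
have : kermx M != 0.
  rewrite -mxrank_eq0 mxrank_ker subn_eq0 -ltnNge.
  exact: leq_ltn_trans (rank_leq_col _) lt.
case/rowV0Pn => v /sub_kermxP vM v0.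
move/eqP: v0; apply; apply/rowP => i; rewrite mxE -(enum_valK i).
apply: (li (fun t => v 0 (enum_rank t))); last first.
move: (@expands_sum _ (fun t => eta (v 0 (enum_rank t))%:MP * F t)
  (fun t j => (v 0 (enum_rank t))%:MP * b t j)
  (fun t => expands_scale _ (hb t).1)); rewrite /expands.
rewrite [X in _ - X]big1 ?subr0 // => j _.
rewrite (_ : \sum_t _ = 0) ?rmorph0 ?mul0r //; apply/mpolyP => m.
rewrite mcoeff0 raddf_sum /=; have [md|md] := ltnP (mdeg m) d; last first.
  rewrite big1 // => t _; rewrite mul_mpolyC mcoeffZ memN_msupp_eq0 ?mulr0 //.
  by apply: msize_mdeg_ge; apply: leq_trans ((hb t).2 j) md.
have := congr1 (fun A : 'rV__ => A 0 (enum_rank (j, BMultinom md))) vM.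
rewrite !mxE => e; apply: (etrans _ e); rewrite [RHS](reindex (@enum_rank T)) /=; last first.
  by apply: onW_bij; apply: enum_rank_bij.
apply: eq_bigr => t _; rewrite !mxE !enum_rankK /=.
by rewrite mul_mpolyC mcoeffZ.
Qed.

Definition on_vars (J : {set 'I_N}) p : Prop :=
  forall m, m \in msupp p -> forall i, i \notin J -> m i = 0%N.

(** Modulo the largest prime, the monomials in J with exponents below m are [m ^ #|J|] independent
    elements. Going down one prime multiplies the family by the powers of an element lost on the
    way, hence its size by m. At the bottom there are [m ^ (e + #|J|)] independent elements at a
    level of the filtration linear in m, where there is room for a constant multiple of [m ^ N]. *)
Lemma prime_chain_length (J : {set 'I_N}) (e : nat) (Q : nat -> set S) :
  I `<=` Q 0%N -> (forall m, (m <= e)%N -> is_prime (Q m)) ->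
  (forall m, (m < e)%N -> Q m `<=` Q m.+1 /\ exists2 x, Q m.+1 x & ~ Q m x) ->
  (forall p, on_vars J p -> Q e (eta p) -> p = 0) -> (e + #|J| <= N)%N.
Proof.
move=> IQ hQ hS hJ.
have h i : (i <= e)%N -> exists c, forall m, exists (T : finType) (F : T -> S),
    [/\ lin_indep (Q (e - i)%N) F, #|T| = (m ^ (i + #|J|))%N &
        forall t, fdeg (F t) (c * m.+1)].
  elim: i => [_|i IH ie].
    (* A monomial with N exponents below m has size at most [N * m.+1 + 1]; [fdeg_scale] adds 1 and
       the level [c1] of the unit. *)
    have [c1 hc1] := fdeg_exists 1; exists (N + 2 + c1)%N => m.
    pose mon (t : {ffun {j | j \in J} -> 'I_m}) : 'X_{1..N} :=
      [multinom if insub i is Some j then val (t j) else 0%N | i < N].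
    have monE t (j : {j | j \in J}) : mon t (val j) = t j.
      by rewrite mnmE valK.
    have mon_out t i : i \notin J -> mon t i = 0%N.
      by move=> iJ; rewrite mnmE insubN.
    exists {ffun {j | j \in J} -> 'I_m}, (fun t => eta 'X_[mon t]); split.
    - move=> c; rewrite subn0 => hc t.
      have : \sum_t c t *: 'X_[mon t] = 0 :> {mpoly k[N]}.
        apply: hJ => [m'|]; last first.
          move: hc; congr (Q e); rewrite rmorph_sum; apply: eq_bigr => t' _.
          by rewrite -mul_mpolyC rmorphM.
        rewrite mcoeff_msupp raddf_sum /= => hm i iJ.
        have [t' /eqP ht] : exists t', m' == mon t'.
          apply: contrapT => h; move: hm; rewrite big1 ?eqxx // => t' _.
          rewrite mcoeffZ mcoeffX; case: eqP => [e'|]; rewrite ?mulr0 //.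
          by case: h; exists t'; rewrite e'.
        by rewrite ht mon_out.
      move/mpolyP/(_ (mon t)); rewrite mcoeff0 raddf_sum /= (bigD1 t) //= big1.
        by rewrite mcoeffZ mcoeffX eqxx mulr1 addr0.
      move=> t' tt; rewrite mcoeffZ mcoeffX; case: eqP => [/mnmP e'|]; last first.
        by rewrite mulr0.
      case/eqP: tt; apply/ffunP => j; apply: val_inj.
      by have := e' (val j); rewrite !monE.
    - by rewrite card_ffun card_ord card_sig; congr (_ ^ _)%N; apply: eq_card.
    - move=> t; have [b hb hd] := fdeg_scale 'X_[mon t] hc1.
      rewrite mulr1 in hb; exists b => // j; apply: leq_trans (hd j) _.
      have md : (mdeg (mon t) <= N * m.+1)%N.
        rewrite mdegE -[X in (_ <= X * _)%N]card_ord -sum_nat_const.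
        apply: leq_sum => i _; rewrite mnmE; case: insubP => // j' _ _.
        exact: leq_trans (ltnW (ltn_ord (t j'))) (leqnSn m).
      have cm : (c1 <= c1 * m.+1)%N by rewrite leq_pmulr.
      by rewrite msizeX !mulnDl; lia.
  have [c hc] := IH (ltnW ie); pose a := (e - i.+1)%N.
  have aE : a.+1 = (e - i)%N by rewrite subnSK.
  have [|sub [g Qg nQg]] := hS a; first by rewrite aE leq_subr.
  have [c' hc'] := fdeg_mul g; exists (c + c')%N => m.
  have [T [F [li cT dF]]] := hc m.
  exists ('I_m * T)%type, (fun p : 'I_m * T => g ^+ p.1 * F p.2); split.
  - apply: (@lin_indep_powers _ (Q a.+1)) => //.
    + by apply: hQ; rewrite leq_subr.
    + by have [] : is_prime (Q a.+1) by apply: hQ; rewrite aE leq_subr.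
    + by rewrite aE.
  - by rewrite card_prod card_ord cT addSn expnS.
  - move=> [j t] /=; have : fdeg (g ^+ j * F t) (c * m.+1 + j * c').
      elim: (val j) => [|j' IHj]; first by rewrite mul1r addn0.
      rewrite exprS -mulrA mulSn [(c' + _)%N]addnC addnA; exact: hc'.
    case=> b hb hd; exists b => // j'; apply: leq_trans (hd j') _.
    by rewrite mulnDl leq_add2l mulnC leq_mul2l ltnW ?orbT // ltnS ltnW.
have [c hc] := h e (leqnn e); rewrite leqNgt; apply/negP => lt.
(* Since [m.+1 <= m * 2], the upper bound is at most [r * (c * 2) ^ N * m ^ N], which this m makes
   smaller than [m ^ N.+1]. *)
pose m := (r * (c * 2) ^ N).+1.
have [T [F [li cT dF]]] := hc m; rewrite subnn in li.
have : (#|T| <= r * (c * m.+1) ^ N)%N.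
  by apply: (@lin_indep_card T F) => // b Ib; apply: li; apply: IQ.
rewrite cT leqNgt => /negP; apply.
apply: (@leq_trans (m ^ N.+1)); last by rewrite leq_pexp2l.
apply: (@leq_ltn_trans (r * (c * 2) ^ N * m ^ N)%N).
  rewrite -mulnA leq_mul2l -expnMn; apply/orP; right.
  have [->//|N0] := posnP N; rewrite leq_exp2r // -mulnA leq_mul2l.
  by apply/orP; right; rewrite /m; lia.
by rewrite expnS ltn_pmul2r // expn_gt0.
Qed.

End FreeModulo.

(** * Elimination of one variable *)

Section OneVariable.
Variables (k : fieldType) (N : nat).
Implicit Types (p : {mpoly k[N]}) (J : {set 'I_N}).

Lemma on_vars0 J : on_vars J (0 : {mpoly k[N]}).
Proof. by move=> m; rewrite msupp0. Qed.

Lemma on_vars1 J : on_vars J (1 : {mpoly k[N]}).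
Proof. by move=> m; rewrite msupp1 inE => /eqP-> i _; rewrite mnm0E. Qed.

Lemma on_varsD J p q : on_vars J p -> on_vars J q -> on_vars J (p + q).
Proof. by move=> hp hq m /msuppD_le; rewrite mem_cat => /orP[/hp|/hq]. Qed.

Lemma on_varsM J p q : on_vars J p -> on_vars J q -> on_vars J (p * q).
Proof.
move=> hp hq m /msuppM_le /allpairsP [[m1 m2] /= [/hp h1 /hq h2 ->]] i iJ.
by rewrite mnmDE h1 ?h2.
Qed.

Lemma on_vars_prod J (T : finType) (F : T -> {mpoly k[N]}) :
  (forall t, on_vars J (F t)) -> on_vars J (\prod_t F t).
Proof.
move=> h; elim/big_ind: _ => //; first exact: on_vars1.
by move=> p q; apply: on_varsM.
Qed.

Variable z : 'I_N.

Definition mnm_clear (m : 'X_{1..N}) : 'X_{1..N} :=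
  [multinom if i == z then 0%N else m i | i < N].

(** A polynomial viewed in the variable z. The coefficients stay in the same ring although z no
    longer occurs in them, so evaluation at ['X_z] gives the polynomial back. *)
Definition as_poly : {mpoly k[N]} -> {poly {mpoly k[N]}} :=
  mmap (polyC \o @mpolyC N k) (fun i => if i == z then 'X else ('X_i)%:P).
HB.instance Definition _ := GRing.RMorphism.on as_poly.

Lemma as_polyE p : as_poly p =
  \sum_(m <- msupp p) (p@_m *: 'X_[mnm_clear m])%:P * 'X^(m z).
Proof.
rewrite /as_poly /mmap; apply: eq_bigr => m _.
rewrite -mul_mpolyC rmorphM /= -mulrA; congr (_ * _).
rewrite /mmap1 (bigD1 z) //= eqxx mulrC; congr (_ * _).
rewrite mpolyXE_id rmorph_prod [RHS](bigD1 z) //= mnmE eqxx expr0 mul1r.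
by apply: eq_bigr => i /negPf iz; rewrite mnmE iz rmorphXn.
Qed.

Lemma as_poly_horner p : (as_poly p).['X_z] = p.
Proof.
rewrite as_polyE horner_sum [RHS]mpolyE; apply: eq_bigr => m _.
rewrite !hornerE -scalerAl; congr (_ *: _).
rewrite [X in X * _]mpolyXE_id [RHS]mpolyXE_id (bigD1 z) //= mnmE eqxx.
rewrite expr0 mul1r mulrC.
rewrite [RHS](bigD1 z) //=; congr (_ * _); apply: eq_bigr => i /negPf iz.
by rewrite mnmE iz.
Qed.

Lemma as_poly_const J p : z \notin J -> on_vars J p -> as_poly p = p%:P.
Proof.
move=> zJ hp; rewrite as_polyE [in RHS](mpolyE p) rmorph_sum /=.
rewrite big_seq [RHS]big_seq; apply: eq_bigr => m /hp hm.
rewrite hm // mulr1; congr (_ *: 'X_[_])%:P; apply/mnmP => i.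
by rewrite mnmE; case: eqP => // ->; rewrite hm.
Qed.

Lemma as_poly_coef J p e : on_vars (z |: J) p -> on_vars J (as_poly p)`_e.
Proof.
move=> hp; rewrite as_polyE coef_sum big_seq.
elim/big_ind: _; [exact: on_vars0|exact: on_varsD|move=> m /hp hm].
rewrite coefCM coefXn; case: eqP => _; rewrite ?mulr0; last exact: on_vars0.
rewrite mulr1 => m'; rewrite mcoeff_msupp mcoeffZ mcoeffX.
case: (mnm_clear m =P m') => [<- _|_]; last by rewrite mulr0 eqxx.
move=> i iJ; rewrite mnmE; case: eqP => // iz; apply: hm.
by rewrite !inE negb_or iJ andbT; apply/eqP.
Qed.

End OneVariable.

(** The top coefficient of p * q is the product of the leading ones. So the leading term of q, times
    the leading coefficient of p, may be dropped modulo I, and the size of q decreases. *)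
Lemma coef_ideal_cancel (C : comNzRingType) (I : set C) (p q : {poly C}) :
  is_ideal I -> (forall e, I (p * q)`_e) ->
  exists M, forall e, I (lead_coef p ^+ M *: q)`_e.
Proof.
move=> hI; have [M] := ubnP (size q); elim: M q => // M IH q.
rewrite ltnS => sq hq.
have [q0|q0] := eqVneq q 0.
  by exists 0%N => e; rewrite q0 scaler0 coef0; apply: hI.1.
have [p0|p0] := eqVneq p 0.
  by exists 1%N => e; rewrite p0 lead_coef0 expr1 scale0r coef0; apply: hI.1.
pose a := lead_coef p; pose d := (size q).-1.
have sqE : size q = d.+1 by rewrite prednK // lt0n size_poly_eq0.
have Ia : I (a * q`_d).
  move: (hq ((size p).-1 + d)%N); rewrite coefM.
  have lp : ((size p).-1 < ((size p).-1 + d).+1)%N by rewrite ltnS leq_addr.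
  rewrite (bigD1 (Ordinal lp)) //= addKn big1 ?addr0 // => j.
  rewrite -val_eqE /= neq_ltn => /orP[jp|jp].
    rewrite [q`_ _]nth_default ?mulr0 //.
    by rewrite sqE ltn_subRL ltn_add2r.
  rewrite [p`_ _]nth_default ?mul0r //; apply: leq_trans jp.
  by rewrite prednK // lt0n size_poly_eq0.
pose q' := a *: q - (a * q`_d) *: 'X^d.
have sq' : (size q' < M)%N.
  apply: leq_trans sq; rewrite sqE ltnS; apply/leq_sizeP => e de.
  rewrite !coefE; case: eqP => [->|ed]; first by rewrite mulr1 subrr.
  rewrite mulr0 subr0 nth_default ?mulr0 // sqE ltn_neqAle de andbT.
  by rewrite eq_sym; apply/eqP.
have [|M' hM'] := IH _ sq'.
  move=> e; rewrite mulrBr coefB -!scalerAr !coefZ; apply: ideal_sub => //.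
    exact: ideal_mul.
  by rewrite mulrC; apply: ideal_mul.
exists M'.+1 => e; have := hM' e; rewrite -/a => h.
rewrite (_ : a ^+ M'.+1 *: q = a ^+ M' *: q' + (a ^+ M' * (a * q`_d)) *: 'X^d).
  rewrite coefD; apply: ideal_add => //; rewrite coefZ mulrC.
  exact: (ideal_mul _ hI (ideal_mul _ hI Ia)).
by rewrite /q' scalerBr !scalerA subrK exprSr.
Qed.

Lemma generated_map (B A : comNzRingType) (f : {rmorphism B -> A}) (G : seq B) x :
  generated G x -> generated [seq f y | y <- G] (f x).
Proof.
have hI := ideal_generated [seq f y | y <- G].
case=> c ->; rewrite rmorph_sum; apply: ideal_sum => // t _.
rewrite rmorphM; apply: ideal_mul => //; apply: generated_mem.
by apply: map_f; apply: mem_nth.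
Qed.

(** Modulo an ideal whose generators do not involve z, a factor g involving z can be cancelled at
    the price of a power of its leading coefficient in z, which involves J only. *)
Lemma generated_cancel (k : fieldType) (N : nat) (J : {set 'I_N}) (z : 'I_N)
    (G : seq {mpoly k[N]}) (g b : {mpoly k[N]}) :
  (forall y, y \in G -> exists2 J' : {set 'I_N}, z \notin J' & on_vars J' y) ->
  on_vars (z |: J) g -> g != 0 -> generated G (g * b) ->
  exists c, [/\ c != 0, on_vars J c & generated G (c * b)].
Proof.
move=> hG hg g0 gb; have hI := ideal_generated G.
have [|M hM] := @coef_ideal_cancel _ _ (as_poly z g) (as_poly z b) hI.
  move=> e; have [c] := generated_map (as_poly z) gb.
  rewrite rmorphM => ->; rewrite coef_sum; apply: ideal_sum => // t _.
  have tG : G`_t \in G by apply: mem_nth; rewrite -(size_map (as_poly z) G).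
  have [J' zJ' hJ'] := hG _ tG.
  rewrite (nth_map 0) -?(size_map (as_poly z) G) //= (as_poly_const zJ' hJ').
  by rewrite coefMC; apply: ideal_mul => //; apply: generated_mem.
pose a := lead_coef (as_poly z g); exists (a ^+ M); split.
- rewrite expf_neq0 // lead_coef_eq0; apply: contraNneq g0 => e.
  by rewrite -(as_poly_horner z g) e horner0.
- by elim: M {hM} => [|M IH]; [exact: on_vars1|rewrite exprS; apply: on_varsM;
    [apply: as_poly_coef|]].
rewrite -{1}(as_poly_horner z b) -hornerZ horner_coef.
apply: ideal_sum => // e _; rewrite mulrC; exact: ideal_mul.
Qed.

(** * Cohen--Macaulay property of local rings of a free algebra *)

Section Localization.
Variables (k : fieldType) (N r : nat) (S A : comNzRingType).
Variables (eta : {rmorphism {mpoly k[N]} -> S}) (om : 'I_r -> S) (I : set S).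
Variable phi : {rmorphism S -> A}.
Hypothesis fm : free_modulo eta om I.

Definition invertible (R : comNzRingType) (x : R) : Prop := exists y, x * y = 1.

Lemma invertibleM (R : comNzRingType) (x y : R) :
  invertible x -> invertible y -> invertible (x * y).
Proof. by move=> [x' hx] [y' hy]; exists (x' * y'); rewrite mulrACA hx hy mulr1. Qed.

(** Together the four properties say that A is a local ring obtained from S modulo I by inverting
    elements. *)
Hypothesis phi0 : forall f, I f -> phi f = 0.
Hypothesis phi_ker : forall f, phi f = 0 -> exists2 h, invertible (phi h) & I (h * f).
Hypothesis phi_frac : forall a, exists p q, invertible (phi q) /\ phi q * a = phi p.
Hypothesis nonunitD : forall a b : A, nonunit a -> nonunit b -> nonunit (a + b).

Let hI : is_ideal I. Proof. by case: fm. Qed.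

Let nonunit_ideal : is_ideal (@nonunit A).
Proof.
split; first by case=> y; rewrite mul0r => /esym/eqP; rewrite oner_eq0.
move=> a x y nx ny; apply: nonunitD => // -[z hz]; apply: nx; exists (a * z).
by rewrite mulrA [x * a]mulrC.
Qed.

Definition gen_mod (G : seq S) : set S :=
  [set f | exists2 y, generated G y & I (f - y)].

Lemma ideal_gen_mod G : is_ideal (gen_mod G).
Proof.
have hG := ideal_generated G.
split; first by exists 0; rewrite ?subr0; [exact: hG.1|exact: hI.1].
move=> a x y [x' gx ix] [y' gy iy]; exists (a * x' + y'); first exact: hG.2.
have := hI.2 a _ _ ix iy; congr I; by rewrite mulrBr opprD addrACA.
Qed.

Lemma sub_gen_mod G f : I f -> gen_mod G f.
Proof.
by move=> If; exists 0; rewrite ?subr0 //; apply: (ideal_generated G).1.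
Qed.

(** Clearing denominators: the fractions with numerator in [gen_mod G] form an ideal of A that
    contains the images of G. *)
Lemma gen_mod_pull (G : seq S) f : generated [seq phi y | y <- G] (phi f) ->
  exists2 h, invertible (phi h) & gen_mod G (h * f).
Proof.
have hG := ideal_gen_mod G.
pose D : set A := [set a | exists f q,
  [/\ invertible (phi q), phi q * a = phi f & gen_mod G f]].
have hD : is_ideal D.
  split.
    exists 0, 1; rewrite rmorph1 mulr0 rmorph0; split=> //; last exact: hG.1.
    by exists 1; rewrite mulr1.
  move=> a x y [fx [qx [ux ex gx]]] [fy [qy [uy ey gy]]].
  have [p [q [uq eq]]] := phi_frac a.
  exists (qy * p * fx + q * qx * fy), (q * qx * qy); split.
  - by rewrite !rmorphM; do 2 apply: invertibleM => //.
  - by rewrite rmorphD !rmorphM -ex -ey -eq; ring.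
  - by apply: ideal_add => //; apply: ideal_mul.
have sub : generated [seq phi y | y <- G] `<=` D.
  apply: generated_min => // _ /mapP[y yG ->]; exists y, 1.
  rewrite rmorph1 mul1r; split=> //; first by exists 1; rewrite mulr1.
  by exists y; [exact: generated_mem|rewrite subrr; apply: hI.1].
move=> /sub[f' [q [uq e gf]]].
have /phi_ker[h uh ih] : phi (q * f - f') = 0.
  by rewrite rmorphB rmorphM e subrr.
exists (h * q); first by rewrite rmorphM; apply: invertibleM.
rewrite -mulrA -(subrK f' (q * f)) mulrDr; apply: ideal_add => //.
  exact: sub_gen_mod.
exact: ideal_mul.
Qed.

(** By freeness, membership in the extension of an ideal of the polynomial ring is decided
    coordinate by coordinate. *)
Lemma gen_mod_coef (G : seq {mpoly k[N]}) f b :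
  gen_mod [seq eta y | y <- G] f -> expands eta om I f b ->
  forall j, generated G (b j).
Proof.
case=> y [c ->] iy hb.
have [_ span _] := fm.
have /choice[bc hbc] t : exists b, expands eta om I (c t) b by apply: span.
pose b' j := \sum_(t < size [seq eta y | y <- G]) G`_t * bc t j.
have hb' : expands eta om I f b'.
  apply: (expands_cong fm iy); apply: (expands_sum fm) => t.
  rewrite (nth_map 0) -?(size_map eta G) // mulrC.
  exact: (expands_scale fm).
move=> j; rewrite (expands_uniq fm hb hb'); have hG := ideal_generated G.
apply: ideal_sum => // t _; rewrite mulrC; apply: ideal_mul => //.
by apply: generated_mem; apply: mem_nth; rewrite -(size_map eta G).
Qed.

Definition units_on (J : {set 'I_N}) : Prop :=
  forall b, on_vars J b -> b != 0 -> invertible (phi (eta b)).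

(** Without variables there are only constants, so the empty set qualifies; a variable that cannot
    be added to a maximal set provides g. *)
Lemma units_on_max : exists J, units_on J /\
  forall i, i \notin J -> exists g : {mpoly k[N]},
    [/\ on_vars (i |: J) g, g != 0 & nonunit (phi (eta g))].
Proof.
have u0 : `[< units_on finset.set0 >].
  apply/asboolP => b hb b0; have bE : b = (b@_0)%:MP.
    apply/mpolyP => m; rewrite mcoeffC; case: eqP => [->|m0].
      by rewrite mulr1.
    rewrite mulr0; apply/eqP; rewrite mcoeff_eq0; apply/negP => /hb hm.
    by case: m0; apply/mnmP => i; rewrite mnm0E hm ?inE.
  move: b0; rewrite bE; move: (b@_0) => c c0; exists (phi (eta c^-1%:MP)).
  rewrite -!rmorphM /= mulfV ?rmorph1 //.
  by apply: contraNneq c0 => ->; rewrite mpolyC0.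
have [J /maxsetP[/asboolP hJ max] _] :=
  maxset_exists (P := fun J => `[< units_on J >]) u0.
exists J; split=> // i iJ; apply: contrapT => h; move: iJ.
have -> : J = i |: J; last by rewrite setU11.
symmetry; apply: max; last exact: finset.subsetUr.
apply/asboolP => b hb b0; apply: contrapT => nu; apply: h; exists b.
by split.
Qed.

(** One maximal set J serves both sides. The images of the polynomials [g i], for i outside J, form
    the regular sequence, of length [N - #|J|]. Chains of primes of A contract to chains in S whose
    members contain no nonzero polynomial in J, and [prime_chain_length] gives the same bound. *)
Theorem cohen_macaulay_free : cohen_macaulay_ring A.
Proof.
have [J [uJ /= gex]] := units_on_max.
have /choice[g hg] (i : 'I_N) : exists g : {mpoly k[N]}, i \notin J ->
    [/\ on_vars (i |: J) g, g != 0 & nonunit (phi (eta g))].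
  have [iJ|iJ] := boolP (i \in J); first by exists 0.
  by have [g] := gex i iJ; exists g.
pose L := enum (~: J)%SET; pose f := fun i => phi (eta (g i)).
have LJ i : i \in L -> i \notin J by rewrite mem_enum inE.
have nus x : x \in map f L -> nonunit x.
  by case/mapP => i /LJ/hg[_ _ nu] ->.
have szL : size (map f L) = (N - #|J|)%N.
  rewrite size_map /L -cardE.
  by have := cardsC J; rewrite card_ord => /(canRL (addKn _)) ->.
apply: (@cohen_macaulay_criterion _ (map f L)) => //; last first.
  move=> P [hP hS]; rewrite szL in hP hS.
  pose Q m : set S := [set x | phi x \in P m].
  have hQ m : (m <= (N - #|J|).+1)%N -> is_prime (Q m).
    case/hP => -[P0 P1 Padd] Pp; split.
    - split; first by rewrite /Q /= rmorph0.
      by move=> a x y Qx Qy; rewrite /Q /= rmorphD rmorphM; apply: Padd.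
    - by rewrite /Q /= rmorph1; apply/negP.
    - by move=> x y; rewrite /Q /= rmorphM => /Pp/orP.
  have := @prime_chain_length _ _ _ _ eta om I fm J (N - #|J|).+1 Q.
  rewrite addSn subnK; last by rewrite -[X in (_ <= X)%N]card_ord max_card.
  rewrite ltnn => /(_ _ hQ) h; suff: false by []; apply: h.
  - move=> x Ix; rewrite /Q /= phi0 //.
    by have [[]] := hP 0%N isT.
  - move=> m md; have [sub nsub] := hS m md; split.
      by move=> x; apply: sub.
    (* Contraction keeps inclusions strict: a is a fraction whose numerator lies in the same primes
       as a, its denominator being a unit. *)
    apply: contrapT => h; apply: nsub => a aP.
    have [p [q [[q' uq] e]]] := phi_frac a.
    have [[P0 P1 Padd] Pp] := hP m (ltnW md).
    have [[P0' P1' Padd'] Pp'] := hP m.+1 md.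
    have Pm (x y : A) : y \in P m -> x * y \in P m.
      by move=> yP; rewrite -[x * y]addr0; apply: Padd.
    have Pm' (x y : A) : y \in P m.+1 -> x * y \in P m.+1.
      by move=> yP; rewrite -[x * y]addr0; apply: Padd'.
    have Qp : phi p \in P m.
      apply: contrapT => nQ; apply: h; exists p => //.
      by rewrite /Q /= -e; apply: Pm'.
    have : phi q * a \in P m by rewrite e.
    case/Pp/orP => // qP; case/negP: P1.
    by rewrite -uq mulrC; apply: Pm.
  - move=> b hb Qb; apply/eqP; apply: contrapT => /negP b0.
    have [y uy] := uJ b hb b0.
    have [[P0 P1 Padd] Pp] := hP _ (leqnn _).
    case/negP: P1; rewrite -uy mulrC -[y * _]addr0; exact: Padd.
split.
  move=> h; suff : nonunit (1 : A) by apply; exists 1; rewrite mulr1.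
  by apply: (generated_min nonunit_ideal _ h).
move=> t; rewrite size_map => tL x.
have [p [q [uq e]]] := phi_frac x.
have [i0 _] : exists i : 'I_N, i \in L.
  by move: tL; case: (L) => // i L' _; exists i; rewrite mem_head.
pose z := nth i0 L t; have zL : z \in L := mem_nth i0 tL.
have [gz1 gz2 _] := hg z (LJ _ zL).
pose G := [seq g i | i <- take t L].
have -> : take t (map f L) = [seq phi y | y <- [seq eta y | y <- G]].
  by rewrite -map_take /G -!map_comp.
have hI' := ideal_generated [seq phi y | y <- [seq eta y | y <- G]].
rewrite (nth_map i0) // -/z => hx.
have /gen_mod_pull[h uh hh] : generated [seq phi y | y <- [seq eta y | y <- G]]
    (phi (eta (g z) * p)).
  by rewrite rmorphM -e mulrCA; apply: ideal_mul.
have [_ span _] := fm; have [b hb] := span (h * p).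
(* The relation now lives in the polynomial ring, one coordinate at a time. The earlier members of
   the sequence do not involve z, so that [g z] can be cancelled. *)
have hgb j : generated G (g z * b j).
  apply: (@gen_mod_coef G (eta (g z) * (h * p)) (fun j => g z * b j)).
    by rewrite mulrCA.
  exact: expands_scale.
have hG y : y \in G -> exists2 J' : {set 'I_N}, z \notin J' & on_vars J' y.
  case/mapP => i it ->; have [gi _ _] := hg i (LJ _ (mem_take it)).
  exists (i |: J); rewrite // !inE negb_or LJ // andbT.
  apply: contraTneq it => <-; apply/negP => zt.
  have : uniq L by apply: enum_uniq.
  rewrite -(cat_take_drop t L) cat_uniq => /and3P[_ /hasPn/(_ z) + _].
  by rewrite /= zt (drop_nth i0 tL) mem_head => /(_ isT).
have /choice[c hc] j : exists c, [/\ c != 0, on_vars J c & generated G (c * b j)].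
  exact: (generated_cancel hG gz1 gz2 (hgb j)).
(* A common multiplier for all coordinates; it involves J only and is therefore a unit of A. *)
pose C := \prod_j c j.
have uC : invertible (phi (eta C)).
  apply: uJ; first by apply: on_vars_prod => j; have [] := hc j.
  by rewrite /C prodf_seq_neq0; apply/allP => j _; have [] := hc j.
have gC : generated [seq phi y | y <- [seq eta y | y <- G]] (phi (eta C * (h * p))).
  have /phi0/eqP := expands_scale fm C hb; rewrite rmorphB subr_eq0 => /eqP ->.
  rewrite rmorph_sum; apply: ideal_sum => // j _; rewrite rmorphM mulrC.
  apply: ideal_mul => //; do 2 apply: generated_map.
  rewrite /C (bigD1 j) //= mulrAC mulrC; apply: ideal_mul; first exact: ideal_generated.
  by have [] := hc j.
have cancel u y : invertible u ->
    generated [seq phi y | y <- [seq eta y | y <- G]] (u * y) ->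
    generated [seq phi y | y <- [seq eta y | y <- G]] y.
  move=> [v uv] gu; rewrite -[y]mul1r -uv mulrAC mulrC; exact: ideal_mul.
move: gC; rewrite !rmorphM -e => /(cancel _ _ uC)/(cancel _ _ uh).
exact: cancel.
Qed.

End Localization.

(** * The cone in adapted coordinates *)

Section Model.
Variables (k : closedFieldType) (n : nat) (pos : 'I_n -> nat).
Implicit Types (u : 'I_(n + n) -> k) (s t : 'I_n) (l : nat).

Definition xc u s : k := u (lshift n s).
Definition yc u s : k := u (rshift n s).

Definition mkpt (x y : 'I_n -> k) : 'I_(n + n) -> k :=
  fun r => match fintype.split r with inl s => x s | inr t => y t end.

Lemma xc_mkpt x y s : xc (mkpt x y) s = x s.
Proof. by rewrite /xc /mkpt (unsplitK (inl s)). Qed.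

Lemma yc_mkpt x y s : yc (mkpt x y) s = y s.
Proof. by rewrite /yc /mkpt (unsplitK (inr s)). Qed.

Lemma mkptK u : mkpt (xc u) (yc u) = u.
Proof.
apply/funext => r; rewrite /mkpt -{2}(splitK r).
by case: (fintype.split r).
Qed.

Lemma pt_ext u u' : xc u =1 xc u' -> yc u =1 yc u' -> u = u'.
Proof.
by move=> hx hy; rewrite -(mkptK u) -(mkptK u'); congr mkpt; apply/funext.
Qed.

(* The cone over the closure of the image of V^(l): writing the coordinates of
   the class [pos s = l] as x = a z and y = b z gives the minors. *)
Definition inZ l u : Prop :=
  [/\ forall s, (pos s < l)%N -> xc u s = 0,
      forall s, (l < pos s)%N -> yc u s = 0 &
      forall s t, pos s = l -> pos t = l -> xc u s * yc u t = xc u t * yc u s].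

Definition inX (Lam : seq nat) u : Prop := exists2 l, l \in Lam & inZ l u.

(** With the next lemma, these are the equations shared by all components: if [pos s < pos t], every
    index l satisfies [pos s < l], which kills x_s, or [l < pos t], which kills y_t. *)
Lemma inX_lt Lam u s t : inX Lam u -> (pos s < pos t)%N -> xc u s * yc u t = 0.
Proof.
case=> l _ [hx hy _] st; case: (ltnP (pos s) l) => [/hx->|ls].
  by rewrite mul0r.
by rewrite hy ?mulr0 // (leq_ltn_trans ls).
Qed.

Lemma inX_eq Lam u s t : inX Lam u -> pos s = pos t ->
  xc u s * yc u t = xc u t * yc u s.
Proof.
case=> l _ [hx hy hm] st; case: (ltngtP (pos s) l) => [sl|sl|sl].
- by rewrite !hx -?st // !mul0r.
- by rewrite !hy -?st // !mulr0.
- by rewrite hm -?st.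
Qed.

End Model.

(** Up to scalars the cofactors U of a polynomial with distinct roots are the Lagrange basis at its
    roots. They span the polynomials of smaller degree, so a linear form that kills all of them is
    zero. *)
Lemma deflated_factors (k : closedFieldType) (c : k) (rs : seq k) (be : nat -> k) :
  c != 0 -> uniq rs ->
  (forall r, r \in rs -> exists2 U : {poly k},
     ('X - r%:P) * U = c *: \prod_(a <- rs) ('X - a%:P) &
     \sum_(i < size rs) be i * U`_i = 0) ->
  forall i, (i < size rs)%N -> be i = 0.
Proof.
move=> c0 urs h.
have szT : size (c *: \prod_(a <- rs) ('X - a%:P)) = (size rs).+1.
  by rewrite size_scale // size_prod_XsubC.
pose L (F : {poly k}) := \sum_(i < size rs) be i * F`_i.
have LD F G : L (F + G) = L F + L G.
  by rewrite /L -big_split; apply: eq_bigr => i _; rewrite coefD mulrDr.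
have LZ a F : L (a *: F) = a * L F.
  rewrite /L big_distrr; apply: eq_bigr => i _.
  by rewrite coefZ mulrCA.
(* Induction on the set s of roots at which F may be nonzero: subtracting a multiple of the cofactor
   of r creates a zero at r and keeps the others. *)
have main (s : seq k) (F : {poly k}) : {subset s <= rs} -> uniq s ->
    (size F <= size rs)%N -> (forall r, r \in rs -> r \notin s -> root F r) ->
    L F = 0.
  elim: s F => [|r s IH] F srs us sF hF.
    rewrite (_ : F = 0); first by rewrite /L big1 // => i _; rewrite coef0 mulr0.
    apply: (@roots_geq_poly_eq0 _ _ rs) => //.
    by apply/allP => r rrs; apply: hF.
  have rrs : r \in rs by apply: srs; rewrite mem_head.
  have [U hU hL] := h r rrs.
  have Ur : U.[r] != 0.
    have rt : root U r = false.
      apply/negP => /factor_theorem[q qE].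
      have : ('X - r%:P) ^+ 2 %| \prod_(a <- rs) ('X - a%:P).
        rewrite -(dvdpZr _ _ c0) -hU qE mulrCA -expr2; exact: dvdp_mull.
      rewrite (big_rem r) //= expr2 dvdp_mul2l ?polyXsubC_eq0 //.
      by rewrite dvdp_XsubCl root_prod_XsubC mem_rem_uniqF.
    by rewrite -[_ == 0]/(root U r) rt.
  have sU : (size U <= size rs)%N.
    have U0 : U != 0 by apply: contraNneq Ur => ->; rewrite horner0.
    have : size (('X - r%:P) * U) = (size rs).+1 by rewrite hU szT.
    by rewrite mulrC size_Mmonic ?monicXsubC // size_XsubC addn2 /= => -[->].
  have Ui r' : r' \in rs -> r' != r -> root U r'.
    move=> r's rr; have : root (('X - r%:P) * U) r'.
      by rewrite hU rootZ // root_prod_XsubC.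
    by rewrite rootM root_XsubC (negPf rr).
  pose G := F - (F.[r] / U.[r]) *: U.
  have : L G = 0.
    apply: IH => //.
    - by move=> x xs; apply: srs; rewrite inE xs orbT.
    - by case/andP: us.
    - apply: leq_trans (size_polyD _ _) _; rewrite geq_max sF size_polyN.
      exact: leq_trans (size_scale_leq _ _) _.
    move=> r' r's r'ns; rewrite rootE !hornerE.
    have [->|rr] := eqVneq r' r; first by rewrite divfK ?subrr.
    have /eqP -> := Ui _ r's rr; rewrite mulr0 subr0.
    by apply: hF; rewrite // inE negb_or rr.
  rewrite /G LD -scaleNr LZ; have -> : L U = 0 by [].
  by rewrite mulr0 addr0.
move=> i ir; have := main rs 'X^i (fun _ => id) urs.
rewrite size_polyXn => /(_ ir) <-; last by move=> r ->.
rewrite /L (bigD1 (Ordinal ir)) //= coefXn eqxx mulr1 big1 ?addr0 // => j.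
by rewrite -val_eqE /= coefXn => /negPf ->; rewrite mulr0.
Qed.

(** * Density of the polynomials with distinct nonzero roots *)

Section Density.
Variables (k : closedFieldType) (N : nat) (s : 'I_N.+1) (a m : nat).
Hypothesis ms : (a + m < s)%N.
Variable b : {mpoly k[N]}.

Definition skip (g : nat -> k) : 'I_N -> k := fun i => g (lift s i).

Lemma skip_eq0 (p : {mpoly k[N]}) : (forall g, p.@[skip g] = 0) -> p = 0.
Proof.
move=> h; apply: mpoly_eval_eq0 => v.
rewrite -(h (fun q => if unlift s (inord q) is Some i then v i else 0)).
by apply: meval_eq => i; rewrite /skip inord_val liftK.
Qed.

(** The coordinates of indices a to a + m are read as the coefficients of a polynomial of degree m;
    those with distinct nonzero roots are dense among all values. *)
Lemma vanish_on_split :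
  (forall g (c : k) rs, c != 0 -> uniq rs -> 0 \notin rs -> size rs = m ->
     (forall i, (i <= m)%N -> g (a + i)%N = (c *: \prod_(r <- rs) ('X - r%:P))`_i) ->
     b.@[skip g] = 0) -> b = 0.
Proof.
move=> h.
(* Nothing is required of the roots in [rs1]; they are moved one by one to a general position and
   then join [rs2]. *)
have h1 rs1 : forall g (c : k) rs2, c != 0 -> uniq rs2 -> 0 \notin rs2 ->
    size (rs1 ++ rs2) = m ->
    (forall i, (i <= m)%N ->
       g (a + i)%N = (c *: \prod_(r <- rs1 ++ rs2) ('X - r%:P))`_i) ->
    b.@[skip g] = 0.
  elim: rs1 => [|r rs1 IH] g c rs2 c0 urs n0 sz hg; first exact: (h g c rs2).
  pose W := c *: \prod_(x <- rs1 ++ rs2) ('X - x%:P).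
  (* Adding r * W and subtracting x * W turns (X - r) W into (X - x) W, so moving one root moves the
     coefficients along a line; b vanishes for almost all x, hence also for x = r. *)
  pose w q := if (q < a)%N then 0 else W`_(q - a).
  have [F hF] := mpoly_line b (skip (fun q => g q + r * w q)) (skip (fun q => - w q)).
  suff F0 : F = 0.
    have := hF r; rewrite F0 horner0 => <-; apply: meval_eq => i.
    by rewrite /skip mulrN addrK.
  apply: (@poly_eval_eq0_off _ ('X * \prod_(x <- rs2) ('X - x%:P))).
    by rewrite mulf_neq0 ?polyX_eq0 // monic_neq0 // monic_prod_XsubC.
  move=> x; rewrite !hornerE mulf_eq0 negb_or => /andP[x0 xrs].
  have {}xrs : x \notin rs2.
    by rewrite -root_prod_XsubC.
  rewrite -hF; apply: (IH (fun q => g q + r * w q + x * - w q) c (x :: rs2)) => //=.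
  - by rewrite xrs.
  - by rewrite inE negb_or eq_sym x0.
  - by rewrite -sz !size_cat /= addnS.
  move=> i im; rewrite hg // /w ltnNge leq_addr /= addKn.
  have -> : c *: \prod_(y <- rs1 ++ x :: rs2) ('X - y%:P) = ('X - x%:P) * W.
    rewrite /W -scalerAr; congr (_ *: _).
    by rewrite !big_cat /= big_cons mulrCA.
  have -> : c *: \prod_(y <- (r :: rs1) ++ rs2) ('X - y%:P) = ('X - r%:P) * W.
    by rewrite /W -scalerAr /= big_cons.
  by rewrite !mulrBl !coefB !coefCM mulrN subrK.
have lN : (a + m < N)%N by apply: leq_trans ms _; rewrite -ltnS.
pose j0 := Ordinal lN.
(* This variable is the leading coefficient; multiplying by it takes care of the points where the
   degree drops. *)
suff : b * 'X_j0 = 0.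
  move/eqP; rewrite mulf_eq0 => /orP[/eqP //|].
  by move/eqP/mpolyP/(_ U_(j0)%MM)/eqP; rewrite mcoeffXU eqxx mcoeff0 oner_eq0.
apply: skip_eq0 => g; rewrite mevalM mevalXU.
have -> : skip g j0 = g (a + m)%N.
  by rewrite /skip /= /bump leqNgt ms add0n.
have [->|gm] := eqVneq (g (a + m)%N) 0; first by rewrite mulr0.
pose T := \poly_(i < m.+1) g (a + i)%N.
have szT : size T = m.+1 by rewrite size_poly_eq.
have [rs TE] := closed_field_poly_normal T.
have lT : lead_coef T = g (a + m)%N by rewrite lead_coefE szT coef_poly ltnSn.
have szr : size rs = m.
  by move: szT; rewrite TE size_scale ?size_prod_XsubC ?lT // => -[].
rewrite (h1 rs g (g (a + m)%N) [::]) ?mul0r ?cats0 // => i im.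
by rewrite -lT -TE coef_poly ltnS im.
Qed.

End Density.

(** * Affine charts *)

Section Chart.
Variables (k : closedFieldType) (n' : nat).
Local Notation n := n'.+1.
Variables (pos : 'I_n -> nat) (Lam : seq nat) (s t : 'I_n).
Hypothesis posM : forall i j : 'I_n, (i <= j)%N -> (pos i <= pos j)%N.
Hypothesis posL : forall i, pos i \in Lam.

(** In the second case t and s are alone in their classes of equal positions within the interval
    from t to s; the rewriting in [in_span_YvYv_lt] then never leaves this interval. *)
Definition chart_indices : Prop := t = s \/
  [/\ (pos t < pos s)%N, forall q, pos q = pos t -> (q <= t)%N &
      forall q, pos q = pos s -> (s <= q)%N].
Hypothesis st : chart_indices.

Implicit Types (u : 'I_(n + n) -> k) (q r : nat) (p : {mpoly k[n']}).
Implicit Types f : {mpoly k[n + n]}.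

Definition chart u : Prop := [/\ inX pos Lam u, xc u s = 1 & yc u t = 1].

Definition chart_ideal : set {mpoly k[n + n]} :=
  [set f | forall u, chart u -> f.@[u] = 0].

Local Notation xn u q := (xc u (inord q)).
Local Notation yn u q := (yc u (inord q)).
Local Notation posn q := (pos (inord q)).

Lemma le_ts : (t <= s)%N.
Proof.
case: st => [->//|[lt _ _]]; rewrite leqNgt; apply/negP => /ltnW/posM.
by rewrite leqNgt lt.
Qed.

Lemma posnM q r : (q <= r)%N -> (r < n)%N -> (posn q <= posn r)%N.
Proof. by move=> qr rn; apply: posM; rewrite !inordK // (leq_ltn_trans qr). Qed.

Lemma chart_lt u q r : chart u -> (posn q < posn r)%N -> xn u q * yn u r = 0.
Proof. by case=> hu _ _; apply: inX_lt hu. Qed.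

Lemma chart_eq u q r : chart u -> posn q = posn r ->
  xn u q * yn u r = xn u r * yn u q.
Proof. by case=> hu _ _; apply: inX_eq hu. Qed.

Lemma chart_xs u : chart u -> xn u s = 1.
Proof. by case=> _ <- _; rewrite inord_val. Qed.

Lemma chart_yt u : chart u -> yn u t = 1.
Proof. by case=> _ _ <-; rewrite inord_val. Qed.

Definition Xv q : {mpoly k[n + n]} := 'X_(lshift n (inord q : 'I_n)).
Definition Yv q : {mpoly k[n + n]} := 'X_(rshift n (inord q : 'I_n)).

Lemma Xv_eval u q : (Xv q).@[u] = xn u q. Proof. exact: mevalXU. Qed.
Lemma Yv_eval u q : (Yv q).@[u] = yn u q. Proof. exact: mevalXU. Qed.

Definition param q : {mpoly k[n + n]} :=
  if (q < t)%N then Yv q else if (q < s)%N then Xv q + Yv q.+1 else Xv q.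

Definition param_val u q : k :=
  if (q < t)%N then yn u q else if (q < s)%N then xn u q + yn u q.+1 else xn u q.

Lemma param_eval u q : (param q).@[u] = param_val u q.
Proof.
rewrite /param /param_val; case: ifP => _; [|case: ifP => _];
  by rewrite ?mevalD ?Xv_eval ?Yv_eval.
Qed.

(** [lift s] skips the index s, whose parameter x_s is 1 on the chart; n - 1 parameters remain. *)
Definition chart_eta : {mpoly k[n']} -> {mpoly k[n + n]} :=
  mmap (@mpolyC (n + n) k) (fun i => param (lift s i)).
HB.instance Definition _ := GRing.RMorphism.on chart_eta.

(** The basis of the chart ring over the parameters: y_t = 1, y_(t+1), .., y_s. *)
Definition chart_om (j : 'I_(s - t).+1) : {mpoly k[n + n]} := Yv (t + j).

Lemma chart_eta_eval p u : (chart_eta p).@[u] = p.@[skip s (param_val u)].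
Proof.
rewrite /chart_eta /mmap raddf_sum mevalE; apply: eq_bigr => m _ /=.
rewrite mevalM mevalC /mmap1 rmorph_prod; congr (_ * _); apply: eq_bigr => i _.
by rewrite rmorphXn /= param_eval.
Qed.

Definition in_span f : Prop := exists b : 'I_(s - t).+1 -> {mpoly k[n']},
  forall u, chart u -> f.@[u] = \sum_j (b j).@[skip s (param_val u)] * yn u (t + j).

Lemma in_span_ext f f' : (forall u, chart u -> f.@[u] = f'.@[u]) ->
  in_span f' -> in_span f.
Proof. by move=> h [b hb]; exists b => u hu; rewrite h // hb. Qed.

Lemma in_spanD f f' : in_span f -> in_span f' -> in_span (f + f').
Proof.
move=> [b hb] [b' hb']; exists (fun j => b j + b' j) => u hu.
rewrite mevalD hb // hb' // -big_split; apply: eq_bigr => j _.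
by rewrite mevalD mulrDl.
Qed.

Lemma in_span_eta p f : in_span f -> in_span (chart_eta p * f).
Proof.
move=> [b hb]; exists (fun j => p * b j) => u hu.
rewrite mevalM chart_eta_eval hb // big_distrr /=; apply: eq_bigr => j _.
by rewrite mevalM mulrA.
Qed.

Lemma in_span_param q f : q != s -> (q < n)%N -> in_span f -> in_span (param q * f).
Proof.
move=> qs qn; have hq : s != inord q by rewrite -val_eqE /= inordK // eq_sym.
have [i iE _] := unlift_some hq.
have <- : chart_eta 'X_i = param q.
  rewrite /chart_eta mmapX mmap1U.
  by congr param; have := congr1 val iE; rewrite /= inordK.
exact: in_span_eta.
Qed.

Lemma in_span_Yv q : (t <= q <= s)%N -> in_span (Yv q).
Proof.
case/andP=> tq qs; have lq : (q - t < (s - t).+1)%N by rewrite ltnS leq_sub2r.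
exists (fun j => (j == Ordinal lq)%:R) => u hu.
rewrite Yv_eval (bigD1 (Ordinal lq)) //= eqxx meval1 mul1r subnKC //.
by rewrite big1 ?addr0 // => j /negPf ->; rewrite meval0 mul0r.
Qed.

Lemma in_spanN f : in_span f -> in_span (- f).
Proof. by move=> h; rewrite -mulN1r -(rmorphN1 chart_eta); apply: in_span_eta. Qed.

(** Write y_q as the parameter of index q - 1 minus x_(q-1). The product x_(q-1) y_r is zero if the
    positions differ. Otherwise it is x_r y_(q-1), and expressing x_r by its parameter leaves
    y_(q-1) y_(r+1): the indices move apart, and s - r decreases. *)
Lemma in_span_YvYv_lt q r : (t < q)%N -> (q <= r)%N -> (r <= s)%N ->
  in_span (Yv q * Yv r).
Proof.
have [m] := ubnP (s - r); elim: m q r => // m IH q r sm tq qr rs.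
have q0 : (0 < q)%N by apply: leq_ltn_trans tq.
have q1q : (q.-1 < q)%N by rewrite prednK.
have q1s : (q.-1 < s)%N by apply: leq_trans q1q (leq_trans qr rs).
have sn := ltn_ord s; have q1n : (q.-1 < n)%N := ltn_trans q1s sn.
have tq1 : (t <= q.-1)%N by rewrite -ltnS prednK.
have h1 : in_span (param q.-1 * Yv r).
  apply: in_span_param; [by rewrite neq_ltn q1s|exact: ltn_trans q1s sn|].
  by apply: in_span_Yv; rewrite (leq_trans (ltnW tq) qr) rs.
have e u : (param q.-1).@[u] = xn u q.-1 + yn u q.
  by rewrite param_eval /param_val ltnNge tq1 /= q1s prednK.
have [lt|ge] := ltnP (posn q.-1) (posn r).
  apply: in_span_ext h1 => u hu; rewrite !mevalM e mulrDl !Yv_eval.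
  by rewrite chart_lt // add0r.
have pe : posn q.-1 = posn r.
  apply/eqP; rewrite eqn_leq ge andbT posnM ?(leq_ltn_trans rs) //.
  exact: leq_trans (ltnW q1q) qr.
case: st => [ts|[pts tl sf]].
  by move: (leq_trans tq (leq_trans qr rs)); rewrite ts ltnn.
(* The indices q - 1 and r share a class, which is neither that of s nor that of t; hence both have
   room to move outwards. *)
have {}rs : (r < s)%N.
  rewrite ltn_neqAle rs andbT; apply: contraTneq q1s => rs'.
  rewrite -leqNgt -[q.-1](@inordK n') //.
  by apply: sf; rewrite pe rs' inord_val.
have rn : (r < n)%N by exact: ltn_trans rs sn.
have {}tq1 : (t < q.-1)%N.
  rewrite ltn_neqAle tq1 andbT; apply: contraTneq (leq_trans tq qr) => tq1'.
  rewrite -leqNgt -[r](@inordK n') //.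
  by apply: tl; rewrite -pe -tq1' inord_val.
have h2 : in_span (param r * Yv q.-1).
  apply: in_span_param => //; first by rewrite neq_ltn rs.
  by apply: in_span_Yv; rewrite ltnW // ltnW.
have h3 : in_span (Yv q.-1 * Yv r.+1).
  apply: IH => //; last exact: leq_trans (ltnW q1q) (leqW qr).
  by rewrite subnS -ltnS prednK // subn_gt0.
apply: in_span_ext (in_spanD (in_spanD h1 (in_spanN h2)) h3) => u hu.
rewrite !(mevalD, mevalN, mevalM) e param_eval /param_val.
rewrite ltnNge (ltnW (leq_trans tq qr)) /= rs !Yv_eval.
have := chart_eq hu pe => c; rewrite mulrDl c.
by ring.
Qed.

Lemma in_span_YvYv q r : (t <= q <= s)%N -> (t <= r <= s)%N ->
  in_span (Yv q * Yv r).
Proof.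
wlog qr : q r / (q <= r)%N.
  move=> h hq hr; have [qr|/ltnW qr] := leqP q r; first exact: h.
  by rewrite mulrC; apply: h.
move=> /andP[]; rewrite leq_eqVlt => /orP[/eqP <- _ hr|tq qs /andP[_ rs]].
  apply: in_span_ext (in_span_Yv hr) => u hu.
  by rewrite mevalM !Yv_eval chart_yt // mul1r.
exact: in_span_YvYv_lt.
Qed.

(** The span contains 1 = y_t, so once it is stable under all polynomials it contains all of
    them. *)
Definition mul_stable f : Prop := forall g, in_span g -> in_span (f * g).

Lemma mul_stable_ext f f' : (forall u, chart u -> f.@[u] = f'.@[u]) ->
  mul_stable f' -> mul_stable f.
Proof.
move=> h hf' g hg; apply: in_span_ext (hf' g hg) => u hu.
by rewrite !mevalM h.
Qed.

Lemma mul_stableM f f' : mul_stable f -> mul_stable f' -> mul_stable (f * f').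
Proof. by move=> h h' g hg; rewrite -mulrA; apply/h/h'. Qed.

Lemma mul_stableB f f' : mul_stable f -> mul_stable f' -> mul_stable (f - f').
Proof.
move=> h h' g hg; rewrite mulrBl; apply: in_spanD; first exact: h.
by apply/in_spanN/h'.
Qed.

Lemma mul_stable0 : mul_stable 0.
Proof. by move=> g _; rewrite mul0r -(rmorph0 chart_eta) -[X in in_span X]mul1r mulrC;
  apply: in_span_eta; apply: in_span_ext (in_span_Yv (_ : t <= t <= s)%N);
  rewrite ?leqnn ?le_ts // => u hu; rewrite meval1 Yv_eval chart_yt. Qed.

Lemma mul_stable_Yv q : (t <= q <= s)%N -> mul_stable (Yv q).
Proof.
move=> hq g [b hb].
apply: (@in_span_ext _ (\sum_j chart_eta (b j) * (Yv q * Yv (t + j)))) => [u hu|].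
  rewrite mevalM hb // big_distrr raddf_sum /=; apply: eq_bigr => j _.
  by rewrite !mevalM chart_eta_eval !Yv_eval mulrCA.
elim/big_ind: _; first by have := mul_stable0 (in_span_Yv hq); rewrite mul0r.
  by move=> f f'; apply: in_spanD.
move=> j _; apply/in_span_eta/in_span_YvYv => //.
have := ltn_ord j; rewrite ltnS leq_addr /= => js.
by rewrite -leq_subRL ?le_ts.
Qed.

Lemma mul_stable_param q : q != s -> (q < n)%N -> mul_stable (param q).
Proof. by move=> qs qn g; apply: in_span_param. Qed.

Lemma mul_stable_Xs : mul_stable (Xv s).
Proof.
move=> g; apply: in_span_ext => u hu.
by rewrite mevalM Xv_eval chart_xs // mul1r.
Qed.

Lemma mul_stable_Xv_ge q : (t <= q)%N -> (q < n)%N -> mul_stable (Xv q).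
Proof.
move=> tq qn; have [qs|qs|->] := ltngtP q s; last exact: mul_stable_Xs.
- apply: (@mul_stable_ext _ (param q - Yv q.+1)).
    move=> u _; rewrite mevalB param_eval /param_val ltnNge tq /= qs.
    by rewrite Yv_eval Xv_eval addrK.
  apply: mul_stableB; first by apply: mul_stable_param => //; rewrite neq_ltn qs.
  by apply: mul_stable_Yv; rewrite (leqW tq).
- apply: (@mul_stable_ext _ (param q)).
    by move=> u _; rewrite param_eval /param_val !ltnNge tq (ltnW qs) /= Xv_eval.
  by apply: mul_stable_param => //; rewrite neq_ltn qs orbT.
Qed.

Lemma mul_stable_Yv_le q : (q <= s)%N -> mul_stable (Yv q).
Proof.
move=> qs; have [qt|tq] := ltnP q t; last by apply: mul_stable_Yv; rewrite tq.
apply: (@mul_stable_ext _ (param q)).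
  by move=> u _; rewrite param_eval /param_val qt Yv_eval.
apply: mul_stable_param; last exact: ltn_trans (ltn_ord t).
by rewrite neq_ltn (leq_trans qt le_ts).
Qed.

(** Before t, x_q equals x_q y_t on the chart, which is 0 or x_t y_q; the variables y_q after s are
    treated in the same way with x_s = 1. *)
Lemma mul_stable_Xv q : (q < n)%N -> mul_stable (Xv q).
Proof.
move=> qn; have [qt|] := ltnP q t; last by move=> tq; apply: mul_stable_Xv_ge.
have := posnM (ltnW qt) (ltn_ord t); rewrite leq_eqVlt => /orP[/eqP pe|lt].
  apply: (@mul_stable_ext _ (Xv t * Yv q)).
    move=> u hu; rewrite mevalM !Xv_eval Yv_eval -(chart_eq hu pe).
    by rewrite chart_yt // mulr1.
  apply: mul_stableM; first exact: mul_stable_Xv_ge (ltn_ord t).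
  exact: mul_stable_Yv_le (leq_trans (ltnW qt) le_ts).
apply: (@mul_stable_ext _ 0); last exact: mul_stable0.
move=> u hu; rewrite meval0 Xv_eval -[LHS]mulr1 -(chart_yt hu).
exact: chart_lt.
Qed.

Lemma mul_stable_Yv_all q : (q < n)%N -> mul_stable (Yv q).
Proof.
move=> qn; have [qs|sq] := leqP q s; first exact: mul_stable_Yv_le.
have := posnM (ltnW sq) qn; rewrite leq_eqVlt => /orP[/eqP pe|lt].
  apply: (@mul_stable_ext _ (Xv q * Yv s)).
    move=> u hu; rewrite mevalM !Yv_eval Xv_eval -(chart_eq hu pe).
    by rewrite chart_xs // mul1r.
  apply: mul_stableM; first exact: mul_stable_Xv.
  exact: mul_stable_Yv_le.
apply: (@mul_stable_ext _ 0); last exact: mul_stable0.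
move=> u hu; rewrite meval0 Yv_eval -[LHS]mul1r -(chart_xs hu).
exact: chart_lt.
Qed.

Lemma mul_stable_all f : mul_stable f.
Proof.
have hv i : mul_stable ('X_i : {mpoly k[n + n]}).
  rewrite -(splitK i); case: (fintype.split i) => j /=.
    by rewrite -(inord_val j); apply: mul_stable_Xv.
  by rewrite -(inord_val j); apply: mul_stable_Yv_all.
have h1 : mul_stable 1 by move=> g; rewrite mul1r.
move=> g hg; rewrite [f]mpolyE mulr_suml.
elim/big_ind: _; first by have := mul_stable0 hg; rewrite mul0r.
  by move=> x y; apply: in_spanD.
move=> m _; rewrite -mul_mpolyC -mulrA.
have -> : (f@_m)%:MP = chart_eta (f@_m)%:MP by rewrite /chart_eta mmapC.
apply: in_span_eta; suff : mul_stable ('X_[m] : {mpoly k[n + n]}) by apply.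
rewrite mpolyXE_id; elim/big_ind: _ => //; first exact: mul_stableM.
move=> i _; elim: (m i) => [|e IH]; first by rewrite expr0.
by rewrite exprS; apply: mul_stableM.
Qed.

Lemma chart_span f : in_span f.
Proof.
rewrite -[f]mulr1; apply: mul_stable_all.
have ht : (t <= t <= s)%N by rewrite leqnn le_ts.
apply: in_span_ext (in_span_Yv ht) => u hu.
by rewrite meval1 Yv_eval chart_yt.
Qed.

End Chart.

(** * Independence of the generators of the chart ring *)

Section ChartFree.
Variables (k : closedFieldType) (n' : nat).
Local Notation n := n'.+1.
Variables (pos : 'I_n -> nat) (Lam : seq nat) (s t : 'I_n).
Hypothesis posM : forall i j : 'I_n, (i <= j)%N -> (pos i <= pos j)%N.
Hypothesis posL : forall i, pos i \in Lam.
Hypothesis st : chart_indices pos s t.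
Local Notation xn u q := (xc u (inord q)).
Local Notation yn u q := (yc u (inord q)).
Local Notation posn q := (pos (inord q)).

Variable b : nat -> {mpoly k[n']}.
Hypothesis hb : forall u, chart pos Lam s t u ->
  \sum_(t <= q < s.+1) (b q).@[skip s (param_val s t u)] * yn u q = 0.

(** The way in which the relation is exploited: for given parameter values g one constructs a point
    of the component l of the chart having these parameters. *)
Lemma relation_at (l : nat) (x y g : nat -> k) : l \in Lam ->
  (forall q, (q < n)%N -> (posn q < l)%N -> x q = 0) ->
  (forall q, (q < n)%N -> (l < posn q)%N -> y q = 0) ->
  (forall q r, (q < n)%N -> (r < n)%N -> posn q = l -> posn r = l ->
     x q * y r = x r * y q) ->
  x s = 1 -> y t = 1 ->
  (forall q, (q < n)%N -> q != s ->
     (if (q < t)%N then y q else if (q < s)%N then x q + y q.+1 else x q) = g q) ->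
  \sum_(t <= q < s.+1) (b q).@[skip s g] * y q = 0.
Proof.
move=> lL hx hy hxy xs yt hg.
pose u : 'I_(n + n) -> k := mkpt (fun i => x (val i)) (fun i => y (val i)).
have xu q : (q < n)%N -> xn u q = x q by move=> qn; rewrite xc_mkpt /= inordK.
have yu q : (q < n)%N -> yn u q = y q by move=> qn; rewrite yc_mkpt /= inordK.
have cu : chart pos Lam s t u.
  split; [exists l => //; split|by rewrite xc_mkpt|by rewrite yc_mkpt].
  - by move=> i il; rewrite xc_mkpt; apply: hx; rewrite ?inord_val ?ltn_ord.
  - by move=> i il; rewrite yc_mkpt; apply: hy; rewrite ?inord_val ?ltn_ord.
  - by move=> i j il jl; rewrite !xc_mkpt !yc_mkpt; apply: hxy; rewrite ?inord_val ?ltn_ord.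
rewrite -[RHS](hb cu) !big_nat; apply: eq_bigr => q /andP[tq qs].
have sn := ltn_ord s; rewrite yu ?(leq_trans qs) //; congr (_ * _).
apply: meval_eq => i; rewrite /skip /param_val -hg; last 2 first.
- exact: ltn_ord.
- by have := neq_lift s i; rewrite eq_sym.
have hi := ltn_ord (lift s i); case: ifP => [it|it]; first by rewrite yu.
case: ifP => [iS|_]; last by rewrite xu.
by rewrite xu // yu // (leq_ltn_trans iS).
Qed.

Lemma independent_same : t = s -> b t = 0.
Proof.
move=> ts; apply: (@skip_eq0 _ _ s) => g.
pose g1 (q : nat) : k := if q == s :> nat then 1 else g q.
have := @relation_at (pos s) (fun q => if (pos s <= posn q)%N then g1 q else 0)
  (fun q => if (posn q <= pos s)%N then g1 q else 0) g.
rewrite ts big_nat1 !inord_val leqnn /g1 eqxx mulr1; apply=> //.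
- by move=> q _; rewrite ltnNge => /negPf ->.
- by move=> q _; rewrite ltnNge => /negPf ->.
- by move=> q r _ _ -> ->; rewrite leqnn mulrC.
move=> q qn qs; rewrite (negPf qs); case: ltnP => [lt|].
  have /= := @posM (inord q) s; rewrite inordK // => -> //; exact: ltnW.
move=> sq; have /= := @posM s (inord q); rewrite inordK // => -> //.
Qed.

Hypothesis pts : (pos t < pos s)%N.
Hypothesis tlast : forall q, pos q = pos t -> (q <= t)%N.
Hypothesis sfirst : forall q, pos q = pos s -> (s <= q)%N.

Let lt_ts : (t < s)%N.
Proof. by rewrite ltnNge; apply/negP => /posM; rewrite leqNgt pts. Qed.

Let posn_t : posn t = pos t. Proof. by rewrite inord_val. Qed.
Let posn_s : posn s = pos s. Proof. by rewrite inord_val. Qed.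

Let pm q r : (q <= r)%N -> (r < n)%N -> (posn q <= posn r)%N.
Proof. exact: posnM. Qed.

(** On the component of the class of t all y_q with q > t vanish, and only the term of y_t = 1
    survives. The factor g t * g q is forced by x_q y_t = x_t y_q. *)
Lemma independent_first : b t = 0.
Proof.
apply: (@skip_eq0 _ _ s) => g.
have tlt q : (q < n)%N -> (t < q)%N -> (pos t < posn q)%N.
  move=> qn tq; have := pm (ltnW tq) qn; rewrite posn_t leq_eqVlt.
  by case/orP => // /eqP/esym/tlast; rewrite inordK // leqNgt tq.
have := @relation_at (pos t)
  (fun q => if q == s :> nat then 1 else if (q < t)%N then
              if posn q == pos t then g t * g q else 0 else g q)
  (fun q => if (q < t)%N then g q else (q == t :> nat)%:R) g.
rewrite big_nat_recl ?(ltnW lt_ts) // ltnn !eqxx /= ?mulr1n mulr1 big1_seq ?addr0.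
  apply=> //.
  - move=> q qn qt; case: eqP => [qs|_].
      by move: qt; rewrite qs posn_s ltnNge (ltnW pts).
    case: ltnP => [_|tq]; first by rewrite ltn_eqF.
    by have := pm tq qn; rewrite posn_t leqNgt qt.
  - move=> q qn tq; have [qt|] := ltnP q t.
      by have := pm (ltnW qt) (ltn_ord t); rewrite posn_t leqNgt tq.
    by case: eqP => // qt; move: tq; rewrite qt posn_t ltnn.
  - have h q : (q < n)%N -> posn q = pos t -> (q <= t)%N.
      by move=> qn /tlast; rewrite inordK.
    move=> q r qn rn qt rt; have := h _ qn qt; have := h _ rn rt.
    have qs a : (a <= t)%N -> (a == s) = false.
      by move=> at_; rewrite ltn_eqF // (leq_ltn_trans at_).
    move=> rt' qt'; rewrite !qs // qt rt eqxx.
    by case: (ltngtP q t) qt' => // [_|->] _; case: (ltngtP r t) rt' => // [_|->] _;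
      rewrite ?mulr1n; ring.
  move=> q qn qs; rewrite (negPf qs); case: ltnP => // tq.
  case: ifP => // _; by rewrite ltnNge (leqW tq) /= gtn_eqF ?addr0.
move=> q /=; rewrite mem_index_iota => /andP[tq _].
by rewrite ltnNge (leqW tq) /= gtn_eqF ?mulr0.
Qed.

(** On the component of the class of s the x_q with q < s vanish, so the parameter of index s - 1 is
    y_s itself, and the relation becomes [b s] times a variable. The factor [g s.-1 * g q] is forced
    by x_s y_q = x_q y_s. *)
Lemma independent_last : (forall q, (t <= q < s)%N -> b q = 0) -> b s = 0.
Proof.
move=> b0.
have s0 : (0 < s)%N by apply: leq_ltn_trans lt_ts.
have ln : (s.-1 < n')%N by rewrite -ltnS prednK.
suff : b s * 'X_(Ordinal ln) = 0.
  move/eqP; rewrite mulf_eq0 => /orP[/eqP //|].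
  by move/eqP/mpolyP/(_ U_(Ordinal ln)%MM)/eqP; rewrite mcoeffXU eqxx mcoeff0 oner_eq0.
apply: (@skip_eq0 _ _ s) => g; rewrite mevalM mevalXU.
have -> : skip s g (Ordinal ln) = g s.-1.
  by rewrite /skip /= /bump leqNgt prednK // leqnn.
have slt q : (q < s)%N -> (posn q < pos s)%N.
  move=> qs; have := pm (ltnW qs) (ltn_ord s); rewrite posn_s leq_eqVlt.
  case/orP => // /eqP/sfirst.
  by rewrite inordK ?(ltn_trans qs) // leqNgt qs.
pose x q := if q == s :> nat then 1 else if (q < s)%N then 0 else g q.
pose y q := if (q < t)%N then g q else if q == t :> nat then 1 else
  if (q <= s)%N then g q.-1 else if posn q == pos s then g s.-1 * g q else 0.
have rel : \sum_(t <= q < s.+1) (b q).@[skip s g] * y q = 0.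
  apply: (@relation_at (pos s) x y g) => //; rewrite /x /y {x y}.
  - move=> q qn qs; case: eqP => [qs'|_].
      by move: qs; rewrite qs' posn_s ltnn.
    case: ltnP => // sq.
    by have := pm sq qn; rewrite posn_s leqNgt qs.
  - move=> q qn sq; have lsq : (s < q)%N.
      rewrite ltnNge; apply/negP => qs; have := pm qs (ltn_ord s).
      by rewrite posn_s leqNgt sq.
    rewrite ltnNge (ltnW (ltn_trans lt_ts lsq)) /= gtn_eqF ?(ltn_trans lt_ts) //.
    by rewrite leqNgt lsq /= gtn_eqF.
  - have h q : (q < n)%N -> posn q = pos s -> (s <= q)%N.
      by move=> qn /sfirst; rewrite inordK.
    move=> q r qn rn qs rs; have := h _ qn qs; have := h _ rn rs.
    have qt a : (s <= a)%N -> (((a < t)%N = false) * ((a == t :> nat) = false))%type.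
      move=> sa; have ta := leq_trans lt_ts sa.
      by rewrite ltnNge (ltnW ta) gtn_eqF.
    move=> rs' qs'; rewrite !qt // qs rs eqxx.
    by case: (ltngtP s q) qs' => // [_|<-] _; case: (ltngtP s r) rs' => // [_|<-] _;
      rewrite ?eqxx; ring.
  - by rewrite eqxx.
  - by rewrite ltnn eqxx.
  move=> q qn qs; rewrite (negPf qs); case: ltnP => // tq.
  case: ltnP => // lqs.
  by rewrite [(q.+1 < t)%N]ltnNge (leqW tq) /= gtn_eqF // add0r.
move: rel; rewrite big_nat_recr ?(ltnW lt_ts) //= big1_seq ?add0r.
  by rewrite /y [(s < t)%N]ltnNge (ltnW lt_ts) /= gtn_eqF // leqnn.
by move=> q /=; rewrite mem_index_iota => /b0->; rewrite meval0 mul0r.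
Qed.

(** On the class of q0, the component l has one point over g for each root r of the polynomial
    formed by the parameters. Each point turns the relation into a linear condition on the unknown
    values, whose coefficients are those of the polynomial divided by X - r; [deflated_factors]
    concludes. *)
Lemma independent_middle q0 : (t < q0)%N -> (q0 < s)%N ->
  (pos t < posn q0)%N -> (posn q0 < pos s)%N ->
  (forall q, (t <= q <= s)%N -> (posn q < posn q0)%N -> b q = 0) -> b q0 = 0.
Proof.
move=> tq0 q0s pt ps b0; pose l := posn q0.
have sn := ltn_ord s; have q0n : (q0 < n)%N := ltn_trans q0s sn.
have exl : exists q, (q <= q0)%N && (posn q == l) by exists q0; rewrite leqnn /=.
have exr : exists q, (q < n)%N && (posn q == l) by exists q0; rewrite q0n /=.
case: (ex_minnP exl) => l1 /andP[l1q /eqP pl1] min1.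
have [|l2 /andP[l2n /eqP pl2] max2] := @ex_maxnP _ n exr.
  by move=> q /andP[/ltnW].
have q0l2 : (q0 <= l2)%N by apply: max2; rewrite q0n /=.
have l12 : (l1 <= l2)%N := leq_trans l1q q0l2.
have tl1 : (t < l1)%N.
  rewrite ltnNge; apply/negP => l1t; have := pm l1t (ltn_ord t).
  by rewrite posn_t pl1 leqNgt pt.
have l2s : (l2 < s)%N.
  rewrite ltnNge; apply/negP => sl2; have := pm sl2 l2n.
  by rewrite posn_s pl2 leqNgt ps.
have lt1 q : (q < n)%N -> (posn q < l)%N -> (q < l1)%N.
  move=> qn ql; rewrite ltnNge; apply/negP => l1q'; have := pm l1q' qn.
  by rewrite pl1 leqNgt ql.
have lt1' q : (q < l1)%N -> (posn q < l)%N.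
  move=> ql1; have ql : (q <= q0)%N := leq_trans (ltnW ql1) l1q.
  rewrite ltn_neqAle /l pm // andbT; apply/negP => pq.
  by have := min1 q; rewrite ql pq leqNgt ql1 => /(_ isT).
have gt2 q : (q < n)%N -> (l < posn q)%N -> (l2 < q)%N.
  move=> qn ql; rewrite ltnNge; apply/negP => l1q'; have := pm l1q' l2n.
  by rewrite pl2 leqNgt ql.
have inl q : (q < n)%N -> posn q = l -> (l1 <= q <= l2)%N.
  move=> qn ql; rewrite (max2 q) ?qn ?ql ?eqxx // andbT.
  by rewrite leqNgt; apply/negP => /lt1'; rewrite ql ltnn.
(* The class runs from l1 to l2 and has m elements; the parameters of indices l1 - 1 to l2 are the m
   + 1 coefficients. *)
pose a := l1.-1; pose m := (l2 - l1).+1.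
have aS : a.+1 = l1 by rewrite /a prednK // (leq_ltn_trans _ tl1).
have amE : (a + m)%N = l2 by rewrite /m addnS -addSn aS subnKC.
apply: (@vanish_on_split _ _ s a m); first by rewrite amE.
move=> g c rs c0 urs n0 sz hg.
suff h j : (j < size rs)%N -> (b (l1 + j)%N).@[skip s g] = 0.
  rewrite -[q0 in LHS](subnKC l1q); apply: h.
  by rewrite sz /m ltnS leq_sub2r.
apply: (deflated_factors (be := fun i => (b (l1 + i)%N).@[skip s g]) c0 urs).
move=> r rrs; pose U := c *: \prod_(x <- rem r rs) ('X - x%:P).
have UE : ('X - r%:P) * U = c *: \prod_(x <- rs) ('X - x%:P).
  by rewrite (big_rem r rrs) /= -scalerAr.
exists U => //; rewrite sz.
have sU : (size U <= m)%N.
  apply: leq_trans (size_scale_leq _ _) _.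
  rewrite size_prod_XsubC size_rem // sz; exact: leqnn.
have cU i : (i < m)%N -> g (a + i.+1)%N = U`_i - r * U`_i.+1.
  by move=> im; rewrite hg // -UE mulrBl coefB coefXM coefCM.
(* On the class x is given by U and y by - r U, so that x_q + y_(q+1) runs through the coefficients
   of (X - r) U, with y_(l1) alone at the lower end and x_(l2) alone at the upper end. *)
pose x q := if q == s :> nat then 1 else if (q < l1)%N then 0 else
  if (q <= l2)%N then U`_(q - l1) else g q.
pose y q := if (q < t)%N then g q else if q == t :> nat then 1 else
  if (q < l1)%N then g q.-1 else if (q <= l2)%N then - r * U`_(q - l1) else 0.
have xin q : (l1 <= q <= l2)%N -> x q = U`_(q - l1).
  move=> /andP[q1 q2]; rewrite /x (ltn_eqF (leq_ltn_trans q2 l2s)).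
  by rewrite ltnNge q1 /= q2.
have yin q : (l1 <= q <= l2)%N -> y q = - r * U`_(q - l1).
  move=> /andP[q1 q2]; have tq := leq_trans tl1 q1.
  by rewrite /y ltnNge (ltnW tq) /= gtn_eqF // ltnNge q1 /= q2.
have yout q : (l2 < q)%N -> y q = 0.
  move=> q2; have q1 := leq_ltn_trans l12 q2; have tq := ltn_trans tl1 q1.
  by rewrite /y ltnNge (ltnW tq) /= gtn_eqF // ltnNge (ltnW q1) /= leqNgt q2.
have rel : \sum_(t <= q < s.+1) (b q).@[skip s g] * y q = 0.
  apply: (@relation_at l x y g); first exact: posL.
  - move=> q qn ql; rewrite /x lt1 //; case: eqP => // qs.
    by move: ql; rewrite qs posn_s ltnNge (ltnW ps).
  - by move=> q qn /(gt2 _ qn)/yout.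
  - move=> q p qn pn /(inl _ qn) ql /(inl _ pn) pl.
    by rewrite !xin // !yin //; ring.
  - by rewrite /x eqxx.
  - by rewrite /y ltnn eqxx.
  move=> q qn qs; have [qt|tq] := ltnP q t; first by rewrite /y qt.
  have xo p : (p < l1)%N -> x p = 0.
    move=> pl; rewrite /x pl ltn_eqF //; exact: leq_trans pl (leq_trans l12 (ltnW l2s)).
  have [q2|q2] := leqP q l2; last first.
    rewrite (yout _ (leqW q2)) /x (negPf qs) [(q < l1)%N]ltnNge.
    rewrite (leq_trans l12 (ltnW q2)) /= [(q <= l2)%N]leqNgt q2 /= addr0.
    by case: ifP.
  rewrite (leq_ltn_trans q2 l2s).
  have [q1|q1] := ltnP q l1; last first.
    have qE : q = (a + (q - l1).+1)%N by rewrite addnS -addSn aS subnKC.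
    rewrite xin ?q1 // [in RHS]qE cU; last by rewrite /m ltnS leq_sub2r.
    move: q2; rewrite leq_eqVlt => /orP[/eqP q2|q2]; last first.
      by rewrite yin ?(leqW q1) // subSn // mulNr.
    rewrite yout ?q2 // -/m [U`_m]nth_default ?mulr0 ?subr0 ?addr0 //.
  rewrite xo // add0r; move: q1; rewrite -aS ltnS leq_eqVlt => /orP[/eqP q1|q1].
    rewrite q1 aS yin ?leqnn // subnn mulNr -[in RHS](addn0 a) hg //.
    by rewrite -UE mulrBl coefB coefXM coefCM sub0r.
  rewrite /y ltnNge (leqW tq) /= gtn_eqF //.
  by have -> : (q.+1 < l1)%N by rewrite -aS ltnS.
have sl2 : (l2 < s.+1)%N by apply: ltnW.
rewrite (big_cat_nat (n := l1)) ?(ltnW tl1) //= in rel; last first.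
  exact: leq_trans l12 (ltnW sl2).
rewrite [X in X + _]big1_seq ?add0r in rel; last first.
  move=> q /=; rewrite mem_index_iota => /andP[tq ql]; rewrite b0 ?meval0 ?mul0r //.
    by rewrite tq (leq_trans (ltnW ql)) // (leq_trans l12) // ltnW.
  exact: lt1'.
rewrite (big_cat_nat (n := l2.+1)) ?(leqW l12) //= in rel.
rewrite [X in _ + X]big1_seq ?addr0 in rel; last first.
  by move=> q /=; rewrite mem_index_iota => /andP[/yout -> _]; rewrite mulr0.
have r0 : - r != 0 by rewrite oppr_eq0; apply: contraNneq n0 => <-.
rewrite -{1}[l1]add0n big_addn subSn // -/m big_mkord in rel.
apply: (mulfI r0); rewrite mulr0 -[RHS]rel big_distrr /=; apply: eq_bigr => i _.
have im := ltn_ord i.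
rewrite [(i + l1)%N]addnC yin; first by rewrite addKn; ring.
by rewrite leq_addr -amE -aS addSnnS leq_add2l.
Qed.

End ChartFree.

(** Induction on the position of q: on the component of its class, which exists by the hypothesis on
    [Lam], later classes do not contribute and the coefficients of earlier classes are already
    zero. *)
Theorem chart_free (k : closedFieldType) (n' : nat) (pos : 'I_n'.+1 -> nat)
    (Lam : seq nat) (s t : 'I_n'.+1) :
  (forall i j : 'I_n'.+1, (i <= j)%N -> (pos i <= pos j)%N) ->
  (forall i, pos i \in Lam) -> chart_indices pos s t ->
  free_modulo (@chart_eta k n' s t) (@chart_om k n' s t) (chart_ideal pos Lam s t).
Proof.
move=> posM posL st; have tsle := le_ts posM st.
have sumE (F : nat -> k) : \sum_(t <= q < s.+1) F q = \sum_(j < (s - t).+1) F (t + j)%N.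
  rewrite -{1}[nat_of_ord t]add0n big_addn subSn // big_mkord.
  by apply: eq_bigr => j _; rewrite addnC.
split.
- split=> [u _|r x y hx hy u hu]; first by rewrite meval0.
  by rewrite mevalD mevalM hx // hy // mulr0 addr0.
- move=> f; have [b hb] := @chart_span _ _ pos Lam s t posM st f; exists b => u hu.
  rewrite mevalB (raddf_sum (meval u)) /= hb //; apply/eqP; rewrite subr_eq0; apply/eqP.
  by apply: eq_bigr => j _; rewrite mevalM chart_eta_eval Yv_eval.
move=> b0 hb0; pose b q := b0 (inord (q - t)).
have hb u : chart pos Lam s t u ->
    \sum_(t <= q < s.+1) (b q).@[skip s (param_val s t u)] * yc u (inord q) = 0.
  move=> hu; rewrite sumE -[RHS](hb0 u hu) raddf_sum /=; apply: eq_bigr => j _.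
  by rewrite mevalM chart_eta_eval Yv_eval /b addKn inord_val.
suff h e q : (pos (inord q) < e)%N -> (t <= q <= s)%N -> b q = 0.
  move=> j; rewrite -(inord_val j) -(addKn t j); apply: (h _ _ (leqnn _)).
  by rewrite leq_addr -leq_subRL // -ltnS ltn_ord.
elim: e q => // e IH q; rewrite ltnS => pe /andP[tq qs].
case: (st) => [ts|[pts tl sf]].
  have -> : q = t by apply/eqP; rewrite eqn_leq tq andbT ts.
  exact: (independent_same posM posL hb).
have [qt|tq'] := leqP q t.
  have -> : q = t by apply/eqP; rewrite eqn_leq tq qt.
  exact: (independent_first posM posL hb).
have sn := ltn_ord s.
have qn : (q < n'.+1)%N := leq_ltn_trans qs sn.
have pt : (pos t < pos (inord q))%N.
  have /= := posM t (inord q); rewrite inordK // => /(_ tq).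
  by rewrite leq_eqVlt; case/orP => // /eqP/esym/tl; rewrite inordK // leqNgt tq'.
have [qs'|sq] := ltnP q s; last first.
  have qE : q = s by apply/eqP; rewrite eqn_leq qs sq.
  rewrite qE; apply: (independent_last posM posL hb) => // q' /andP[tq1 qs1].
  apply: IH; last by rewrite tq1 ltnW.
  apply: leq_trans pe; rewrite qE inord_val.
  have /= := posM (inord q') s; rewrite inordK ?(ltn_trans qs1) // => /(_ (ltnW qs1)).
  rewrite leq_eqVlt => /orP[/eqP/sf|//].
  by rewrite inordK ?(ltn_trans qs1) // leqNgt qs1.
apply: (independent_middle posM posL hb) => //.
  have /= := posM (inord q) s; rewrite inordK // => /(_ qs).
  rewrite leq_eqVlt => /orP[/eqP/sf|//].
  by rewrite inordK // leqNgt qs'.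
by move=> q' hq' pq; apply: IH => //; apply: leq_trans pq pe.
Qed.

(** * Bihomogeneous coordinates *)

Section Scaling.
Variables (k : closedFieldType) (n : nat).
Implicit Types (u : 'I_(n + n) -> k) (p q : {mpoly k[n + n]}) (a b : nat).

Definition sc (c d : k) u : 'I_(n + n) -> k :=
  mkpt (fun s => c * xc u s) (fun s => d * yc u s).

Lemma xc_sc c d u s : xc (sc c d u) s = c * xc u s.
Proof. exact: xc_mkpt. Qed.

Lemma yc_sc c d u s : yc (sc c d u) s = d * yc u s.
Proof. exact: yc_mkpt. Qed.

Lemma sc_sc c d c' d' u : sc c d (sc c' d' u) = sc (c * c') (d * d') u.
Proof. by apply: pt_ext => s; rewrite ?xc_sc ?yc_sc mulrA. Qed.

Lemma sc1 u : sc 1 1 u = u.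
Proof. by apply: pt_ext => s; rewrite ?xc_sc ?yc_sc mul1r. Qed.

(* Tested on values, unlike [bihomog]. *)
Definition hom2 a b p : Prop :=
  forall c d u, p.@[sc c d u] = c ^+ a * d ^+ b * p.@[u].

Lemma hom2M a b a' b' p q :
  hom2 a b p -> hom2 a' b' q -> hom2 (a + a') (b + b') (p * q).
Proof.
by move=> hp hq c d u; rewrite !mevalM hp hq !exprD; ring.
Qed.

Lemma hom2D a b p q : hom2 a b p -> hom2 a b q -> hom2 a b (p + q).
Proof. by move=> hp hq c d u; rewrite !mevalD hp hq mulrDr. Qed.

Lemma hom2N a b p : hom2 a b p -> hom2 a b (- p).
Proof. by move=> hp c d u; rewrite !mevalN hp mulrN. Qed.

Lemma hom2Z a b e p : hom2 a b p -> hom2 a b (e *: p).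
Proof. by move=> hp c d u; rewrite !mevalZ hp mulrCA. Qed.

Lemma hom2_1 : hom2 0 0 1.
Proof. by move=> c d u; rewrite !meval1 !mul1r. Qed.

Lemma hom2_C e : hom2 0 0 e%:MP.
Proof. by move=> c d u; rewrite !mevalC !mul1r. Qed.

Lemma hom2_0 a b : hom2 a b 0.
Proof. by move=> c d u; rewrite !meval0 mulr0. Qed.

Definition Xp s : {mpoly k[n + n]} := 'X_(lshift n s).
Definition Yp s : {mpoly k[n + n]} := 'X_(rshift n s).

Lemma Xp_eval u s : (Xp s).@[u] = xc u s. Proof. exact: mevalXU. Qed.
Lemma Yp_eval u s : (Yp s).@[u] = yc u s. Proof. exact: mevalXU. Qed.

Lemma hom2_X s : hom2 1 0 (Xp s).
Proof. by move=> c d u; rewrite !Xp_eval xc_sc expr1 mulr1. Qed.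

Lemma hom2_Y s : hom2 0 1 (Yp s).
Proof. by move=> c d u; rewrite !Yp_eval yc_sc expr1 mul1r. Qed.

End Scaling.

Lemma mmap_mpolyC_eval (k : comNzRingType) (N M : nat) (h : 'I_N -> {mpoly k[M]})
    (f : {mpoly k[N]}) v :
  (mmap (@mpolyC M k) h f).@[v] = f.@[fun i => (h i).@[v]].
Proof.
rewrite /mmap raddf_sum mevalE; apply: eq_bigr => m _ /=.
rewrite mevalM mevalC /mmap1 rmorph_prod; congr (_ * _); apply: eq_bigr => i _.
by rewrite rmorphXn.
Qed.

(** Stated on values, bihomogeneity no longer depends on the chosen bases. The converse tests the
    weights that are 1 on one block of variables and 0 on the other. *)
Lemma bihomogP (k : closedFieldType) (V W : vectType k) a b
    (f : {mpoly k[\dim {:V} + \dim {:W}]}) :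
  bihomog a b f <-> forall c d (z : V * W),
    peval f (c *: z.1, d *: z.2) = c ^+ a * d ^+ b * peval f z.
Proof.
pose e (z : V * W) (r : 'I_(\dim {:V} + \dim {:W})) :=
  match fintype.split r with
  | inl s => coord (vbasis {:V}) s z.1 | inr t => coord (vbasis {:W}) t z.2 end.
pose wt c d (r : 'I_(\dim {:V} + \dim {:W})) : k :=
  match fintype.split r with inl _ => c | inr _ => d end.
have eE c d z : e (c *: z.1, d *: z.2) = fun r => wt c d r * e z r.
  by apply/funext => r; rewrite /e /wt; case: fintype.split => s; rewrite linearZ.
split=> [hf c d z|hf].
  rewrite /peval -!/(e _) eE !mevalE big_distrr /= !big_seq.
  apply: eq_bigr => m /hf[ha hb]; rewrite mulrCA; congr (_ * _).
  rewrite -ha -hb -!prodrXr !big_split_ord /= mulrACA; congr (_ * _);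
    rewrite -big_split /=; apply: eq_bigr => s _; rewrite exprMn; congr (_ * _);
    by rewrite /wt ?(unsplitK (inl s)) ?(unsplitK (inr s)).
have ez v : exists z, e z = v.
  exists (\sum_s v (lshift _ s) *: (vbasis {:V})`_s,
          \sum_t v (rshift _ t) *: (vbasis {:W})`_t).
  apply/funext => r; rewrite /e -{2}(splitK r).
  case: (fintype.split r) => s /=; rewrite coord_sum_free //;
    exact: basis_free (vbasisP _).
have hw c d v : f.@[fun r => wt c d r * v r] = c ^+ a * d ^+ b * f.@[v].
  by have [z <-] := ez v; rewrite -eE; apply: hf.
move=> m mf; split.
  pose w (r : 'I_(\dim {:V} + \dim {:W})) := if fintype.split r is inl _ then 1%N else 0%N.
  have := @msupp_wdeg _ _ w f (fun e => e != a) _ m mf.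
  rewrite negbK => h; have /eqP <- : wdeg w m == a.
    apply: h => v; exists (f.@[v] *: 'X^a); split=> [e' /negPf ea|t].
      by rewrite coefZ coefXn ea mulr0.
    rewrite hornerZ hornerXn mulrC -[t ^+ a]mulr1 -(expr1n _ b) -hw.
    apply: meval_eq => r; rewrite /w /wt.
    by case: fintype.split => _; rewrite ?expr1 ?expr0.
  rewrite /wdeg big_split_ord /= [X in _ = (_ + X)%N]big1 ?addn0.
    by apply: eq_bigr => s _; rewrite /w (unsplitK (inl s)) mul1n.
  by move=> s _; rewrite /w (unsplitK (inr s)) mul0n.
pose w (r : 'I_(\dim {:V} + \dim {:W})) := if fintype.split r is inl _ then 0%N else 1%N.
have := @msupp_wdeg _ _ w f (fun e => e != b) _ m mf.
rewrite negbK => h; have /eqP <- : wdeg w m == b.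
  apply: h => v; exists (f.@[v] *: 'X^b); split=> [e' /negPf ea|t].
    by rewrite coefZ coefXn ea mulr0.
  rewrite hornerZ hornerXn mulrC -[t ^+ b]mul1r -(expr1n _ a) -hw.
  apply: meval_eq => r; rewrite /w /wt.
  by case: fintype.split => _; rewrite ?expr1 ?expr0.
rewrite /wdeg big_split_ord /= [X in _ = (X + _)%N]big1 ?add0n.
  by apply: eq_bigr => s _; rewrite /w (unsplitK (inr s)) mul1n.
by move=> s _; rewrite /w (unsplitK (inl s)) mul0n.
Qed.

Section Coordinates.
Variables (k : closedFieldType) (V W : vectType k) (n : nat).
Variables (ba : n.-tuple V) (bb : n.-tuple W).
Hypothesis hba : basis_of fullv ba.
Hypothesis hbb : basis_of fullv bb.
Implicit Types (z : V * W) (u : 'I_(n + n) -> k) (p q : {mpoly k[n + n]}).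
Implicit Types (P Q : biproj V W) (X U : set (biproj V W)).

Definition cf z : 'I_(n + n) -> k :=
  mkpt (fun s => coord ba s z.1) (fun s => coord bb s z.2).

Definition ofc u : V * W :=
  (\sum_s xc u s *: ba`_s, \sum_s yc u s *: bb`_s).

Lemma cfK : cancel cf ofc.
Proof.
case=> v w; rewrite /ofc /cf; congr pair.
  rewrite [RHS](coord_basis hba (memvf v)); apply: eq_bigr => s _.
  by rewrite xc_mkpt.
rewrite [RHS](coord_basis hbb (memvf w)); apply: eq_bigr => s _.
by rewrite yc_mkpt.
Qed.

Lemma ofcK : cancel ofc cf.
Proof.
move=> u; apply: pt_ext => s; rewrite ?xc_mkpt ?yc_mkpt coord_sum_free //.
  exact: basis_free hba.
exact: basis_free hbb.
Qed.

Lemma ofc_sc c d u : ofc (sc c d u) = (c *: (ofc u).1, d *: (ofc u).2).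
Proof.
by congr pair; rewrite scaler_sumr; apply: eq_bigr => s _;
  rewrite ?xc_sc ?yc_sc scalerA.
Qed.

Lemma cf_scale c d z : cf (c *: z.1, d *: z.2) = sc c d (cf z).
Proof. by apply: (can_inj ofcK); rewrite cfK ofc_sc cfK. Qed.

Lemma bihomog_hom2 a b f : bihomog a b f ->
  exists2 p, hom2 a b p & forall u, p.@[u] = peval f (ofc u).
Proof.
move=> /bihomogP hf.
pose h (r : 'I_(\dim {:V} + \dim {:W})) : {mpoly k[n + n]} :=
  match fintype.split r with
  | inl s => \sum_(i < n) coord (vbasis {:V}) s ba`_i *: Xp k i
  | inr t => \sum_(i < n) coord (vbasis {:W}) t bb`_i *: Yp k i end.
have E u : (mmap (@mpolyC _ k) h f).@[u] = peval f (ofc u).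
  rewrite mmap_mpolyC_eval; apply: meval_eq => r; rewrite /h.
  by case: fintype.split => s; rewrite !raddf_sum /=; apply: eq_bigr => i _;
    rewrite mevalZ ?Xp_eval ?Yp_eval linearZ mulrC.
by exists (mmap (@mpolyC _ k) h f) => // c d u; rewrite !E ofc_sc hf.
Qed.

Lemma hom2_bihomog a b p : hom2 a b p ->
  exists2 f : {mpoly k[\dim {:V} + \dim {:W}]},
    bihomog a b f & forall u, peval f (ofc u) = p.@[u].
Proof.
move=> hp.
pose h (r : 'I_(n + n)) : {mpoly k[\dim {:V} + \dim {:W}]} :=
  match fintype.split r with
  | inl s => \sum_(i < \dim {:V}) coord ba s (vbasis {:V})`_i *: 'X_(lshift _ i)
  | inr t => \sum_(i < \dim {:W}) coord bb t (vbasis {:W})`_i *: 'X_(rshift _ i) end.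
have E z : peval (mmap (@mpolyC _ k) h p) z = p.@[cf z].
  rewrite /peval mmap_mpolyC_eval; apply: meval_eq => r; rewrite /h /cf /mkpt.
  case: (fintype.split r) => s; rewrite !raddf_sum /=.
    rewrite [in RHS](coord_vbasis (memvf z.1)) raddf_sum.
    apply: eq_bigr => i _; rewrite mevalZ mevalXU /= (unsplitK (inl i)).
    by rewrite linearZ mulrC.
  rewrite [in RHS](coord_vbasis (memvf z.2)) raddf_sum.
  apply: eq_bigr => i _; rewrite mevalZ mevalXU /= (unsplitK (inr i)).
  by rewrite linearZ mulrC.
exists (mmap (@mpolyC _ k) h p); last by move=> u; rewrite E ofcK.
by apply/bihomogP => c d z; rewrite !E cf_scale hp.
Qed.

Definition rp P u : Prop := rep P (ofc u).

Definition nz u : Prop := (exists s, xc u s != 0) /\ (exists s, yc u s != 0).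

Lemma rp_ex P : exists u, rp P u.
Proof. by have [z hz] := rep_neq0 P; exists (cf z); rewrite /rp cfK. Qed.

Lemma dim1_vline (U : vectType k) (L : {vspace U}) v :
  \dim L == 1%N -> v \in L -> v != 0 -> L = <[v]>%VS.
Proof.
move=> /eqP d1 vL v0; symmetry; apply/eqP; rewrite eqEdim -memvE vL /=.
by rewrite d1 dim_vline v0.
Qed.

Lemma rp_scale P u c d : rp P u -> c != 0 -> d != 0 -> rp P (sc c d u).
Proof.
move=> [h1 h2 h3 h4] c0 d0; rewrite /rp ofc_sc; split=> /=.
- exact: memvZ.
- by rewrite scaler_eq0 negb_or c0.
- exact: memvZ.
- by rewrite scaler_eq0 negb_or d0.
Qed.

Lemma rp_uniq P u u' : rp P u -> rp P u' ->
  exists c d, [/\ c != 0, d != 0 & u' = sc c d u].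
Proof.
move=> [h1 h2 h3 h4] [h1' h2' h3' h4'].
have E1 := dim1_vline (valP P.1) h1 h2; have E2 := dim1_vline (valP P.2) h3 h4.
move: h1' h3'; rewrite E1 E2 => /vlineP[c hc] /vlineP[d hd].
exists c, d; split.
- by apply: contraNneq h2' => c0; rewrite hc c0 scale0r.
- by apply: contraNneq h4' => c0; rewrite hd c0 scale0r.
by rewrite -[u']ofcK [ofc u']surjective_pairing hc hd cf_scale ofcK.
Qed.

Lemma nzP u : nz u <-> (ofc u).1 != 0 /\ (ofc u).2 != 0.
Proof.
have sum0 (U : vectType k) (bs : n.-tuple U) (F : 'I_n -> k) : free bs ->
    (exists s, F s != 0) <-> \sum_s F s *: bs`_s != 0.
  move=> fr; split=> [[s Fs]|h].
    apply: contraNneq Fs => e; have := coord_sum_free F s fr.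
    by rewrite e linear0 => <-.
  apply: contrapT => h'; move/eqP: h; apply; rewrite big1 // => s _.
  have [->|Fs] := eqVneq (F s) 0; first by rewrite scale0r.
  by case: h'; exists s.
by rewrite /nz (sum0 _ ba _ (basis_free hba)) (sum0 _ bb _ (basis_free hbb)).
Qed.

Lemma rp_nz P u : rp P u -> nz u.
Proof. by case=> _ h _ h'; apply/nzP. Qed.

Lemma nz_rp u : nz u -> exists P, rp P u.
Proof.
move=> /nzP[h1 h2].
have d1 : \dim <[(ofc u).1]>%VS == 1%N by rewrite dim_vline h1.
have d2 : \dim <[(ofc u).2]>%VS == 1%N by rewrite dim_vline h2.
pose P1 : proj V := exist (fun L : {vspace V} => \dim L == 1%N) _ d1.
pose P2 : proj W := exist (fun L : {vspace W} => \dim L == 1%N) _ d2.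
by exists (P1, P2); split=> //=; apply: memv_line.
Qed.

Lemma hom2_rp a b p P u u' : hom2 a b p -> rp P u -> rp P u' ->
  p.@[u] = 0 -> p.@[u'] = 0.
Proof.
move=> hp hu hu'; have [c [d [_ _ ->]]] := rp_uniq hu hu'.
by rewrite hp => ->; rewrite mulr0.
Qed.

Definition vanishes p : set (biproj V W) := [set P | forall u, rp P u -> p.@[u] = 0].

Lemma vanishes_rp a b p P u : hom2 a b p -> rp P u ->
  vanishes p P <-> p.@[u] = 0.
Proof.
move=> hp hu; split; first by apply.
by move=> h u' hu'; apply: hom2_rp hp hu hu' h.
Qed.

Lemma open_nonvanishing a b p : hom2 a b p -> open (~` vanishes p).
Proof.
move=> hp; have [f hf fE] := hom2_bihomog hp.
exists [set f]; split; first by move=> _ ->; exists a, b.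
apply/seteqP; split=> P /=.
  move=> h; exists f => // z hz; rewrite -(cfK z) fE; apply/eqP => p0; apply: h.
  by apply/(vanishes_rp hp); last exact: p0; rewrite /rp cfK.
case=> _ -> h /= h'; have [u hu] := rp_ex P.
by have := h _ hu; rewrite fE h' // eqxx.
Qed.

Lemma closed_vanishing a b p : hom2 a b p -> closed (vanishes p).
Proof. by move=> /open_nonvanishing/open_closedC; rewrite setCK. Qed.

Lemma open_point U P : open U -> U P ->
  exists a b p, [/\ hom2 a b p, ~ vanishes p P & ~` vanishes p `<=` U].
Proof.
case=> F [hF ->] [f Ff hf]; have [a [b hom]] := hF f Ff.
have [p hp pE] := bihomog_hom2 hom; exists a, b, p; split=> //.
  have [u hu] := rp_ex P; move/(_ _ hu) => p0.
  by have := hf _ hu; rewrite -pE p0 eqxx.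
move=> Q /= hQ; exists f => // z hz; rewrite -(cfK z) -pE; apply/eqP => p0.
by apply: hQ; apply/(vanishes_rp hp); last exact: p0; rewrite /rp cfK.
Qed.

Lemma closed_point C P : closed C -> ~ C P ->
  exists a b p, [/\ hom2 a b p, ~ vanishes p P & C `<=` vanishes p].
Proof.
move=> /closed_openC oC CP; have [a [b [p [hp pP h]]]] := open_point oC CP.
exists a, b, p; split=> // Q CQ; apply: contrapT => nv.
exact: h nv CQ.
Qed.

Lemma nbhs_nonvanishing A P : nbhs P A ->
  exists a b p, [/\ hom2 a b p, ~ vanishes p P & ~` vanishes p `<=` A].
Proof.
rewrite nbhsE => -[U [oU UP] UA]; have [a [b [p [hp pP h]]]] := open_point oU UP.
by exists a, b, p; split=> // Q /h/UA.
Qed.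

Definition loc_frac X U a b (s : V * W -> k) : Prop :=
  forall P, X P -> U P -> exists c d p q,
    [/\ hom2 (a + c) (b + d) p, hom2 c d q, ~ vanishes q P &
     forall Q u, X Q -> U Q -> rp Q u -> s (ofc u) * q.@[u] = p.@[u]].

(** Multiplying numerator and denominator by a form that vanishes off the neighbourhood turns a
    local quotient into an identity s q = p that holds at all points of X in U. *)
Lemma section_frac X U a b s : is_section X U a b s <-> loc_frac X U a b s.
Proof.
split=> h P XP UP.
  have [c [d [f [g [hf hg /nbhs_nonvanishing[a' [b' [r [hr rP sub]]]]]]]]] := h P XP UP.
  have [p hp pE] := bihomog_hom2 hf; have [q hq qE] := bihomog_hom2 hg.
  exists (c + a')%N, (d + b')%N, (p * r), (q * r); split.
  - by rewrite !addnA; apply: hom2M.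
  - exact: hom2M.
  - have [u hu] := rp_ex P; move=> /(_ u hu); rewrite mevalM => /eqP.
    rewrite mulf_eq0 qE => /orP[|/eqP r0]; last first.
      by apply: rP; apply/(vanishes_rp hr hu).
    by have /(_ XP UP _ hu)[/negPf -> _] := sub _ rP.
  move=> Q u XQ UQ hu; rewrite !mevalM mulrA.
  have [->|r0] := eqVneq r.@[u] 0; first by rewrite !mulr0.
  have rQ : (~` vanishes r) Q by move/(_ u hu)/eqP; apply/negP.
  have [q0 ->] := sub _ rQ XQ UQ _ hu.
  by rewrite pE qE divfK.
have [c [d [p [q [hp hq qP hs]]]]] := h P XP UP.
have [f hf fE] := hom2_bihomog hp; have [g hg gE] := hom2_bihomog hq.
exists c, d, f, g; split=> //; rewrite nbhsE.
exists (~` vanishes q); first by split=> //; apply: open_nonvanishing hq.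
move=> Q /= qQ XQ UQ z hz; rewrite -(cfK z).
have hu : rp Q (cf z) by rewrite /rp cfK.
have q0 : q.@[cf z] != 0.
  by apply/eqP => q0; apply: qQ; apply/(vanishes_rp hq hu).
by rewrite fE gE q0 -(hs Q) // mulfK.
Qed.

End Coordinates.

(** * Irreducible components *)

Section Topology.
Variable T : topologicalType.
Implicit Types A B C : set T.

Lemma irreducible_connected C : irreducible C -> connected C.
Proof.
move=> [_ irr] B [x Bx] [U oU BU] [D cD BD].
have [|CD|CU] := irr D (~` U) cD (open_closedC oU).
- move=> y Cy; have [Uy|nUy] := pselect (U y); last by right.
  by left; have : B y by [rewrite BU]; rewrite BD => -[].
- by rewrite BD; apply/seteqP; split=> [y []//|y Cy]; split=> //; apply: CD.
- by move: Bx; rewrite BU => -[/CU].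
Qed.

Lemma irreducible_cover C (I : eqType) (r : seq I) (F : I -> set T) :
  irreducible C -> (forall i, i \in r -> closed (F i)) ->
  (forall x, C x -> exists2 i, i \in r & F i x) ->
  exists2 i, i \in r & C `<=` F i.
Proof.
move=> irr; elim: r => [|i r IH] cF cov.
  by case: irr => -[x /cov[]].
pose G := \bigcup_(j in [set j | j \in r]) F j.
have cG : closed G.
  rewrite /G; elim: (r) {IH cov} cF => [|j s IHs] cF.
    rewrite (_ : \bigcup_(_ in _) _ = set0); first exact: closed0.
    by apply/seteqP; split=> x // [].
  rewrite (_ : \bigcup_(_ in _) _ = F j `|` \bigcup_(j in [set j | j \in s]) F j).
    apply: closedU; first by apply: cF; rewrite !inE eqxx orbT.
    apply: IHs => a; rewrite !inE => /orP[/eqP->|as_]; apply: cF; rewrite !inE ?eqxx //.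
    by rewrite as_ !orbT.
  apply/seteqP; split=> x.
    case=> a /=; rewrite inE => /orP[/eqP->|as_] Fx; first by left.
    by right; exists a.
  by case=> [Fx|[a as_ Fx]]; [exists j|exists a] => //=; rewrite inE ?eqxx //;
    rewrite [a \in s]as_ orbT.
have [||Ci|CG] := irr.2 (F i) G _ cG; first by apply: cF; rewrite mem_head.
- move=> x /cov[j]; rewrite inE => /orP[/eqP->|jr] Fx; first by left.
  by right; exists j.
- by exists i; rewrite ?mem_head.
have [j jr Cj] := IH (fun j jr => cF j (mem_behead (s := i :: r) jr))
  (fun x Cx => let: ex_intro2 j jr Fx := CG x Cx in ex_intro2 _ _ j jr Fx).
by exists j; rewrite // inE jr orbT.
Qed.

End Topology.

Section Components.
Variables (k : closedFieldType) (V W : vectType k) (n : nat).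
Variables (ba : n.-tuple V) (bb : n.-tuple W).
Hypothesis hba : basis_of fullv ba.
Hypothesis hbb : basis_of fullv bb.
Variable pos : 'I_n -> nat.
Implicit Types (u : 'I_(n + n) -> k) (w : 'I_n -> k) (p : {mpoly k[n + n]}).
Implicit Types (P Q : biproj V W) (l : nat) (J : {set 'I_n}) (A : set (biproj V W)).
Local Notation rp := (rp ba bb).

Definition iota_pt l w : 'I_(n + n) -> k :=
  mkpt (fun s => if (l <= pos s)%N then w s else 0)
       (fun s => if (pos s <= l)%N then w s else 0).

Lemma xc_iota l w s : xc (iota_pt l w) s = if (l <= pos s)%N then w s else 0.
Proof. exact: xc_mkpt. Qed.

Lemma yc_iota l w s : yc (iota_pt l w) s = if (pos s <= l)%N then w s else 0.
Proof. exact: yc_mkpt. Qed.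

Lemma inZ_sc l u c d : inZ pos l u -> inZ pos l (sc c d u).
Proof.
case=> hx hy hm; split=> [s sl|s sl|s t sl tl].
- by rewrite xc_sc hx ?mulr0.
- by rewrite yc_sc hy ?mulr0.
- by rewrite !xc_sc !yc_sc mulrACA hm // mulrACA.
Qed.

Lemma inZ_iota l w : inZ pos l (iota_pt l w).
Proof.
split=> [s sl|s sl|s t sl tl]; rewrite ?xc_iota ?yc_iota.
- by rewrite leqNgt sl.
- by rewrite leqNgt sl.
- by rewrite sl tl !leqnn mulrC.
Qed.

Lemma inX_sc Lam u c d : inX pos Lam u -> inX pos Lam (sc c d u).
Proof. by case=> l lL h; exists l => //; apply: inZ_sc. Qed.

Lemma iota_line l w w' :
  (fun t => iota_pt l (fun s => w s + t * w' s)) =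
  (fun t r => iota_pt l w r + t * iota_pt l w' r).
Proof.
apply/funext => t; apply: pt_ext => s.
  by rewrite xc_iota [RHS]/xc -!/(xc _ s) !xc_iota; case: ifP; rewrite ?mulr0 ?addr0.
by rewrite yc_iota [RHS]/yc -!/(yc _ s) !yc_iota; case: ifP; rewrite ?mulr0 ?addr0.
Qed.

Definition param_set J l : set (biproj V W) :=
  [set P | exists w, (forall s, s \notin J -> w s = 0) /\ rp P (iota_pt l w)].

(** J selects a coordinate subspace: the full set gives a whole component, and growing sets J give
    the chains that realize its dimension. *)
Definition comp_set J l : set (biproj V W) :=
  [set P | exists u, [/\ rp P u, inZ pos l u &
     forall s, s \notin J -> xc u s = 0 /\ yc u s = 0]].

Lemma comp_setP J l P u : rp P u -> comp_set J l P <->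
  inZ pos l u /\ (forall s, s \notin J -> xc u s = 0 /\ yc u s = 0).
Proof.
move=> hu; split; last by case=> h1 h2; exists u.
case=> u' [hu' hz h0]; have [c [d [_ _ ->]]] := rp_uniq hba hbb hu' hu.
split=> [|s /h0[h1 h2]]; first exact: inZ_sc.
by rewrite xc_sc yc_sc h1 h2 !mulr0.
Qed.

Lemma closure_vanishes a b p A P : hom2 a b p -> A `<=` vanishes ba bb p ->
  closure A P -> vanishes ba bb p P.
Proof.
move=> hp Ap; have cp := closed_vanishing hba hbb hp.
by move/(closureS Ap); rewrite -(iffLR (closure_id _)).
Qed.

Lemma closed_comp_set J l : closed (comp_set J l).
Proof.
rewrite closure_id; apply/seteqP; split; first exact: subset_closure.
move=> P clP; have [u hu] := rp_ex hba hbb P; apply/(comp_setP _ _ hu).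
have vX s : (forall Q u, rp Q u -> comp_set J l Q -> xc u s = 0) -> xc u s = 0.
  move=> h; rewrite -(Xp_eval u); apply: closure_vanishes clP _ hu.
    exact: hom2_X.
  by move=> Q CQ v hv; rewrite Xp_eval; apply: (h Q).
have vY s : (forall Q u, rp Q u -> comp_set J l Q -> yc u s = 0) -> yc u s = 0.
  move=> h; rewrite -(Yp_eval u); apply: closure_vanishes clP _ hu.
    exact: hom2_Y.
  by move=> Q CQ v hv; rewrite Yp_eval; apply: (h Q).
split; last first.
  move=> s sJ; split; [apply: vX|apply: vY] => Q v hv /(comp_setP _ _ hv)[_ /(_ s sJ)];
    by case.
split=> [s sl|s sl|s t sl tl].
- by apply: vX => Q v hv /(comp_setP _ _ hv)[[h _ _] _]; apply: h.
- by apply: vY => Q v hv /(comp_setP _ _ hv)[[_ h _] _]; apply: h.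
have hp : hom2 1 1 (Xp k s * Yp k t - Xp k t * Yp k s).
  move=> c d v; rewrite !mevalB !mevalM !Xp_eval !Yp_eval !xc_sc !yc_sc !expr1.
  by ring.
have : (Xp k s * Yp k t - Xp k t * Yp k s).@[u] = 0.
  apply: closure_vanishes hp _ clP _ hu => Q CQ v hv.
  have [[_ _ h] _] := (comp_setP J l hv).1 CQ.
  by rewrite mevalB !mevalM !Xp_eval !Yp_eval h // subrr.
by rewrite mevalB !mevalM !Xp_eval !Yp_eval => /eqP; rewrite subr_eq0 => /eqP.
Qed.

Lemma param_set_sub J l : param_set J l `<=` comp_set J l.
Proof.
move=> P [w [wJ hw]]; exists (iota_pt l w); split=> //; first exact: inZ_iota.
by move=> s /wJ ws; rewrite xc_iota yc_iota ws !if_same.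
Qed.

(** The vanishing minors make the x- and y-parts of the class l proportional to one vector z. The
    second clause keeps z inside any coordinate subspace containing u. *)
Lemma inZ_common l u : inZ pos l u -> exists z la mu,
  (forall s, pos s = l -> xc u s = la * z s /\ yc u s = mu * z s) /\
  (forall s, xc u s = 0 -> yc u s = 0 -> z s = 0).
Proof.
case=> hx hy hm.
have [[s [sl xs]]|nx] := pselect (exists s, pos s = l /\ xc u s != 0).
  exists (xc u), 1, (yc u s / xc u s); split=> // t tl; rewrite mul1r; split=> //.
  by rewrite mulrAC -[X in X / _]mulrC hm // mulrC mulKf.
have x0 s : pos s = l -> xc u s = 0.
  by move=> sl; apply: contrapT => /eqP xs; apply: nx; exists s.
exists (yc u), 0, 1; split=> // t tl; by rewrite mul0r mul1r x0.
Qed.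

(** Adding t z to both parts of the class l changes the factors la and mu into t + la and t + mu.
    When both are nonzero, the point is a rescaled point of the parametrization; so a form vanishing
    on the parametrized set vanishes along the line except for two values of t, hence also at t =
    0. *)
Lemma closure_param_set J l : closure (param_set J l) = comp_set J l.
Proof.
apply/seteqP; split.
  rewrite [X in _ `<=` X](iffLR (closure_id _) (@closed_comp_set J l)).
  by apply: closureS; apply: param_set_sub.
move=> P [u [hu hz uJ]]; apply: contrapT => nP.
have [a [b [p [hp pP sub]]]] := closed_point hba hbb (@closed_closure _ _) nP.
apply: pP; apply/(vanishes_rp hba hbb hp hu).
have [z [la [mu [hzM hz0]]]] := inZ_common hz.
pose e : 'I_(n + n) -> k := mkpt (fun s => if pos s == l then z s else 0)
  (fun s => if pos s == l then z s else 0).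
have [F hF] := mpoly_line p u e.
suff F0 : F = 0.
  by rewrite -[RHS](horner0 0) -F0 -hF; apply: meval_eq => r; rewrite mul0r addr0.
apply: (@poly_eval_eq0_off _ (('X + la%:P) * ('X + mu%:P))).
  by rewrite mulf_neq0 // -size_poly_eq0 size_XaddC.
move=> t; rewrite !hornerE mulf_eq0 negb_or => /andP[tla tmu]; rewrite -hF.
pose w s := if pos s == l then z s else
  if (l < pos s)%N then xc u s / (t + la) else yc u s / (t + mu).
have -> : (fun r => u r + t * e r) = sc (t + la) (t + mu) (iota_pt l w).
  case: hz => hx hy hm; apply: pt_ext => s.
    rewrite [LHS]/xc -!/(xc _ s) xc_mkpt xc_sc xc_iota /w.
    have [sl|ls] := eqVneq (pos s) l.
      by have [-> _] := hzM _ sl; rewrite sl leqnn; ring.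
    rewrite mulr0 addr0 leq_eqVlt eq_sym (negPf ls) /=.
    case: ltnP => [_|sl]; first by rewrite mulrC divfK.
    by rewrite hx ?mulr0 // ltn_neqAle ls.
  rewrite [LHS]/yc -!/(yc _ s) yc_mkpt yc_sc yc_iota /w.
  have [sl|ls] := eqVneq (pos s) l.
    by have [_ ->] := hzM _ sl; rewrite sl leqnn; ring.
  rewrite mulr0 addr0 leq_eqVlt (negPf ls) /= ltnNge leq_eqVlt eq_sym (negPf ls) /=.
  case: ltnP => [sl|ls'] /=; last by rewrite mulrC divfK.
  by rewrite hy ?mulr0.
rewrite hp; have [[s xs] [s' ys]] := rp_nz hba hbb hu.
have nzw : nz (iota_pt l w).
  case: (hz) => hx hy hm; split.
    exists s; rewrite xc_iota /w; have [sl|sl|sl] := ltngtP (pos s) l.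
    - by move: xs; rewrite hx ?eqxx.
    - by rewrite mulf_neq0 // invr_neq0.
    - by apply: contraNneq xs => z0; have [-> _] := hzM _ sl; rewrite z0 mulr0.
  exists s'; rewrite yc_iota /w; have [sl|sl|sl] := ltngtP (pos s') l.
  - by rewrite mulf_neq0 // invr_neq0.
  - by move: ys; rewrite hy ?eqxx.
  - by apply: contraNneq ys => z0; have [_ ->] := hzM _ sl; rewrite z0 mulr0.
have [Q hQ] := nz_rp hba hbb nzw.
suff -> : p.@[iota_pt l w] = 0 by rewrite mulr0.
apply: (sub Q) => //; apply: subset_closure; exists w; split=> // r /uJ[x0 y0].
by rewrite /w x0 y0 !mul0r hz0 // !if_same.
Qed.

(** The set is the closure of the image of a vector space, in which two forms that do not vanish
    identically are both nonzero at a common point; [w0] ensures that this point can be taken to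
    define a point of the product of projective spaces. *)
Lemma irreducible_comp_set J l w0 : (forall s, s \notin J -> w0 s = 0) ->
  nz (iota_pt l w0) -> irreducible (comp_set J l).
Proof.
move=> w0J nz0; split.
  have [P hP] := nz_rp hba hbb nz0; exists P; apply: param_set_sub.
  by exists w0.
move=> A B cA cB cov; apply: contrapT => /not_orP[nA nB].
have pick C : closed C -> ~ (comp_set J l `<=` C) -> exists a b p w,
    [/\ hom2 a b p, C `<=` vanishes ba bb p, (forall s, s \notin J -> w s = 0) &
        p.@[iota_pt l w] != 0].
  move=> cC nC; have [P [CP nP]] : exists P, comp_set J l P /\ ~ C P.
    apply: contrapT => h; apply: nC => P CP; apply: contrapT => nP.
    by apply: h; exists P.
  have [a [b [p [hp pP sub]]]] := closed_point hba hbb cC nP.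
  exists a, b, p.
  have [w [wJ /eqP pw]] : exists w, (forall s, s \notin J -> w s = 0) /\
      p.@[iota_pt l w] <> 0.
    apply: contrapT => h; apply: pP; move: CP; rewrite -closure_param_set.
    apply: (closure_vanishes hp) => Q [w [wJ hw]].
    apply/(vanishes_rp hba hbb hp hw); apply: contrapT => pw.
    by apply: h; exists w.
  by exists w.
have [a [b [p [w1 [hp Ap w1J pw]]]]] := pick A cA nA.
have [a' [b' [q [w2 [hq Bq w2J qw]]]]] := pick B cB nB.
have [[s1 xs] [s2 ys]] := nz0.
(* A generic point of the plane through w0, w1, w2 avoids the three bad loci. *)
have gen (f1 f2 : {mpoly k[n + n]}) v1 v2 :
    (forall s, s \notin J -> v1 s = 0) -> (forall s, s \notin J -> v2 s = 0) ->
    f1.@[iota_pt l v1] != 0 -> f2.@[iota_pt l v2] != 0 ->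
    exists2 v, forall s, s \notin J -> v s = 0 & (f1 * f2).@[iota_pt l v] != 0.
  move=> v1J v2J f1n f2n.
  have [F1 h1] := mpoly_line f1 (iota_pt l v1) (iota_pt l (fun s => v2 s - v1 s)).
  have [F2 h2] := mpoly_line f2 (iota_pt l v1) (iota_pt l (fun s => v2 s - v1 s)).
  have e0 : (fun r => iota_pt l v1 r + 0 * iota_pt l (fun s => v2 s - v1 s) r) =
      iota_pt l v1 by apply/funext => r; rewrite mul0r addr0.
  have il := iota_line l v1 (fun s => v2 s - v1 s).
  have e1 : (fun r => iota_pt l v1 r + 1 * iota_pt l (fun s => v2 s - v1 s) r) =
      iota_pt l v2.
    have /(congr1 (fun f => f 1)) /= <- := il.
    by congr iota_pt; apply/funext => s; rewrite mul1r addrC subrK.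
  have F1n : F1 != 0 by apply: contraNneq f1n => F0; rewrite -e0 h1 F0 horner0.
  have F2n : F2 != 0 by apply: contraNneq f2n => F0; rewrite -e1 h2 F0 horner0.
  have [t /eqP ht] : exists t, (F1 * F2).[t] <> 0.
    apply: contrapT => h; have : F1 * F2 = 0.
      by apply: poly_eval_eq0 => t; apply: contrapT => ht; apply: h; exists t.
    by move/eqP; rewrite mulf_eq0 (negPf F1n) (negPf F2n).
  exists (fun s => v1 s + t * (v2 s - v1 s)).
    by move=> s sJ; rewrite v1J // v2J // subrr mulr0 addr0.
  have /(congr1 (fun f => f t)) /= -> := il.
  by rewrite mevalM h1 h2 -hornerM.
have [v vJ hv] := gen _ _ w1 w2 w1J w2J pw qw.
have h0 : (Xp k s1 * Yp k s2).@[iota_pt l w0] != 0.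
  by rewrite mevalM Xp_eval Yp_eval mulf_neq0.
have [v' v'J] := gen _ _ v w0 vJ w0J hv h0.
rewrite !mevalM !mulf_eq0 !negb_or Xp_eval Yp_eval => /andP[/andP[p0 q0] /andP[x0 y0]].
have [|P hP] := @nz_rp _ _ _ _ _ _ hba hbb (iota_pt l v').
  by split; [exists s1|exists s2].
have : comp_set J l P by apply: param_set_sub; exists v'.
case/cov => [/Ap/(_ _ hP) pe|/Bq/(_ _ hP) qe].
  by rewrite pe eqxx in p0.
by rewrite qe eqxx in q0.
Qed.

End Components.

Section Package.
Variables (k : closedFieldType) (V W : vectType k) (n' : nat).
Local Notation n := n'.+1.
Variables (ba : n.-tuple V) (bb : n.-tuple W) (pos : 'I_n -> nat) (Lam : seq nat).
Variable X : set (biproj V W).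

Definition adapted : Prop :=
  [/\ basis_of fullv ba, basis_of fullv bb,
      forall i j : 'I_n, (i <= j)%N -> (pos i <= pos j)%N &
      forall P u, rp ba bb P u -> X P <-> inX pos Lam u].

Hypothesis ad : adapted.
Let hba : basis_of fullv ba. Proof. by case: ad. Qed.
Let hbb : basis_of fullv bb. Proof. by case: ad. Qed.
Let posM : forall i j : 'I_n, (i <= j)%N -> (pos i <= pos j)%N.
Proof. by case: ad. Qed.
Let hX : forall P u, rp ba bb P u -> X P <-> inX pos Lam u.
Proof. by case: ad. Qed.

Implicit Types (u : 'I_(n + n) -> k) (w : 'I_n -> k).
Implicit Types (P Q : biproj V W) (l : nat) (C : set (biproj V W)).
Local Notation rp := (rp ba bb).
Local Notation comp_set := (comp_set ba bb pos).

Definition full_comp l := comp_set [set: 'I_n]%SET l.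

Lemma full_comp_closure l : full_comp l = closure (param_set ba bb pos [set: 'I_n]%SET l).
Proof. by rewrite closure_param_set. Qed.

Lemma full_compP l P u : rp P u -> full_comp l P <-> inZ pos l u.
Proof.
move=> hu; rewrite /full_comp (comp_setP hba hbb pos _ l hu).
by split=> [[]//|h]; split=> // s; rewrite inE.
Qed.

Lemma XP P : X P <-> exists2 l, l \in Lam & full_comp l P.
Proof.
have [u hu] := rp_ex hba hbb P; rewrite (hX hu).
by split=> -[l lL h]; exists l => //; apply/(full_compP _ hu).
Qed.

Definition unitv (s : 'I_n) : 'I_n -> k := fun r => (r == s)%:R.

Lemma full_comp_ends l P : full_comp l P ->
  (pos ord0 <= l)%N /\ (l <= pos ord_max)%N.
Proof.
have [u hu] := rp_ex hba hbb P; move/(full_compP _ hu) => [hx hy _].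
have [[s xs] [t yt]] := rp_nz hba hbb hu; split.
  apply: (@leq_trans (pos t)); first exact: posM.
  by rewrite leqNgt; apply: contraNN yt => /hy->.
apply: (@leq_trans (pos s)); last by apply: posM; rewrite -ltnS.
by rewrite leqNgt; apply: contraNN xs => /hx->.
Qed.

Lemma irreducible_full l P : full_comp l P -> irreducible (full_comp l).
Proof.
have [u hu] := rp_ex hba hbb P; move/(full_compP _ hu) => [hx hy _].
have [[s xs] [t yt]] := rp_nz hba hbb hu.
apply: (@irreducible_comp_set _ _ _ _ _ _ hba hbb pos _ l (fun=> 1)).
  by move=> r; rewrite inE.
split; [exists s; rewrite xc_iota|exists t; rewrite yc_iota].
  by case: leqP; rewrite ?oner_eq0 // => /hx xs0; rewrite xs0 eqxx in xs.
by case: leqP; rewrite ?oner_eq0 // => /hy yt0; rewrite yt0 eqxx in yt.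
Qed.

Lemma nz_unit s (J : {set 'I_n}) : s \in J -> exists P, comp_set J (pos s) P.
Proof.
move=> sJ; have nzu : nz (iota_pt pos (pos s) (unitv s)).
  split; exists s; rewrite ?xc_iota ?yc_iota leqnn /unitv eqxx; exact: oner_neq0.
have [P hP] := nz_rp hba hbb nzu; exists P; apply: param_set_sub.
exists (unitv s); split=> // r rJ; rewrite /unitv.
by case: eqP => // rs; rewrite rs sJ in rJ.
Qed.

Hypothesis exact : forall s, pos s \in Lam.

Lemma X_nonempty : X !=set0.
Proof.
have [P hP] := @nz_unit ord0 [set: 'I_n]%SET (finset.in_setT _); exists P.
by apply/XP; exists (pos ord0).
Qed.

(** The nonempty components have indices between the first and the last position. If these differ,
    the point with x the last and y the first unit vector lies on all of them; otherwise there is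
    only one. *)
Lemma X_connected : connected X.
Proof.
pose D := [set l | l \in Lam /\ full_comp l !=set0].
have -> : X = \bigcup_(l in D) full_comp l.
  apply/seteqP; split=> P; first by move/XP => [l lL h]; exists l => //; split=> //; exists P.
  by case=> l [lL _] h; apply/XP; exists l.
apply: bigcup_connected; last first.
  by move=> l [_ [P h]]; apply/irreducible_connected/irreducible_full/h.
have [e|ne] := eqVneq (pos ord0) (pos ord_max).
  have [P hP] := @nz_unit ord0 [set: 'I_n]%SET (finset.in_setT _); exists P.
  move=> l [lL [Q /full_comp_ends[h1 h2]]].
  suff -> : l = pos ord0 by [].
  by apply/eqP; rewrite eqn_leq h1 [X in (_ <= X)%N]e h2.
have lt : (pos ord0 < pos ord_max)%N by rewrite ltn_neqAle ne posM.
pose u : 'I_(n + n) -> k := mkpt (unitv ord_max) (unitv ord0).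
have nzu : nz u.
  by split; [exists ord_max; rewrite xc_mkpt|exists ord0; rewrite yc_mkpt];
    rewrite /unitv eqxx oner_eq0.
have [P hP] := nz_rp hba hbb nzu; exists P.
move=> l [lL [Q /full_comp_ends[h1 h2]]]; apply/(full_compP _ hP).
split=> [s sl|s sl|s t sl tl]; rewrite ?xc_mkpt ?yc_mkpt /unitv.
- by case: eqP => // se; move: sl; rewrite se ltnNge h2.
- by case: eqP => // se; move: sl; rewrite se ltnNge h1.
have z a b : pos a = pos b -> unitv ord_max a * unitv ord0 b = 0.
  rewrite /unitv; case: eqP => [->|_]; last by rewrite mul0r.
  case: eqP => [->|_]; last by rewrite mulr0.
  by move/esym/eqP; rewrite (negPf ne).
by rewrite !z // sl tl.
Qed.

(** An index l in [Lam] need not be a value of [pos]; lowering it to the largest value not exceeding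
    l can only enlarge the component, as no position lies in between. *)
Lemma irr_component_full Y : irr_component X Y -> exists s, Y = full_comp (pos s).
Proof.
move=> [cY irrY YX maxY].
have [l lL Yl] : exists2 l, l \in Lam & Y `<=` full_comp l.
  apply: irreducible_cover => // [l _|P /YX/XP//]; exact: closed_comp_set.
have [P YP] := irrY.1.
have [u hu] := rp_ex hba hbb P.
have /(full_compP _ hu)[_ hy _] := Yl _ YP.
have [_ [t yt]] := rp_nz hba hbb hu.
have tl : (pos t <= l)%N by rewrite leqNgt; apply: contraNN yt => /hy->.
case: (@arg_maxnP _ t (fun s => (pos s <= l)%N) pos tl) => s sl smax.
exists s; symmetry; apply: maxY.
- exact: closed_comp_set.
- have [Q hQ] := @nz_unit s [set: 'I_n]%SET (finset.in_setT _); exact: irreducible_full hQ.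
- by move=> Q hQ; apply/XP; exists (pos s).
move=> Q /Yl; have [v hv] := rp_ex hba hbb Q.
move=> /(full_compP _ hv)[hx' hy' hm'] ; apply/(full_compP _ hv).
have [sl'|sl'] := eqVneq (pos s) l; first by rewrite sl'.
have {}sl' : (pos s < l)%N by rewrite ltn_neqAle sl' sl.
split=> [r rs|r rs|r r' rs rs'].
- by apply: hx'; apply: ltn_trans rs sl'.
- apply: hy'; rewrite ltnNge; apply/negP => rl.
  by have := leq_trans rs (smax r rl); rewrite ltnn.
- by rewrite !hx' ?rs ?rs' // !mul0r.
Qed.

(** The chain starts from s alone and adds the other indices one at a time. Strictness is seen at
    the point with coordinates 1 at s and at the added index. *)
Lemma comp_chain s : exists Z, irr_chain (full_comp (pos s)) n' Z.
Proof.
pose J m : {set 'I_n} := [set r | if unlift s r is Some i then (i < m)%N else true]%SET.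
exists (fun m => comp_set (J m) (pos s)).
have sJ m : s \in J m by rewrite inE unlift_none.
split=> m mn.
  split; first exact: closed_comp_set.
    apply: (@irreducible_comp_set _ _ _ _ _ _ hba hbb pos _ _ (unitv s)).
      by move=> r rJ; rewrite /unitv; case: eqP => // e; rewrite e sJ in rJ.
    by split; exists s; rewrite ?xc_iota ?yc_iota leqnn /unitv eqxx oner_eq0.
  move=> P [u [hu hz _]]; exact/(full_compP _ hu).
have subJ r : r \in J m -> r \in J m.+1.
  by rewrite !inE; case: unlift => // i /ltnW.
split.
  move=> P [u [hu hz h0]]; exists u; split=> // r rJ; apply: h0.
  by apply: contraNN rJ => /subJ.
move=> e; pose i := Ordinal mn; pose r := lift s i.
have rJ : r \notin J m by rewrite inE liftK /= ltnn.
have rJ' : r \in J m.+1 by rewrite inE liftK /= ltnSn.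
pose w q : k := ((q == s) || (q == r))%:R.
have wJ q : q \notin J m.+1 -> w q = 0.
  rewrite /w; case: eqP => [->|_ /=]; first by rewrite sJ.
  by case: eqP => [->|//]; rewrite rJ'.
have nzw : nz (iota_pt pos (pos s) w).
  by split; exists s; rewrite ?xc_iota ?yc_iota leqnn /w eqxx oner_eq0.
have [P hP] := nz_rp hba hbb nzw.
have : comp_set (J m.+1) (pos s) P by apply: param_set_sub; exists w.
rewrite -e => /(comp_setP hba hbb _ _ _ hP)[_ /(_ r rJ)].
rewrite xc_iota yc_iota /w eqxx orbT => -[e1 e2].
have [h|h] := leqP (pos s) (pos r).
  by move: e1; rewrite h => /eqP; rewrite oner_eq0.
by move: e2; rewrite (ltnW h) => /eqP; rewrite oner_eq0.
Qed.

End Package.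

(** * Dimension *)

Section Permute.
Variables (k : closedFieldType) (V W : vectType k) (n' : nat).
Local Notation n := n'.+1.
Variables (ba : n.-tuple V) (bb : n.-tuple W) (pos : 'I_n -> nat) (Lam : seq nat).
Variable X : set (biproj V W).
Implicit Types (u : 'I_(n + n) -> k) (sg : 'S_n).

Definition perm_pt sg u : 'I_(n + n) -> k :=
  mkpt (fun i => xc u (sg i)) (fun i => yc u (sg i)).

Definition perm_tuple (T : Type) (b : n.-tuple T) sg : n.-tuple T :=
  [tuple tnth b (sg i) | i < n].

Lemma perm_basis_of (U : vectType k) (b : n.-tuple U) sg :
  basis_of fullv b -> basis_of fullv (perm_tuple b sg).
Proof.
rewrite (@perm_basis _ _ (perm_tuple b sg) b) //.
by apply/tuple_permP; exists sg.
Qed.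

Lemma nth_perm_tuple (U : vectType k) (b : n.-tuple U) sg (i : 'I_n) :
  (perm_tuple b sg)`_i = b`_(sg i).
Proof.
have := tnth_mktuple (fun i => tnth b (sg i)) i.
by rewrite (tnth_nth 0) [in X in _ = X](tnth_nth 0).
Qed.

Lemma ofc_perm sg u :
  ofc (perm_tuple ba sg) (perm_tuple bb sg) (perm_pt sg u) = ofc ba bb u.
Proof.
congr pair; rewrite [RHS](reindex_inj (@perm_inj _ sg)); apply: eq_bigr => i _.
  by rewrite xc_mkpt nth_perm_tuple.
by rewrite yc_mkpt nth_perm_tuple.
Qed.

Lemma perm_ptK sg u : perm_pt sg (perm_pt (sg^-1)%g u) = u.
Proof. by apply: pt_ext => i; rewrite ?(xc_mkpt, yc_mkpt) permK. Qed.

Lemma inZ_perm l sg u : (forall i, pos (sg i) = pos i) ->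
  inZ pos l u -> inZ pos l (perm_pt sg u).
Proof.
move=> hs [hx hy hm]; split=> [i il|i il|i j il jl]; rewrite ?xc_mkpt ?yc_mkpt.
- by apply: hx; rewrite hs.
- by apply: hy; rewrite hs.
- by apply: hm; rewrite hs.
Qed.

Lemma adapted_perm sg : (forall i, pos (sg i) = pos i) -> adapted ba bb pos Lam X ->
  adapted (perm_tuple ba sg) (perm_tuple bb sg) pos Lam X.
Proof.
move=> hs [h1 h2 h3 hX]; split=> //; try exact: perm_basis_of.
move=> P u; rewrite -(perm_ptK sg u) /rp ofc_perm => hu; rewrite (hX _ _ hu).
have hs' i : pos ((sg^-1)%g i) = pos i by rewrite -hs permKV.
split=> -[l lL hz]; exists l => //; first exact: inZ_perm.
by have := inZ_perm hs' hz; congr inZ; apply: pt_ext => i;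
  rewrite ?(xc_mkpt, yc_mkpt) permKV.
Qed.

End Permute.

(** Permuting basis vectors of equal position preserves adaptedness, so a nonzero y-coordinate can
    be moved to the end and a nonzero x-coordinate to the start of its class. If both have the same
    position, the minors give an index that serves for both. *)
Lemma adapted_chart (k : closedFieldType) (V W : vectType k) (n' : nat)
    (ba : n'.+1.-tuple V) (bb : n'.+1.-tuple W) (pos : 'I_n'.+1 -> nat) Lam X P :
  adapted ba bb pos Lam X -> X P ->
  exists (ba' : n'.+1.-tuple V) (bb' : n'.+1.-tuple W) s t u,
    [/\ adapted ba' bb' pos Lam X, chart_indices pos s t, rp ba' bb' P u,
        xc u s != 0 & yc u t != 0].
Proof.
move=> ad XP; have [hba hbb posM hX] := ad; have [u hu] := rp_ex hba hbb P.
have [l lL [hx hy hm]] := (hX _ _ hu).1 XP.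
have [[s0 xs] [t0 yt]] := rp_nz hba hbb hu.
have ls : (l <= pos s0)%N by rewrite leqNgt; apply: contraNN xs => /hx->.
have tl : (pos t0 <= l)%N by rewrite leqNgt; apply: contraNN yt => /hy->.
have [e|ne] := eqVneq (pos t0) (pos s0).
  have tl' : pos t0 = l by apply/eqP; rewrite eqn_leq tl e ls.
  have xt : xc u t0 != 0.
    apply: contraNneq (mulf_neq0 xs yt) => x0.
    by rewrite hm -?e // x0 mul0r.
  by exists ba, bb, t0, t0, u; split=> //; left.
have lt : (pos t0 < pos s0)%N by rewrite ltn_neqAle ne (leq_trans tl).
case: (@arg_maxnP _ t0 (fun q => pos q == pos t0) val (eqxx _)) => tm /eqP tmE tmax.
case: (@arg_minnP _ s0 (fun q => pos q == pos s0) val (eqxx _)) => sm /eqP smE smin.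
have neq a b : pos a = pos t0 -> pos b = pos s0 -> a != b.
  by move=> ea eb; apply: contraNneq ne => ab; rewrite -ea ab eb.
pose sg := (tperm t0 tm * tperm s0 sm)%g.
have hs i : pos (sg i) = pos i.
  have tp a b j : pos a = pos b -> pos (tperm a b j) = pos j.
    by move=> ab; case: tpermP => // ->.
  by rewrite permM !tp.
exists (perm_tuple ba sg), (perm_tuple bb sg), sm, tm, (perm_pt sg u); split.
- exact: adapted_perm.
- right; rewrite tmE smE; split=> // q qe.
    by apply: tmax; rewrite qe.
  by apply: smin; rewrite qe.
- by rewrite /rp ofc_perm.
- rewrite xc_mkpt permM (@tpermD _ t0 tm sm) ?tpermR //; exact: neq.
- rewrite yc_mkpt permM tpermR tpermD // eq_sym; exact: neq.
Qed.

Section ChartPrimes.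
Variables (k : closedFieldType) (V W : vectType k) (n' : nat).
Local Notation n := n'.+1.
Variables (ba : n.-tuple V) (bb : n.-tuple W) (pos : 'I_n -> nat) (Lam : seq nat).
Variable X : set (biproj V W).
Hypothesis ad : adapted ba bb pos Lam X.
Let hba : basis_of fullv ba. Proof. by case: ad. Qed.
Let hbb : basis_of fullv bb. Proof. by case: ad. Qed.
Let posM : forall i j : 'I_n, (i <= j)%N -> (pos i <= pos j)%N.
Proof. by case: ad. Qed.
Let hX : forall P u, rp ba bb P u -> X P <-> inX pos Lam u.
Proof. by case: ad. Qed.
Variables s t : 'I_n.
Implicit Types (u : 'I_(n + n) -> k) (f g : {mpoly k[n + n]}).
Implicit Types (P Q : biproj V W) (C : set (biproj V W)).
Local Notation rp := (rp ba bb).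
Local Notation vanishes := (vanishes ba bb).

Definition dehom u := sc (xc u s)^-1 (yc u t)^-1 u.

Lemma xc_dehom u : xc u s != 0 -> xc (dehom u) s = 1.
Proof. by move=> h; rewrite xc_sc mulVf. Qed.

Lemma yc_dehom u : yc u t != 0 -> yc (dehom u) t = 1.
Proof. by move=> h; rewrite yc_sc mulVf. Qed.

Lemma dehom_id u : xc u s = 1 -> yc u t = 1 -> dehom u = u.
Proof. by move=> h1 h2; rewrite /dehom h1 h2 !invr1 sc1. Qed.

Lemma rp_dehom P u : rp P u -> xc u s != 0 -> yc u t != 0 -> rp P (dehom u).
Proof. by move=> hu h1 h2; apply: rp_scale => //; rewrite invr_neq0. Qed.

(** Built up from variables and constants; in a sum the bidegrees are equalized by powers of x_s and
    y_t. *)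
Lemma homogenize f : exists c d g, hom2 c d g /\
  forall u, xc u s != 0 -> yc u t != 0 ->
    g.@[u] = xc u s ^+ c * yc u t ^+ d * f.@[dehom u].
Proof.
pose H f := exists c d g, hom2 c d g /\
  forall u, xc u s != 0 -> yc u t != 0 ->
    g.@[u] = xc u s ^+ c * yc u t ^+ d * f.@[dehom u].
have HC e : H e%:MP.
  exists 0%N, 0%N, e%:MP; split; first exact: hom2_C.
  by move=> u _ _; rewrite !mevalC !mul1r.
have HM f1 f2 : H f1 -> H f2 -> H (f1 * f2).
  move=> [c1 [d1 [g1 [h1 e1]]]] [c2 [d2 [g2 [h2 e2]]]].
  exists (c1 + c2)%N, (d1 + d2)%N, (g1 * g2); split; first exact: hom2M.
  by move=> u xs yt; rewrite !mevalM e1 // e2 // !exprD; ring.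
have HD f1 f2 : H f1 -> H f2 -> H (f1 + f2).
  move=> [c1 [d1 [g1 [h1 e1]]]] [c2 [d2 [g2 [h2 e2]]]].
  exists (c1 + c2)%N, (d1 + d2)%N,
    (g1 * (Xp k s ^+ c2 * Yp k t ^+ d2) + g2 * (Xp k s ^+ c1 * Yp k t ^+ d1)).
  have hxy c d : hom2 c d (Xp k s ^+ c * Yp k t ^+ d).
    move=> a b u; rewrite !mevalM !rmorphXn /= !Xp_eval !Yp_eval xc_sc yc_sc.
    by rewrite !exprMn; ring.
  split.
    apply: hom2D; first exact: hom2M.
    by rewrite addnC [(d1 + _)%N]addnC; apply: hom2M.
  move=> u xs yt; rewrite !mevalD !mevalM !rmorphXn /= !Xp_eval !Yp_eval.
  by rewrite e1 // e2 // !exprD; ring.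
have HV i : H 'X_i.
  rewrite -(splitK i); case: (fintype.split i) => j /=.
    exists 1%N, 0%N, (Xp k j); split; first exact: hom2_X.
    by move=> u xs _; rewrite !Xp_eval xc_sc expr1 mulr1 mulVKf.
  exists 0%N, 1%N, (Yp k j); split; first exact: hom2_Y.
  by move=> u _ yt; rewrite !Yp_eval yc_sc expr1 mul1r mulVKf.
rewrite -/(H f) [f]mpolyE; elim/big_ind: _; [|exact: HD|].
  by have := HC 0; rewrite mpolyC0.
move=> m _; rewrite -mul_mpolyC; apply: (HM _ _ (HC _)).
rewrite mpolyXE_id; elim/big_ind: _; [|exact: HM|].
  by have := HC 1; rewrite mpolyC1.
move=> i _; elim: (m i) => [|e IH]; first by have := HC 1; rewrite mpolyC1 expr0.
by rewrite exprS; apply: HM.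
Qed.

Definition meets_chart C : Prop :=
  exists P u, [/\ C P, rp P u, xc u s != 0 & yc u t != 0].

Definition chart_prime C : set {mpoly k[n + n]} :=
  [set f | forall P u, C P -> rp P u -> xc u s = 1 -> yc u t = 1 -> f.@[u] = 0].

(** If f g vanishes on C in the chart, the zero sets of the two homogenizations cover C, once one of
    them is multiplied by x_s y_t to include the points outside the chart. *)
Lemma chart_primeP C : irreducible C -> meets_chart C -> is_prime (chart_prime C).
Proof.
move=> irr [P0 [u0 [CP0 hu0 xs0 yt0]]]; split.
- split=> [P u _ _ _ _|r f g hf hg P u CP hu h1 h2]; first by rewrite meval0.
  by rewrite mevalD mevalM (hf P) // (hg P) // mulr0 addr0.
- move/(_ P0 (dehom u0) CP0 (rp_dehom hu0 xs0 yt0) (xc_dehom xs0) (yc_dehom yt0)).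
  by move/eqP; rewrite meval1 oner_eq0.
move=> f g fg.
have [c [d [F [hF FE]]]] := homogenize f.
have [c' [d' [G [hG GE]]]] := homogenize g.
have hXY : hom2 1 1 (Xp k s * Yp k t).
  by move=> a b u; rewrite !mevalM !Xp_eval !Yp_eval xc_sc yc_sc !expr1; ring.
have hG' := hom2M hG hXY.
case: (irr.2 (vanishes F) (vanishes (G * (Xp k s * Yp k t)))).
- exact: closed_vanishing hF.
- exact: closed_vanishing hG'.
- move=> P CP; have [u hu] := rp_ex hba hbb P.
  have : F.@[u] = 0 \/ (G * (Xp k s * Yp k t)).@[u] = 0.
    rewrite !mevalM Xp_eval Yp_eval.
    have [->|xs] := eqVneq (xc u s) 0; first by right; rewrite mul0r mulr0.
    have [->|yt] := eqVneq (yc u t) 0; first by right; rewrite !mulr0.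
    have := fg P (dehom u) CP (rp_dehom hu xs yt) (xc_dehom xs) (yc_dehom yt).
    rewrite mevalM FE // GE // => /eqP; rewrite mulf_eq0 => /orP[/eqP->|/eqP->].
      by left; rewrite mulr0.
    by right; rewrite mulr0 mul0r.
  by case=> h; [left; apply/(vanishes_rp hba hbb hF hu)|
    right; apply/(vanishes_rp hba hbb hG' hu)].
- move=> CF; left=> P u CP hu xs yt; have := CF P CP u hu.
  have xs' : xc u s != 0 by rewrite xs oner_eq0.
  have yt' : yc u t != 0 by rewrite yt oner_eq0.
  by rewrite (FE _ xs' yt') (dehom_id xs yt) xs yt !expr1n !mul1r.
- move=> CG; right=> P u CP hu xs yt; have := CG P CP u hu.
  have xs' : xc u s != 0 by rewrite xs oner_eq0.
  have yt' : yc u t != 0 by rewrite yt oner_eq0.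
  rewrite !mevalM Xp_eval Yp_eval (GE _ xs' yt') (dehom_id xs yt) xs yt.
  by rewrite !expr1n !mulr1 !mul1r.
Qed.

Lemma chart_ideal_sub C : C `<=` X -> chart_ideal pos Lam s t `<=` chart_prime C.
Proof.
by move=> CX f hf P u /CX XP hu xs yt; apply: hf; split=> //; apply/(hX hu).
Qed.

(** A form vanishing on C but not on C' separates the primes: if it vanished on C' within the chart,
    C' would be covered by its zeros and those of x_s y_t. *)
Lemma chart_prime_strict C C' : closed C -> irreducible C' -> meets_chart C ->
  C `<=` C' -> C' <> C ->
  chart_prime C' `<=` chart_prime C /\
  exists2 f, chart_prime C f & ~ chart_prime C' f.
Proof.
move=> cC irr' [P0 [u0 [CP0 hu0 xs0 yt0]]] CC' ne.
split=> [f hf P u /CC' CP|]; first exact: hf.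
have [P [C'P nCP]] : exists P, C' P /\ ~ C P.
  apply: contrapT => h; apply: ne; apply/seteqP; split=> // P C'P.
  by apply: contrapT => nCP; apply: h; exists P.
have [a [b [p [hp pP sub]]]] := closed_point hba hbb cC nCP.
exists p => [Q u CQ hu _ _|hpC]; first exact: sub CQ _ hu.
have hXY : hom2 1 1 (Xp k s * Yp k t).
  by move=> c d u; rewrite !mevalM !Xp_eval !Yp_eval xc_sc yc_sc !expr1; ring.
case: (irr'.2 (vanishes p) (vanishes (Xp k s * Yp k t))).
- exact: closed_vanishing hp.
- exact: closed_vanishing hXY.
- move=> Q C'Q; have [u hu] := rp_ex hba hbb Q.
  have [xs|xs] := eqVneq (xc u s) 0.
    by right; apply/(vanishes_rp hba hbb hXY hu); rewrite mevalM Xp_eval xs mul0r.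
  have [yt|yt] := eqVneq (yc u t) 0.
    by right; apply/(vanishes_rp hba hbb hXY hu); rewrite mevalM Yp_eval yt mulr0.
  left; apply/(vanishes_rp hba hbb hp (rp_dehom hu xs yt)).
  exact: (hpC Q _ C'Q (rp_dehom hu xs yt) (xc_dehom xs) (yc_dehom yt)).
- by move/(_ P C'P).
- move/(_ P0 (CC' _ CP0) u0 hu0)/eqP; rewrite mevalM Xp_eval Yp_eval mulf_eq0.
  by rewrite (negPf xs0) (negPf yt0).
Qed.

End ChartPrimes.

(** The chart is taken at a point of the smallest member, so that all members meet it. Passing to
    ideals reverses the chain, and [prime_chain_length] applies with the empty set of variables,
    since only constants have to be kept out of the largest prime. *)
Lemma chain_bound (k : closedFieldType) (V W : vectType k) (n' : nat)
    (ba : n'.+1.-tuple V) (bb : n'.+1.-tuple W) (pos : 'I_n'.+1 -> nat) Lam X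
    (e : nat) (Z : nat -> set (biproj V W)) :
  adapted ba bb pos Lam X -> (forall i, pos i \in Lam) -> irr_chain X e Z ->
  (e <= n')%N.
Proof.
move=> ad0 ex [hZ hS].
have [_ [[P0 ZP0] _] Z0X] := hZ 0%N (leq0n _).
have [ba' [bb' [s [t [u0 [ad st hu0 xs0 yt0]]]]]] := adapted_chart ad0 (Z0X _ ZP0).
have [hba hbb posM hX] := ad.
have sub0 m : (m <= e)%N -> Z 0%N `<=` Z m.
  by elim: m => [_|m IH me P /(IH (ltnW me))]; [|exact: (hS _ me).1].
have mc m : (m <= e)%N -> meets_chart ba' bb' s t (Z m).
  by move=> me; exists P0, u0; split=> //; apply: sub0.
pose Q m := chart_prime ba' bb' s t (Z (e - m)%N).
have := @prime_chain_length _ _ _ _ _ _ _ (@chart_free k _ _ _ s t posM ex st)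
  finset.set0 e Q.
rewrite finset.cards0 addn0; apply.
- rewrite /Q subn0; apply: (chart_ideal_sub ad); by have [] := hZ e (leqnn _).
- move=> m me; apply: (chart_primeP ad); last by apply: mc; rewrite leq_subr.
  by have [] := hZ (e - m)%N (leq_subr _ _).
- move=> m me; rewrite /Q; pose m' := (e - m.+1)%N.
  have mE : (e - m)%N = m'.+1 by rewrite /m' subnSK.
  have m'e : (m' < e)%N by rewrite -mE leq_subr.
  rewrite mE -/m'; have [sub ne] := hS m' m'e.
  apply: (chart_prime_strict ad) => //.
  + by have [] := hZ m' (ltnW m'e).
  + by have [] := hZ m'.+1 m'e.
  + by apply: mc; apply: ltnW.
  + by move=> e'; apply: ne.
move=> p hp Qp; have pE : p = (p@_0)%:MP.
  apply/mpolyP => m; rewrite mcoeffC; case: eqP => [->|m0]; first by rewrite mulr1.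
  rewrite mulr0; apply/eqP; rewrite mcoeff_eq0; apply/negP => /hp hm.
  by case: m0; apply/mnmP => i; rewrite mnm0E hm ?inE.
rewrite /Q subnn pE in Qp; rewrite pE; move: (p@_0) Qp => c Qp.
have := Qp P0 (dehom s t u0) ZP0 (rp_dehom hu0 xs0 yt0) (xc_dehom t xs0) (yc_dehom s yt0).
by rewrite chart_eta_eval mevalC => ->; rewrite mpolyC0.
Qed.

Lemma pure_dimension_adapted (k : closedFieldType) (V W : vectType k) (n' : nat)
    (ba : n'.+1.-tuple V) (bb : n'.+1.-tuple W) (pos : 'I_n'.+1 -> nat) Lam X :
  adapted ba bb pos Lam X -> (forall i, pos i \in Lam) -> pure_dimension X n'.
Proof.
move=> ad ex Y hY; have [_ _ YX _] := hY.
have [s YE] := irr_component_full ad ex hY; split.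
  by rewrite YE; apply: comp_chain ad s.
move=> Z [hZ hS]; have := @chain_bound _ _ _ _ _ _ _ _ _ n'.+1 Z ad ex.
rewrite ltnn => h; suff: false by []; apply: h; split=> // m mn.
have [h1 h2 h3] := hZ m mn; split=> //; exact: subset_trans h3 YX.
Qed.

(** * Stalks *)

Section Stalk.
Variables (k : closedFieldType) (V W : vectType k) (n' : nat).
Local Notation n := n'.+1.
Variables (ba : n.-tuple V) (bb : n.-tuple W) (pos : 'I_n -> nat) (Lam : seq nat).
Variable X : set (biproj V W).
Hypothesis ad : adapted ba bb pos Lam X.
Let hba : basis_of fullv ba. Proof. by case: ad. Qed.
Let hbb : basis_of fullv bb. Proof. by case: ad. Qed.
Let hX : forall P u, rp ba bb P u -> X P <-> inX pos Lam u.
Proof. by case: ad. Qed.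
Variables (s t : 'I_n) (Y : scheme_point X).
Hypothesis mc : meets_chart ba bb s t Y.
Implicit Types (u : 'I_(n + n) -> k) (f g : {mpoly k[n + n]}) (z : V * W).
Local Notation rp := (rp ba bb).
Local Notation cf := (cf ba bb).
Local Notation ofc := (ofc ba bb).
Local Notation vanishes := (vanishes ba bb).
Local Notation dh := (dehom s t).

Lemma quot_eq0 (r : regular_fun Y) : (\pi_(stalk Y) r = 0) <-> zero_germ Y r.
Proof.
have -> : (0 : stalk Y) = \pi_(stalk Y) 0 by rewrite rmorph0.
split=> [/eqP|h].
  by rewrite -Quotient.idealrBE subr0 => /asboolP.
by apply/eqP; rewrite -Quotient.idealrBE subr0; apply/asboolP.
Qed.

Definition chart_open : set (biproj V W) := ~` vanishes (Xp k s * Yp k t).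

Lemma hom2_XY c d : hom2 c d (Xp k s ^+ c * Yp k t ^+ d).
Proof.
move=> a b u; rewrite !mevalM !rmorphXn /= !Xp_eval !Yp_eval xc_sc yc_sc.
by rewrite !exprMn; ring.
Qed.

Lemma hom2_XY1 : hom2 1 1 (Xp k s * Yp k t).
Proof. by have := hom2_XY 1 1; rewrite !expr1. Qed.

Lemma chart_openP P u : rp P u -> chart_open P <-> xc u s != 0 /\ yc u t != 0.
Proof.
move=> hu; rewrite /chart_open /setC /= (vanishes_rp hba hbb hom2_XY1 hu).
rewrite mevalM Xp_eval Yp_eval; split.
  by move/eqP; rewrite mulf_eq0 negb_or => /andP.
by case=> xs yt; apply/eqP; rewrite mulf_neq0.
Qed.

Lemma open_chart : open chart_open.
Proof. exact: (open_nonvanishing hba hbb hom2_XY1). Qed.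

Lemma meets_chart_open : sp_set Y `&` chart_open !=set0.
Proof.
have [P [u [YP hu xs yt]]] := mc; exists P; split=> //.
exact/(chart_openP hu).
Qed.

(** Off the chart [dehom] uses 0^-1 = 0. The values there do not affect the germ, and f is sent to a
    function on all of V * W by a ring morphism. *)
Definition affine_fun f : V * W -> k := fun z => f.@[dh (cf z)].

Lemma affine_section f : is_section X chart_open 0 0 (affine_fun f).
Proof.
apply/(section_frac hba hbb) => P XP UP.
have [c [d [g [hg gE]]]] := homogenize s t f.
exists c, d, g, (Xp k s ^+ c * Yp k t ^+ d); split=> //; first exact: hom2_XY.
  have [u hu] := rp_ex hba hbb P; have [xs yt] := (chart_openP hu).1 UP.
  move/(_ u hu)/eqP; rewrite mevalM !rmorphXn /= Xp_eval Yp_eval.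
  by rewrite mulf_eq0 !expf_eq0 (negPf xs) (negPf yt) !andbF.
move=> Q u _ UQ hu; have [xs yt] := (chart_openP hu).1 UQ.
rewrite /affine_fun (ofcK hba hbb) gE // mevalM !rmorphXn /= Xp_eval Yp_eval.
by rewrite mulrC.
Qed.

Lemma affine_regular f : affine_fun f \in regular_at Y.
Proof.
apply/asboolP; exists chart_open; split; first exact: open_chart.
  exact: meets_chart_open.
exact: affine_section.
Qed.

Definition affine_germ f : regular_fun Y := RegularFun (affine_regular f).

Fact affine_germ_zmod : zmod_morphism affine_germ.
Proof.
by move=> f g; apply: val_inj; apply/funext => z; rewrite /= /affine_fun mevalB.
Qed.

Fact affine_germ_monoid : monoid_morphism affine_germ.
Proof.
split; first by apply: val_inj; apply/funext => z; rewrite /= /affine_fun meval1.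
by move=> f g; apply: val_inj; apply/funext => z; rewrite /= /affine_fun mevalM.
Qed.

HB.instance Definition _ := GRing.isZmodMorphism.Build {mpoly k[n + n]}
  (regular_fun Y) affine_germ affine_germ_zmod.
HB.instance Definition _ := GRing.isMonoidMorphism.Build {mpoly k[n + n]}
  (regular_fun Y) affine_germ affine_germ_monoid.

(** The lemmas below identify the stalk with the localization of the chart ring at the prime of Y,
    in the form that [cohen_macaulay_free] asks for. *)
Definition to_stalk : {mpoly k[n + n]} -> stalk Y := \pi_(stalk Y) \o affine_germ.
HB.instance Definition _ := GRing.RMorphism.on to_stalk.

Local Notation pr := (chart_prime ba bb s t Y).

Lemma chart_point (U : set (biproj V W)) : open U -> sp_set Y `&` U !=set0 ->
  exists P u, [/\ sp_set Y P, U P, rp P u, xc u s = 1 & yc u t = 1].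
Proof.
move=> oU YU; have [P [YP [UP cP]]] := scheme_point_openI oU open_chart YU meets_chart_open.
have [u hu] := rp_ex hba hbb P; have [xs yt] := (chart_openP hu).1 cP.
exists P, (dh u); split=> //; [exact: rp_dehom|exact: xc_dehom|exact: yc_dehom].
Qed.

Lemma to_stalk_invertible f : ~ pr f -> invertible (to_stalk f).
Proof.
move=> nf; have [P [u [YP hu xs yt /eqP fu]]] : exists P u,
    [/\ sp_set Y P, rp P u, xc u s = 1, yc u t = 1 & f.@[u] <> 0].
  apply: contrapT => h; apply: nf => P u YP hu xs yt; apply: contrapT => fu.
  by apply: h; exists P, u.
have [c [d [g [hg gE]]]] := homogenize s t f.
have hgXY := hom2M hg hom2_XY1.
pose U := ~` vanishes (g * (Xp k s * Yp k t)).
have oU : open U := open_nonvanishing hba hbb hgXY.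
have UP Q v : rp Q v -> U Q <-> [/\ xc v s != 0, yc v t != 0 & f.@[dh v] != 0].
  move=> hv; rewrite /U /setC /= (vanishes_rp hba hbb hgXY hv).
  rewrite !mevalM Xp_eval Yp_eval; split.
    move/eqP; rewrite !mulf_eq0 !negb_or => /andP[gv /andP[xv yv]]; split=> //.
    by apply: contraNneq gv => f0; rewrite gE // f0 mulr0.
  by case=> xv yv fv; apply/eqP; rewrite gE // !mulf_neq0 // expf_neq0.
have YU : sp_set Y `&` U !=set0.
  exists P; split=> //; apply/(UP _ _ hu).
  by rewrite dehom_id // xs yt oner_neq0.
have reg : (fun z => (affine_fun f z)^-1) \in regular_at Y.
  apply/asboolP; exists U; split=> //; apply/(section_frac hba hbb) => Q XQ UQ.
  exists c, d, (Xp k s ^+ c * Yp k t ^+ d), g; split=> //; first exact: hom2_XY.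
    have [v hv] := rp_ex hba hbb Q; have [xv yv fv] := (UP _ _ hv).1 UQ.
    move/(_ v hv)/eqP; rewrite gE // !mulf_eq0 (negPf fv) orbF !expf_eq0.
    by rewrite (negPf xv) (negPf yv) !andbF.
  move=> R v _ UR hv; have [xv yv fv] := (UP _ _ hv).1 UR.
  rewrite /affine_fun (ofcK hba hbb) gE // mevalM !rmorphXn /= Xp_eval Yp_eval.
  by rewrite mulrC mulfK.
exists (\pi_(stalk Y) (RegularFun reg)).
apply/eqP; rewrite -subr_eq0; apply/eqP.
have -> : (1 : stalk Y) = \pi_(stalk Y) 1 by rewrite rmorph1.
rewrite /to_stalk /= -rmorphM -rmorphB; apply/quot_eq0; exists U; split=> //.
move=> Q z XQ UQ hz.
have hv : rp Q (cf z) by rewrite /rp cfK.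
have [xv yv fv] := (UP _ _ hv).1 UQ.
rewrite -[LHS]/(affine_fun f z * (affine_fun f z)^-1 - 1).
by rewrite /affine_fun mulfV ?subrr.
Qed.

Lemma to_stalk_frac (a : stalk Y) : exists p q, ~ pr q /\ to_stalk q * a = to_stalk p.
Proof.
pose r : regular_fun Y := generic_quotient.repr a; have aE : a = \pi_(stalk Y) r by rewrite reprK.
have /asboolP[U [oU YU /(section_frac hba hbb) hr]] := rf_regular r.
have [P [u [YP UP hu xs yt]]] := chart_point oU YU.
have [c [d [p [q [hp hq qP hpq]]]]] := hr P (sp_sub YP) UP.
exists p, q; split.
  move/(_ P u YP hu xs yt) => q0; apply: qP.
  exact/(vanishes_rp hba hbb hq hu).
apply/eqP; rewrite -subr_eq0 aE; apply/eqP.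
rewrite /to_stalk /= -rmorphM -rmorphB; apply/quot_eq0.
exists (U `&` chart_open); split; first exact: openI oU open_chart.
  exact: scheme_point_openI oU open_chart YU meets_chart_open.
move=> Q z XQ [UQ cQ] hz.
have hv : rp Q (cf z) by rewrite /rp cfK.
have [xv yv] := (chart_openP hv).1 cQ.
have := hpq Q (dh (cf z)) XQ UQ (rp_dehom hv xv yv).
have := hpq Q (cf z) XQ UQ hv; rewrite cfK // => e _.
rewrite -[LHS]/(affine_fun q z * r z - affine_fun p z).
rewrite /affine_fun /dehom hq hp -e !add0n; apply/eqP; rewrite subr_eq0.
by apply/eqP; ring.
Qed.

(** If f vanishes on an open set meeting Y in the chart, a form h that is nonzero at a common point
    and zero off this open set makes h f vanish on the whole chart. *)
Lemma to_stalk_ker f : to_stalk f = 0 -> exists2 h, ~ pr h & chart_ideal pos Lam s t (h * f).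
Proof.
move/quot_eq0 => [U [oU YU hf]].
have [P [u [YP UP hu xs yt]]] := chart_point oU YU.
have [a [b [h [hh hP sub]]]] := open_point hba hbb oU UP.
exists h.
  move/(_ P u YP hu xs yt) => h0; apply: hP; exact/(vanishes_rp hba hbb hh hu).
move=> v [iv xv yv]; rewrite mevalM.
have [->|hv] := eqVneq h.@[v] 0; first by rewrite mul0r.
have [Q hQ] : exists Q, rp Q v.
  by apply: nz_rp => //; split; [exists s; rewrite xv|exists t; rewrite yv];
    rewrite oner_eq0.
have UQ : U Q by apply: sub => /(_ v hQ)/eqP; rewrite (negPf hv).
have := hf Q (ofc v) ((hX hQ).2 iv) UQ hQ.
by rewrite /= /affine_fun (ofcK hba hbb) dehom_id // => ->; rewrite mulr0.
Qed.

Lemma to_stalk_ideal f : chart_ideal pos Lam s t f -> to_stalk f = 0.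
Proof.
move=> hf; apply/quot_eq0; exists chart_open; split.
- exact: open_chart.
- exact: meets_chart_open.
move=> P z XP cP hz; have hv : rp P (cf z) by rewrite /rp cfK.
have [xv yv] := (chart_openP hv).1 cP.
apply: hf; split; [|exact: xc_dehom|exact: yc_dehom].
by apply/inX_sc/(hX hv).
Qed.

Lemma to_stalk_nonunit f : pr f -> nonunit (to_stalk f).
Proof.
move=> pf [y fy]; have [p [q [nq e]]] := to_stalk_frac y.
have hp : is_prime pr := chart_primeP ad (sp_irr Y) mc.
have [hI _ Pp] := hp.
have /to_stalk_ker[h nh hi] : to_stalk (q - p * f) = 0.
  have -> : to_stalk (q - p * f) = to_stalk q - to_stalk p * to_stalk f.
    by rewrite rmorphB rmorphM.
  by rewrite -e -mulrA [y * _]mulrC fy mulr1 subrr.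
case/Pp: (chart_ideal_sub ad (@sp_sub _ _ _ _ Y) hi) => // h1; apply: nq.
by rewrite -(subrK (p * f) q); apply: (ideal_add hI h1 (ideal_mul p hI pf)).
Qed.

(** A nonunit is a fraction with numerator in the prime of Y, and so is a sum of two such
    fractions. *)
Lemma stalk_nonunitD (a b : stalk Y) : nonunit a -> nonunit b -> nonunit (a + b).
Proof.
have red (c : stalk Y) : nonunit c ->
    exists p q, [/\ pr p, ~ pr q & to_stalk q * c = to_stalk p].
  move=> nc; have [p [q [nq e]]] := to_stalk_frac c; exists p, q; split=> //.
  apply: contrapT => /to_stalk_invertible[y hy]; apply: nc.
  by exists (to_stalk q * y); rewrite mulrCA mulrA e.
have hp : is_prime pr := chart_primeP ad (sp_irr Y) mc.
have [hI _ Pp] := hp.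
move=> /red[p1 [q1 [pp1 nq1 e1]]] /red[p2 [q2 [pp2 nq2 e2]]] [y hy].
have [z hz] := invertibleM (to_stalk_invertible nq1) (to_stalk_invertible nq2).
apply: (@to_stalk_nonunit (q2 * p1 + q1 * p2)).
  exact: (ideal_add hI (ideal_mul q2 hI pp1) (ideal_mul q1 hI pp2)).
exists (z * y).
have -> : to_stalk (q2 * p1 + q1 * p2) =
    to_stalk q2 * to_stalk p1 + to_stalk q1 * to_stalk p2.
  by rewrite rmorphD !rmorphM.
rewrite -e1 -e2 (_ : _ * _ = (to_stalk q1 * to_stalk q2 * z) * ((a + b) * y)).
  by rewrite hz hy mulr1.
by ring.
Qed.

Lemma stalk_cohen_macaulay : (forall i, pos i \in Lam) -> chart_indices pos s t ->
  cohen_macaulay_ring (stalk Y).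
Proof.
move=> ex st; have [_ _ posM _] := ad.
apply: (@cohen_macaulay_free _ _ _ _ _ _ _ _ to_stalk (@chart_free k _ _ _ s t posM ex st)).
- exact: to_stalk_ideal.
- move=> f /to_stalk_ker[h nh hh]; exists h => //; exact: to_stalk_invertible.
- move=> a; have [p [q [nq e]]] := to_stalk_frac a; exists p, q; split=> //.
  exact: to_stalk_invertible.
- exact: stalk_nonunitD.
Qed.

End Stalk.

Lemma cohen_macaulay_adapted (k : closedFieldType) (V W : vectType k) (n' : nat)
    (ba : n'.+1.-tuple V) (bb : n'.+1.-tuple W) (pos : 'I_n'.+1 -> nat) Lam X :
  adapted ba bb pos Lam X -> (forall i, pos i \in Lam) -> cohen_macaulay X.
Proof.
move=> ad ex Y; have [[P YP] _] := sp_irr Y.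
have [ba' [bb' [s [t [u [ad' st hu xs yt]]]]]] := adapted_chart ad (sp_sub YP).
apply: (stalk_cohen_macaulay ad' (s := s) (t := t)) => //.
by exists P, u.
Qed.

(** * Global sections *)

Section LocallyRational.
Variable k : closedFieldType.

(** Induction on the degree of a global denominator h: at a root of h the numerator vanishes too, so
    the linear factor can be cancelled. *)
Lemma poly_of_locally_rational (r : k -> k) :
  (forall t0, exists f h : {poly k}, h.[t0] != 0 /\ forall t, r t * h.[t] = f.[t]) ->
  exists F : {poly k}, forall t, r t = F.[t].
Proof.
move=> loc.
have [m] : exists m, exists f h : {poly k},
    [/\ h != 0, forall t, r t * h.[t] = f.[t] & (size h <= m)%N].
  have [f [h [h0 hf]]] := loc 0; exists (size h), f, h; split=> //.
  by apply: contraNneq h0 => ->; rewrite horner0.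
elim: m => [|m IH] [f [h [h0 hf sh]]].
  by move: sh; rewrite leqn0 size_poly_eq0 (negPf h0).
have [sh1|sh1] := eqVneq (size h) 1%N.
  have /eqP/size_poly1P[c c0 hc] := sh1; exists (c^-1 *: f) => t.
  by rewrite hornerZ -hf hc hornerC mulrCA mulVf // mulr1.
have [t1 /factor_theorem[h' hE]] := closed_rootP h sh1.
have [f' fE] : exists f', f = f' * ('X - t1%:P).
  by apply/factor_theorem; rewrite rootE -hf hE hornerM hornerXsubC subrr !mulr0.
have h'0 : h' != 0 by apply: contraNneq h0 => e; rewrite hE e mul0r.
have off t : t != t1 -> r t * h'.[t] = f'.[t].
  move=> tt; have := hf t; rewrite hE fE !hornerM !hornerXsubC mulrA.
  by apply: mulIf; rewrite subr_eq0.
apply: IH; exists f', h'; split=> //; last first.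
  by move: sh; rewrite hE size_Mmonic ?monicXsubC // size_XsubC addn2.
(* Cancelling is not allowed at t1 itself. There a second fraction, regular at t1, agrees with the
   reduced one as a rational function, and its denominator can be inverted. *)
move=> t; have [->|/off//] := eqVneq t t1.
have [f1 [h1 [h1n h1f]]] := loc t1.
have e : f1 * h' = f' * h1.
  apply/eqP; rewrite -subr_eq0; apply/eqP.
  apply: (@poly_eval_eq0_off _ ('X - t1%:P)); first by rewrite polyXsubC_eq0.
  move=> x; rewrite !hornerE subr_eq0 => /off xe.
  by rewrite -h1f -xe; ring.
have := congr1 (fun q => q.[t1]) e; rewrite !hornerM -h1f => e'.
by apply: (mulIf h1n); rewrite -e'; ring.
Qed.

(** With e the size of G, R is t^e G(1/t), a polynomial of degree at most e, and F t^e = t^d R. *)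
Lemma size_by_inversion (F G : {poly k}) d :
  (forall t, t != 0 -> F.[t] = t ^+ d * G.[t^-1]) -> (size F <= d.+1)%N.
Proof.
move=> h; pose e := size G.
pose R := \sum_(i < e) G`_i *: 'X^(e - i).
have FR : F * 'X^e = 'X^d * R.
  apply/eqP; rewrite -subr_eq0; apply/eqP.
  apply: (@poly_eval_eq0_off _ 'X); first by rewrite polyX_eq0.
  move=> x; rewrite hornerX => x0; rewrite !hornerE h // -mulrA -mulrBr.
  rewrite horner_coef horner_sum big_distrl -sumrB big1 ?mulr0 // => i _ /=.
  rewrite hornerZ hornerXn exprVn -mulrA.
  have -> : x ^+ e = x ^+ i * x ^+ (e - i) by rewrite -exprD subnKC // ltnW.
  by rewrite mulKf ?subrr // expf_neq0.
have sR : (size R <= e.+1)%N.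
  apply: leq_trans (size_sum _ _ _) _; apply/bigmax_leqP => i _.
  by apply: leq_trans (size_scale_leq _ _) _; rewrite size_polyXn ltnS leq_subr.
have [->|F0] := eqVneq F 0; first by rewrite size_poly0.
have : (size (F * 'X^e)%R <= (d + e).+1)%N.
  rewrite FR mulrC; have [->|R0] := eqVneq R 0; first by rewrite mul0r size_poly0.
  by rewrite size_mulXn // -addnS leq_add2l.
by rewrite size_mulXn // addnC -addSn leq_add2r.
Qed.

End LocallyRational.

Section SectionOnComponent.
Variables (k : closedFieldType) (n : nat) (pos : 'I_n -> nat) (Lam : seq nat).
Variables (a b : nat) (sig : ('I_(n + n) -> k) -> k).
Hypotheses (a_gt0 : (0 < a)%N) (b_gt0 : (0 < b)%N).
Implicit Types (u v : 'I_(n + n) -> k) (x y w : 'I_n -> k).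

Definition local_fraction : Prop := forall u0, nz u0 -> inX pos Lam u0 ->
  exists c d p q, [/\ hom2 (a + c) (b + d) p, hom2 c d q, q.@[u0] != 0 &
    forall u, nz u -> inX pos Lam u -> sig u * q.@[u] = p.@[u]].

Hypothesis lf : local_fraction.

Lemma nz_sc c d u : c != 0 -> d != 0 -> nz u -> nz (sc c d u).
Proof.
move=> c0 d0 [[s xs] [t yt]]; split; [exists s|exists t];
  by rewrite ?xc_sc ?yc_sc mulf_neq0.
Qed.

Lemma sig_sc c d u : c != 0 -> d != 0 -> nz u -> inX pos Lam u ->
  sig (sc c d u) = c ^+ a * d ^+ b * sig u.
Proof.
move=> c0 d0 nu iu; have [e [f [p [q [hp hq qu h]]]]] := lf nu iu.
have := h _ (nz_sc c0 d0 nu) (inX_sc _ _ iu); rewrite hp hq -h //.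
have n0 : c ^+ e * d ^+ f * q.@[u] != 0 by rewrite !mulf_neq0 // expf_neq0.
move=> e'; apply: (mulIf n0); rewrite e' !exprD; ring.
Qed.

(** Extension by zero to the points with a vanishing half; positivity of a and b makes it compatible
    with scaling by 0. *)
Definition sig0 u : k := if `[< nz u >] then sig u else 0.

Lemma sig0_nz u : nz u -> sig0 u = sig u.
Proof. by move=> h; rewrite /sig0 asboolT. Qed.

Lemma sig0_x0 u : (forall s, xc u s = 0) -> sig0 u = 0.
Proof. by move=> h; rewrite /sig0 asboolF // => -[[s]]; rewrite h eqxx. Qed.

Lemma sig0_y0 u : (forall s, yc u s = 0) -> sig0 u = 0.
Proof. by move=> h; rewrite /sig0 asboolF // => -[_ [s]]; rewrite h eqxx. Qed.

Lemma sig0_sc c d u : inX pos Lam u -> sig0 (sc c d u) = c ^+ a * d ^+ b * sig0 u.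
Proof.
move=> iu; have [->|c0] := eqVneq c 0.
  rewrite expr0n (gtn_eqF a_gt0) !mul0r sig0_x0 // => s.
  by rewrite xc_sc mul0r.
have [->|d0] := eqVneq d 0.
  rewrite expr0n (gtn_eqF b_gt0) mulr0 mul0r sig0_y0 // => s.
  by rewrite yc_sc mul0r.
have [nu|nu] := pselect (nz u); first by rewrite !sig0_nz ?sig_sc //; apply: nz_sc.
rewrite /sig0 !asboolF ?mulr0 // => nu'; apply: nu.
have := nz_sc (invr_neq0 c0) (invr_neq0 d0) nu'.
by rewrite sc_sc !mulVf // sc1.
Qed.

Definition ray u v (t : k) : 'I_(n + n) -> k := fun r => u r + t * v r.

Lemma xc_ray u v t s : xc (ray u v t) s = xc u s + t * xc v s. Proof. by []. Qed.
Lemma yc_ray u v t s : yc (ray u v t) s = yc u s + t * yc v s. Proof. by []. Qed.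

Lemma sig_ray u v : (forall t, nz (ray u v t)) -> (forall t, inX pos Lam (ray u v t)) ->
  exists F : {poly k}, forall t, sig (ray u v t) = F.[t].
Proof.
move=> nr ir; apply: poly_of_locally_rational => t0.
have [c [d [p [q [hp hq qu h]]]]] := lf (nr t0) (ir t0).
have [F hF] := mpoly_line p u v; have [G hG] := mpoly_line q u v.
exists F, G; split=> [|t]; first by rewrite -hG.
by rewrite -hG -hF; apply: h.
Qed.

(* The exponents e1, e2 in {0, 1} say whether the x- and the y-part move; the
   second ray is the first one seen from its point at infinity. *)
Lemma sig_ray_size u v u' v' (e1 e2 : nat) :
  (forall t, nz (ray u v t)) -> (forall t, inX pos Lam (ray u v t)) ->
  (forall t, nz (ray u' v' t)) -> (forall t, inX pos Lam (ray u' v' t)) ->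
  (forall t, t != 0 -> ray u v t = sc (t ^+ e1) (t ^+ e2) (ray u' v' t^-1)) ->
  exists F : {poly k}, (size F <= (e1 * a + e2 * b).+1)%N /\
    forall t, sig0 (ray u v t) = F.[t].
Proof.
move=> n1 i1 n2 i2 inv.
have [F hF] := sig_ray n1 i1; have [G hG] := sig_ray n2 i2.
exists F; split; last by move=> t; rewrite sig0_nz.
apply: (@size_by_inversion _ F G) => t t0.
rewrite -hF inv // sig_sc ?expf_neq0 // hG; congr (_ * _).
by rewrite -!exprM -exprD.
Qed.

Lemma inZ_mk l x y : (forall s, (pos s < l)%N -> x s = 0) ->
  (forall s, (l < pos s)%N -> y s = 0) ->
  (exists al be z, forall s, pos s = l -> x s = al * z s /\ y s = be * z s) ->
  inZ pos l (mkpt x y).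
Proof.
move=> hx hy [al [be [z hz]]]; split=> [s sl|s sl|s t sl tl].
- by rewrite xc_mkpt hx.
- by rewrite yc_mkpt hy.
have [e1 e2] := hz _ sl; have [e3 e4] := hz _ tl.
by rewrite !xc_mkpt !yc_mkpt e1 e2 e3 e4; ring.
Qed.

Lemma zero_or_not x : (forall s, x s = 0) \/ (exists s, x s != 0).
Proof.
have [h|h] := pselect (exists s, x s != 0); [by right|left=> s].
by apply: contrapT => /eqP xs; apply: h; exists s.
Qed.

(** Disjoint supports keep the ray away from x = 0 when x0 and x1 are both nonzero, and the ray seen
    from infinity is the one with x0 and x1 exchanged. In the degenerate cases bihomogeneity gives a
    multiple of t^a, a constant or zero. *)
Lemma sig_move_x x0 x1 y :
  (forall s, x0 s = 0 \/ x1 s = 0) ->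
  (forall c d, inX pos Lam (mkpt (fun s => c * x0 s + d * x1 s) y)) ->
  exists F : {poly k}, (size F <= a.+1)%N /\
    forall t, sig0 (mkpt (fun s => x0 s + t * x1 s) y) = F.[t].
Proof.
move=> dis hin.
have [y0|[r yr]] := zero_or_not y.
  exists 0; rewrite size_poly0; split=> // t.
  by rewrite horner0 sig0_y0 // => s; rewrite yc_mkpt.
have [z0|[s0 xs0]] := zero_or_not x0.
  exists (sig0 (mkpt x1 y) *: 'X^a); split=> [|t].
    by apply: leq_trans (size_scale_leq _ _) _; rewrite size_polyXn.
  rewrite (_ : mkpt _ _ = sc t 1 (mkpt x1 y)); last first.
    by apply: pt_ext => s; rewrite ?xc_sc ?yc_sc ?xc_mkpt ?yc_mkpt ?z0 ?add0r ?mul1r.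
  rewrite sig0_sc; first by rewrite expr1n hornerZ hornerXn mulr1 mulrC.
  have := hin 0 1; congr inX; apply: pt_ext => s; rewrite ?yc_mkpt // !xc_mkpt.
  by rewrite mul0r add0r mul1r.
have [z1|[s1 xs1]] := zero_or_not x1.
  exists (sig0 (mkpt x0 y))%:P; split; first exact: leq_trans (size_polyC_leq1 _) _.
  move=> t; rewrite hornerC; congr sig0; apply: pt_ext => s; rewrite ?yc_mkpt //.
  by rewrite !xc_mkpt z1 mulr0 addr0.
have rE t : mkpt (fun s => x0 s + t * x1 s) y = ray (mkpt x0 y) (mkpt x1 (fun=> 0)) t.
  by apply: pt_ext => s; rewrite ?xc_ray ?yc_ray !(xc_mkpt, yc_mkpt) ?mulr0 ?addr0.
have rE' t : mkpt (fun s => x1 s + t * x0 s) y = ray (mkpt x1 y) (mkpt x0 (fun=> 0)) t.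
  by apply: pt_ext => s; rewrite ?xc_ray ?yc_ray !(xc_mkpt, yc_mkpt) ?mulr0 ?addr0.
have s01 : x1 s0 = 0 by case: (dis s0) => // e; rewrite e eqxx in xs0.
have s10 : x0 s1 = 0 by case: (dis s1) => // e; rewrite e eqxx in xs1.
have [||||t t0|F [sF hF]] := @sig_ray_size (mkpt x0 y) (mkpt x1 (fun=> 0))
    (mkpt x1 y) (mkpt x0 (fun=> 0)) 1 0.
- move=> t; rewrite -rE; split; [exists s0|exists r];
    by rewrite ?xc_mkpt ?yc_mkpt // s01 mulr0 addr0.
- move=> t; rewrite -rE; have := hin 1 t; congr inX; apply: pt_ext => s;
    by rewrite ?yc_mkpt // !xc_mkpt mul1r.
- move=> t; rewrite -rE'; split; [exists s1|exists r];
    by rewrite ?xc_mkpt ?yc_mkpt // s10 mulr0 addr0.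
- move=> t; rewrite -rE'; have := hin t 1; congr inX; apply: pt_ext => s;
    by rewrite ?yc_mkpt // !xc_mkpt mul1r addrC.
- rewrite -rE -rE'; apply: pt_ext => s; rewrite ?xc_sc ?yc_sc ?xc_mkpt ?yc_mkpt.
    by rewrite expr1 mulrDr mulrA mulfV // mul1r addrC.
  by rewrite expr0 mul1r.
exists F; split=> [|t]; last by rewrite rE hF.
by move: sF; rewrite mul1n mul0n addn0.
Qed.

Lemma sig_move_y y0 y1 x :
  (forall s, y0 s = 0 \/ y1 s = 0) ->
  (forall c d, inX pos Lam (mkpt x (fun s => c * y0 s + d * y1 s))) ->
  exists F : {poly k}, (size F <= b.+1)%N /\
    forall t, sig0 (mkpt x (fun s => y0 s + t * y1 s)) = F.[t].
Proof.
move=> dis hin.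
have [x0|[r xr]] := zero_or_not x.
  exists 0; rewrite size_poly0; split=> // t.
  by rewrite horner0 sig0_x0 // => s; rewrite xc_mkpt.
have [z0|[s0 xs0]] := zero_or_not y0.
  exists (sig0 (mkpt x y1) *: 'X^b); split=> [|t].
    by apply: leq_trans (size_scale_leq _ _) _; rewrite size_polyXn.
  rewrite (_ : mkpt _ _ = sc 1 t (mkpt x y1)); last first.
    by apply: pt_ext => s; rewrite ?xc_sc ?yc_sc ?xc_mkpt ?yc_mkpt ?z0 ?add0r ?mul1r.
  rewrite sig0_sc; first by rewrite expr1n hornerZ hornerXn mul1r mulrC.
  have := hin 0 1; congr inX; apply: pt_ext => s; rewrite ?xc_mkpt // !yc_mkpt.
  by rewrite mul0r add0r mul1r.
have [z1|[s1 xs1]] := zero_or_not y1.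
  exists (sig0 (mkpt x y0))%:P; split; first exact: leq_trans (size_polyC_leq1 _) _.
  move=> t; rewrite hornerC; congr sig0; apply: pt_ext => s; rewrite ?xc_mkpt //.
  by rewrite !yc_mkpt z1 mulr0 addr0.
have rE t : mkpt x (fun s => y0 s + t * y1 s) = ray (mkpt x y0) (mkpt (fun=> 0) y1) t.
  by apply: pt_ext => s; rewrite ?xc_ray ?yc_ray !(xc_mkpt, yc_mkpt) ?mulr0 ?addr0.
have rE' t : mkpt x (fun s => y1 s + t * y0 s) = ray (mkpt x y1) (mkpt (fun=> 0) y0) t.
  by apply: pt_ext => s; rewrite ?xc_ray ?yc_ray !(xc_mkpt, yc_mkpt) ?mulr0 ?addr0.
have s01 : y1 s0 = 0 by case: (dis s0) => // e; rewrite e eqxx in xs0.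
have s10 : y0 s1 = 0 by case: (dis s1) => // e; rewrite e eqxx in xs1.
have [||||t t0|F [sF hF]] := @sig_ray_size (mkpt x y0) (mkpt (fun=> 0) y1)
    (mkpt x y1) (mkpt (fun=> 0) y0) 0 1.
- move=> t; rewrite -rE; split; [exists r|exists s0];
    by rewrite ?xc_mkpt ?yc_mkpt // s01 mulr0 addr0.
- move=> t; rewrite -rE; have := hin 1 t; congr inX; apply: pt_ext => s;
    by rewrite ?xc_mkpt // !yc_mkpt mul1r.
- move=> t; rewrite -rE'; split; [exists r|exists s1];
    by rewrite ?xc_mkpt ?yc_mkpt // s10 mulr0 addr0.
- move=> t; rewrite -rE'; have := hin t 1; congr inX; apply: pt_ext => s;
    by rewrite ?xc_mkpt // !yc_mkpt mul1r addrC.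
- rewrite -rE -rE'; apply: pt_ext => s; rewrite ?xc_sc ?yc_sc ?xc_mkpt ?yc_mkpt.
    by rewrite expr0 mul1r.
  by rewrite expr1 mulrDr mulrA mulfV // mul1r addrC.
exists F; split=> [|t]; last by rewrite rE hF.
by move: sF; rewrite mul1n mul0n add0n.
Qed.

(** The same vector moves in both halves, whence the degree a + b. If one fixed part is zero, that
    half is merely scaled and contributes t^a or t^b, and only the other half moves. *)
Lemma sig_move_both x0 y0 x1 :
  (forall s, x0 s = 0 \/ x1 s = 0) -> (forall s, y0 s = 0 \/ x1 s = 0) ->
  (exists s, x1 s != 0) ->
  (forall c d, inX pos Lam (mkpt (fun s => c * x0 s + d * x1 s)
                                 (fun s => c * y0 s + d * x1 s))) ->
  (forall c d, (forall s, x0 s = 0) ->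
     inX pos Lam (mkpt x1 (fun s => c * y0 s + d * x1 s))) ->
  (forall c d, (forall s, y0 s = 0) ->
     inX pos Lam (mkpt (fun s => c * x0 s + d * x1 s) x1)) ->
  exists F : {poly k}, (size F <= (a + b).+1)%N /\
    forall t, sig0 (mkpt (fun s => x0 s + t * x1 s) (fun s => y0 s + t * x1 s)) = F.[t].
Proof.
move=> disx disy [s1 xs1] hin hinx hiny.
have szM (F : {poly k}) c d : (size F <= d.+1)%N -> (size ('X^c * F)%R <= (c + d).+1)%N.
  move=> sF; rewrite mulrC; have [->|F0] := eqVneq F 0; first by rewrite mul0r size_poly0.
  by rewrite size_mulXn // -addnS leq_add2l.
have [z0|[s0 xs0]] := zero_or_not x0.
  have [F [sF hF]] := sig_move_y disy (fun c d => hinx c d z0).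
  exists ('X^a * F); split=> [|t]; first exact: szM.
  rewrite hornerM hornerXn -hF -[t ^+ a]mulr1 -(expr1n _ b) -sig0_sc.
    congr sig0; apply: pt_ext => s;
      by rewrite ?xc_sc ?yc_sc ?xc_mkpt ?yc_mkpt ?z0 ?add0r ?mul1r.
  by have := hinx 1 t z0; congr inX; apply: pt_ext => s;
    rewrite ?xc_mkpt ?yc_mkpt ?mul1r.
have [z0|[s2 ys2]] := zero_or_not y0.
  have [F [sF hF]] := sig_move_x disx (fun c d => hiny c d z0).
  exists ('X^b * F); split=> [|t]; first by rewrite addnC; apply: szM.
  rewrite hornerM hornerXn -hF -[t ^+ b]mul1r -(expr1n _ a) -sig0_sc.
    congr sig0; apply: pt_ext => s;
      by rewrite ?xc_sc ?yc_sc ?xc_mkpt ?yc_mkpt ?z0 ?add0r ?mul1r.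
  by have := hiny 1 t z0; congr inX; apply: pt_ext => s;
    rewrite ?xc_mkpt ?yc_mkpt ?mul1r.
have rE t : mkpt (fun s => x0 s + t * x1 s) (fun s => y0 s + t * x1 s) =
    ray (mkpt x0 y0) (mkpt x1 x1) t.
  by apply: pt_ext => s; rewrite ?xc_ray ?yc_ray !(xc_mkpt, yc_mkpt).
have rE' t : mkpt (fun s => x1 s + t * x0 s) (fun s => x1 s + t * y0 s) =
    ray (mkpt x1 x1) (mkpt x0 y0) t.
  by apply: pt_ext => s; rewrite ?xc_ray ?yc_ray !(xc_mkpt, yc_mkpt).
have x1s0 : x1 s0 = 0 by case: (disx s0) => // e; rewrite e eqxx in xs0.
have x1s2 : x1 s2 = 0 by case: (disy s2) => // e; rewrite e eqxx in ys2.
have x0s1 : x0 s1 = 0 by case: (disx s1) => // e; rewrite e eqxx in xs1.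
have y0s1 : y0 s1 = 0 by case: (disy s1) => // e; rewrite e eqxx in xs1.
have [||||t t0|F [sF hF]] := @sig_ray_size (mkpt x0 y0) (mkpt x1 x1)
    (mkpt x1 x1) (mkpt x0 y0) 1 1.
- move=> t; rewrite -rE; split; [exists s0|exists s2];
    by rewrite ?xc_mkpt ?yc_mkpt ?x1s0 ?x1s2 mulr0 addr0.
- move=> t; rewrite -rE; have := hin 1 t; congr inX; apply: pt_ext => s;
    by rewrite ?xc_mkpt ?yc_mkpt mul1r.
- move=> t; rewrite -rE'; split; exists s1;
    by rewrite ?xc_mkpt ?yc_mkpt ?x0s1 ?y0s1 mulr0 addr0.
- move=> t; rewrite -rE'; have := hin t 1; congr inX; apply: pt_ext => s;
    by rewrite ?xc_mkpt ?yc_mkpt mul1r addrC.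
- rewrite -rE -rE'; apply: pt_ext => s; rewrite ?xc_sc ?yc_sc ?xc_mkpt ?yc_mkpt;
    by rewrite expr1 mulrDr mulrA mulfV // mul1r addrC.
exists F; split=> [|t]; last by rewrite rE hF.
by move: sF; rewrite !mul1n.
Qed.

End SectionOnComponent.

Section OneComponent.
Variables (k : closedFieldType) (n : nat) (pos : 'I_n -> nat) (Lam : seq nat).
Variables (a b : nat) (sig : ('I_(n + n) -> k) -> k).
Hypotheses (a_gt0 : (0 < a)%N) (b_gt0 : (0 < b)%N).
Hypothesis lf : local_fraction pos Lam a b sig.
Variable l : nat.
Hypothesis lL : l \in Lam.
Implicit Types (x y w : 'I_n -> k) (s r : 'I_n).
Local Notation sig0 := (sig0 sig).
Local Notation iota_pt := (iota_pt pos l).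

Let inX_mk x y : (forall s, (pos s < l)%N -> x s = 0) ->
  (forall s, (l < pos s)%N -> y s = 0) ->
  (exists al be z, forall s, pos s = l -> x s = al * z s /\ y s = be * z s) ->
  inX pos Lam (mkpt x y).
Proof. by move=> hx hy hz; exists l => //; apply: inZ_mk. Qed.

(** A coordinate of [w] appears in x only, in y only, or in both, according to whether its position
    lies above, below or at l. *)
Lemma sig_iota_variable w r : exists F : {poly k}, (size F <= (a + b).+1)%N /\
  forall t, sig0 (iota_pt (upd w r t)) = F.[t].
Proof.
pose x0 s := if (l <= pos s)%N && (s != r) then w s else 0.
pose y0 s := if (pos s <= l)%N && (s != r) then w s else 0.
pose e s : k := (s == r)%:R.
have dx s : x0 s = 0 \/ e s = 0.
  by rewrite /x0 /e; case: eqP; rewrite ?andbF; [left|right].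
have dy s : y0 s = 0 \/ e s = 0.
  by rewrite /y0 /e; case: eqP; rewrite ?andbF; [left|right].
have [lr|rl|rl] := ltngtP l (pos r).
- have [|F [sF hF]] := @sig_move_x _ _ pos Lam _ _ _ a_gt0 b_gt0 lf x0 e y0 dx.
    move=> c d; apply: inX_mk => [s sl|s sl|].
    + rewrite /x0 /e leqNgt sl /= mulr0 add0r; case: eqP => [se|]; rewrite ?mulr0 //.
      by move: sl; rewrite se ltnNge (ltnW lr).
    + by rewrite /y0 leqNgt sl.
    + exists c, 1, w => s sl; rewrite /x0 /y0 /e sl leqnn /=.
      case: eqP => [se|_]; last by rewrite mulr0 addr0 mul1r.
      by move: lr; rewrite -sl se ltnn.
  exists F; split=> [|t]; first by apply: leq_trans sF _; rewrite ltnS leq_addr.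
  rewrite -hF; congr sig0; apply: pt_ext => s; rewrite ?xc_mkpt ?yc_mkpt /upd.
    rewrite /x0 /e; case: eqP => [->|_]; rewrite ?andbT ?andbF ?mulr0 ?addr0 //.
    by rewrite (ltnW lr) add0r mulr1.
  rewrite /y0; case: eqP => [->|_]; rewrite ?andbT ?andbF //.
  by rewrite leqNgt lr.
- have [|F [sF hF]] := @sig_move_y _ _ pos Lam _ _ _ a_gt0 b_gt0 lf y0 e x0 dy.
    move=> c d; apply: inX_mk => [s sl|s sl|].
    + by rewrite /x0 leqNgt sl.
    + rewrite /y0 /e leqNgt sl /= mulr0 add0r; case: eqP => [se|]; rewrite ?mulr0 //.
      by move: sl; rewrite se ltnNge (ltnW rl).
    + exists 1, c, w => s sl; rewrite /x0 /y0 /e sl leqnn /=.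
      case: eqP => [se|_]; last by rewrite mulr0 addr0 mul1r.
      by move: rl; rewrite -sl se ltnn.
  exists F; split=> [|t]; first by apply: leq_trans sF _; rewrite ltnS leq_addl.
  rewrite -hF; congr sig0; apply: pt_ext => s; rewrite ?xc_mkpt ?yc_mkpt /upd.
    rewrite /x0; case: eqP => [->|_]; rewrite ?andbT ?andbF //.
    by rewrite leqNgt rl.
  rewrite /y0 /e; case: eqP => [->|_]; rewrite ?andbT ?andbF ?mulr0 ?addr0 //.
  by rewrite (ltnW rl) add0r mulr1.
have hl s : (l <= pos s)%N -> (pos s <= l)%N -> pos s = l.
  by move=> h1 h2; apply/eqP; rewrite eqn_leq h1 h2.
have e0 s : pos s <> l -> e s = 0.
  by rewrite /e; case: eqP => // ->; rewrite -rl.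
have x0l s : (pos s < l)%N -> x0 s = 0 by move=> sl; rewrite /x0 leqNgt sl.
have y0l s : (l < pos s)%N -> y0 s = 0 by move=> sl; rewrite /y0 leqNgt sl.
have xy0 s : pos s = l -> x0 s = y0 s by move=> sl; rewrite /x0 /y0 sl leqnn.
have elt s : (pos s < l)%N -> e s = 0.
  by move=> sl; apply: e0 => se; rewrite se ltnn in sl.
have egt s : (l < pos s)%N -> e s = 0.
  by move=> sl; apply: e0 => se; rewrite se ltnn in sl.
have [||||F [sF hF]] := @sig_move_both _ _ pos Lam _ _ _ a_gt0 b_gt0 lf x0 y0 e dx dy.
- by exists r; rewrite /e eqxx oner_eq0.
- move=> c d; apply: inX_mk => [s sl|s sl|].
  + by rewrite x0l // elt // !mulr0 addr0.
  + by rewrite y0l // egt // !mulr0 addr0.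
  + exists 1, 1, (fun s => c * x0 s + d * e s) => s sl.
    by rewrite !mul1r xy0.
- move=> c d z; apply: inX_mk => [s sl|s sl|]; first exact: elt.
    by rewrite y0l // egt // !mulr0 addr0.
  by exists 1, d, e => s sl; rewrite -xy0 // z mulr0 add0r mul1r.
- move=> c d z; apply: inX_mk => [s sl|s sl|]; last first.
  + by exists d, 1, e => s sl; rewrite xy0 // z mulr0 add0r mul1r.
  + exact: egt.
  + by rewrite x0l // elt // !mulr0 addr0.
exists F; split=> // t; rewrite -hF; congr sig0.
apply: pt_ext => s; rewrite ?xc_mkpt ?yc_mkpt /upd /x0 /y0 /e.
  case: eqP => [->|_]; rewrite ?andbT ?andbF ?mulr0 ?addr0 //.
  by rewrite rl leqnn add0r mulr1.
case: eqP => [->|_]; rewrite ?andbT ?andbF ?mulr0 ?addr0 //.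
by rewrite rl leqnn add0r mulr1.
Qed.

(** The coordinates of position above l enter through x alone, so their joint degree is at most a.
    This bound and the symmetric one for b are what [adm_degrees] turns into admissibility. *)
Lemma sig_iota_upper w : exists F : {poly k}, (size F <= a.+1)%N /\
  forall t, sig0 (iota_pt (fun s => t ^+ (l < pos s)%N * w s)) = F.[t].
Proof.
pose x0 s := if pos s == l then w s else 0.
pose x1 s := if (l < pos s)%N then w s else 0.
pose y0 s := if (pos s <= l)%N then w s else 0.
have [||F [sF hF]] := @sig_move_x _ _ pos Lam _ _ _ a_gt0 b_gt0 lf x0 x1 y0.
- move=> s; rewrite /x0 /x1; case: eqP => [->|_]; last by left.
  by rewrite ltnn; right.
- move=> c d; apply: inX_mk => [s sl|s sl|].
  + by rewrite /x0 /x1 (ltn_eqF sl) ltnNge (ltnW sl) !mulr0 addr0.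
  + by rewrite /y0 leqNgt sl.
  + exists c, 1, w => s sl; rewrite /x0 /x1 /y0 sl eqxx ltnn leqnn.
    by rewrite mulr0 addr0 mul1r.
exists F; split=> // t; rewrite -hF; congr sig0.
apply: pt_ext => s; rewrite ?xc_mkpt ?yc_mkpt /x0 /x1 /y0.
  case: ltngtP => _; rewrite ?mulr0 ?addr0 ?add0r ?expr1 ?expr0 ?mul1r //.
by case: ltnP => _; rewrite ?expr0 ?mul1r.
Qed.

Lemma sig_iota_lower w : exists F : {poly k}, (size F <= b.+1)%N /\
  forall t, sig0 (iota_pt (fun s => t ^+ (pos s < l)%N * w s)) = F.[t].
Proof.
pose y0 s := if pos s == l then w s else 0.
pose y1 s := if (pos s < l)%N then w s else 0.
pose x0 s := if (l <= pos s)%N then w s else 0.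
have [||F [sF hF]] := @sig_move_y _ _ pos Lam _ _ _ a_gt0 b_gt0 lf y0 y1 x0.
- move=> s; rewrite /y0 /y1; case: eqP => [->|_]; last by left.
  by rewrite ltnn; right.
- move=> c d; apply: inX_mk => [s sl|s sl|].
  + by rewrite /x0 leqNgt sl.
  + by rewrite /y0 /y1 (gtn_eqF sl) ltnNge (ltnW sl) !mulr0 addr0.
  + exists 1, c, w => s sl; rewrite /x0 /y0 /y1 sl eqxx ltnn leqnn.
    by rewrite mulr0 addr0 mul1r.
exists F; split=> // t; rewrite -hF; congr sig0.
apply: pt_ext => s; rewrite ?xc_mkpt ?yc_mkpt /x0 /y0 /y1.
  by case: ltnP => _; rewrite ?expr0 ?mul1r.
case: ltngtP => _; rewrite ?mulr0 ?addr0 ?add0r ?expr1 ?expr0 ?mul1r //.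
Qed.

Lemma sig_iota_scale t w : sig0 (iota_pt (fun s => t * w s)) = t ^+ (a + b) * sig0 (iota_pt w).
Proof.
rewrite exprD -(sig0_sc a_gt0 b_gt0 lf).
  congr sig0; apply: pt_ext => s; rewrite ?xc_sc ?yc_sc ?xc_iota ?yc_iota;
    by case: ifP; rewrite ?mulr0.
by exists l => //; apply: inZ_iota.
Qed.

Lemma sig_iota_mpoly : exists G : {mpoly k[n]},
  (forall w, sig0 (iota_pt w) = G.@[w]) /\
  forall m, m \in msupp G ->
    [/\ mdeg m = (a + b)%N, (\sum_s (l < pos s)%N * m s <= a)%N &
        (\sum_s (pos s < l)%N * m s <= b)%N].
Proof.
have [G hG] := @poly_in_each_variable _ _ (a + b) (fun w => sig0 (iota_pt w))
  sig_iota_variable.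
exists G; split=> // m mG.
have hw (wt : 'I_n -> nat) d : (forall w, exists F : {poly k}, (size F <= d.+1)%N /\
    forall t, sig0 (iota_pt (fun s => t ^+ wt s * w s)) = F.[t]) ->
    (\sum_s wt s * m s <= d)%N.
  move=> h; rewrite leqNgt; apply: (@msupp_wdeg _ _ wt G (fun e => (d < e)%N)) mG.
  move=> v; have [F [sF hF]] := h v; exists F; split=> [e de|t].
    by rewrite nth_default // (leq_trans sF).
  by rewrite -hF hG.
split; [|exact: hw sig_iota_upper|exact: hw sig_iota_lower].
have := @msupp_wdeg _ _ (fun=> 1%N) G (fun e => e != (a + b)%N) _ m mG.
rewrite negbK => h; have /eqP <- : wdeg (fun=> 1%N) m == (a + b)%N.
  apply: h => v; exists (G.@[v] *: 'X^(a + b)); split=> [e /negPf ea|t].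
    by rewrite coefZ coefXn ea mulr0.
  rewrite hornerZ hornerXn mulrC -!hG -sig_iota_scale.
  by congr sig0; congr iota_pt; apply/funext => s; rewrite expr1.
by rewrite mdegE; apply: eq_bigr => s _; rewrite mul1n.
Qed.

End OneComponent.

(** * Standard monomials and their restrictions to components *)

Section StandardMonomials.
Variables (k : closedFieldType) (n : nat) (pos : 'I_n -> nat) (a b : nat).
Hypothesis posM : forall i j : 'I_n, (i <= j)%N -> (pos i <= pos j)%N.
Implicit Types (sq : seq 'I_n) (u : 'I_(n + n) -> k) (w : 'I_n -> k) (l : nat).

(* For sorted [sq] the indices given to y precede those given to x, so that
   [std sq] is nonzero on the component [l] as soon as [adm l sq]. *)
Definition std sq : {mpoly k[n + n]} :=
  (\prod_(s <- drop b sq) Xp k s) * (\prod_(s <- take b sq) Yp k s).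

Definition adm l sq : bool :=
  all (fun s => (l <= pos s)%N) (drop b sq) && all (fun s => (pos s <= l)%N) (take b sq).

Lemma std_eval sq u : (std sq).@[u] =
  (\prod_(s <- drop b sq) xc u s) * (\prod_(s <- take b sq) yc u s).
Proof.
rewrite mevalM !rmorph_prod; congr (_ * _); apply: eq_bigr => s _.
  exact: Xp_eval.
exact: Yp_eval.
Qed.

Lemma hom2_std sq : size sq = (a + b)%N -> hom2 a b (std sq).
Proof.
move=> sz c d u; rewrite !std_eval.
have sd : size (drop b sq) = a by rewrite size_drop sz addnK.
have st : size (take b sq) = b.
  by rewrite size_take sz; case: ltnP => //; rewrite -{2}[b]add0n leq_add2r leqn0 => /eqP ->.
have -> : \prod_(s <- drop b sq) xc (sc c d u) s =
    c ^+ a * \prod_(s <- drop b sq) xc u s.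
  rewrite -sd -[RHS]/(_ * _); elim: (drop b sq) => [|s r IH].
    by rewrite !big_nil mulr1.
  by rewrite !big_cons IH xc_sc /= exprS; ring.
have -> : \prod_(s <- take b sq) yc (sc c d u) s =
    d ^+ b * \prod_(s <- take b sq) yc u s.
  rewrite -{2}st; elim: (take b sq) => [|s r IH].
    by rewrite !big_nil mulr1.
  by rewrite !big_cons IH yc_sc /= exprS; ring.
by ring.
Qed.

Lemma std_inZ l sq u : inZ pos l u -> ~~ adm l sq -> (std sq).@[u] = 0.
Proof.
case=> hx hy _; rewrite negb_and std_eval => /orP[] /allPn[s ss].
  rewrite -ltnNge => /hx x0; rewrite (big_rem s ss) /= x0.
  by rewrite !mul0r.
rewrite -ltnNge => /hy y0; rewrite (big_rem s ss) /= y0.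
by rewrite mul0r mulr0.
Qed.

(** For l = l' this is the parametrization of the component; for l < l' these points lie on both
    components. A standard monomial restricts to an ordinary monomial in w or to 0. *)
Definition cross_pt l l' w : 'I_(n + n) -> k :=
  mkpt (fun s => if (l' <= pos s)%N then w s else 0)
       (fun s => if (pos s <= l)%N then w s else 0).

Lemma std_cross l l' w sq : all (fun s => (l' <= pos s)%N) (drop b sq) ->
  all (fun s => (pos s <= l)%N) (take b sq) ->
  (std sq).@[cross_pt l l' w] = \prod_(s <- sq) w s.
Proof.
move=> /allP hd /allP ht; rewrite std_eval -[in RHS](cat_take_drop b sq) big_cat /=.
rewrite mulrC; congr (_ * _); apply: eq_big_seq => s ss.
  by rewrite yc_mkpt ht.
by rewrite xc_mkpt hd.
Qed.

Lemma std_cross0 l l' w sq :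
  ~~ (all (fun s => (l' <= pos s)%N) (drop b sq) &&
      all (fun s => (pos s <= l)%N) (take b sq)) ->
  (std sq).@[cross_pt l l' w] = 0.
Proof.
rewrite negb_and std_eval => /orP[] /allPn[s ss].
  by move=> /negPf sl; rewrite (big_rem s ss) /= xc_mkpt sl !mul0r.
by move=> /negPf sl; rewrite mulrC (big_rem s ss) /= yc_mkpt sl !mul0r.
Qed.

Lemma prod_s2m sq w : \prod_(s <- sq) w s = ('X_[s2m sq] : {mpoly k[n]}).@[w].
Proof.
rewrite mevalX; elim: sq => [|s sq IH].
  by rewrite big_nil big1 // => i _; rewrite mnmE expr0.
rewrite big_cons IH [RHS](bigD1 s) //= mnmE /= eqxx add1n exprS.
rewrite (bigD1 s) //= -mulrA mnmE; congr (_ * (_ * _)).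
by apply: eq_bigr => i /negPf is_; rewrite !mnmE /= eq_sym is_.
Qed.

Lemma sum_s2m (wt : 'I_n -> nat) sq :
  (\sum_s wt s * (s2m sq) s)%N = (\sum_(s <- sq) wt s)%N.
Proof.
elim: sq => [|s sq IH].
  by rewrite big_nil big1 // => i _; rewrite mnmE muln0.
rewrite big_cons -IH (bigD1 s) //= [in RHS](bigD1 s) //= !mnmE /= eqxx add1n mulnS.
rewrite -!addnA; congr (_ + (_ + _))%N.
by apply: eq_bigr => i /negPf is_; rewrite !mnmE /= eq_sym is_.
Qed.

(** By sortedness, a position below l among the indices given to x forces all b indices given to y
    below l as well, which makes b + 1 of them; symmetrically above l. *)
Lemma adm_degrees l sq : size sq = (a + b)%N -> (0 < a)%N -> (0 < b)%N ->
  sorted leq [seq val i | i <- sq] ->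
  (\sum_(s <- sq) (l < pos s)%N <= a)%N -> (\sum_(s <- sq) (pos s < l)%N <= b)%N ->
  adm l sq.
Proof.
move=> sz a0 b0 srt ha hb; rewrite -(cat_take_drop b sq) big_cat /= in ha;
  rewrite -(cat_take_drop b sq) big_cat /= in hb.
have sd : size (drop b sq) = a by rewrite size_drop sz addnK.
have st : size (take b sq) = b.
  by rewrite size_takel // sz leq_addl.
have le s s' : s \in take b sq -> s' \in drop b sq -> (pos s <= pos s')%N.
  move=> hs hs'; apply: posM; move: srt; rewrite -(cat_take_drop b sq) map_cat.
  rewrite (sorted_pairwise leq_trans) pairwise_cat => /and3P[/allrelP h _ _].
  by apply: h; apply: map_f.
have full (p : pred 'I_n) (r : seq 'I_n) : all p r -> (\sum_(s <- r) p s)%N = size r.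
  elim: r => [|s r IH] /=; first by rewrite big_nil.
  by case/andP=> ps /IH; rewrite big_cons ps => ->.
rewrite /adm; apply/andP; split; apply/allP => s ss; rewrite leqNgt; apply/negP => sl.
  have h : all (fun s' => (pos s' < l)%N) (take b sq).
    by apply/allP => s' hs' /=; exact: (leq_ltn_trans (le _ _ hs' ss) sl).
  move: hb; rewrite (full _ _ h) st (big_rem s ss) /= sl.
  by rewrite leqNgt addnA addnAC addn1 ltnS leq_addr.
have h : all (fun s' => (l < pos s')%N) (drop b sq).
  by apply/allP => s' hs'; exact: (leq_trans sl (le _ _ ss hs')).
move: ha; rewrite (full _ _ h) sd (big_rem s ss) /= sl.
by rewrite leqNgt addnC addnA addn1 ltnS leq_addr.
Qed.

End StandardMonomials.

Lemma sum_pick (R : pzRingType) (I : eqType) (r : seq I) (i : I) (F : I -> R) : uniq r ->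
  \sum_(j <- r) F j * (j == i)%:R = if i \in r then F i else 0.
Proof.
move=> ur; case: ifP => ir.
  rewrite (bigD1_seq i) //= eqxx mulr1 big1 ?addr0 // => j /negPf ->.
  by rewrite mulr0.
rewrite big_seq big1 // => j jr; case: eqP => [ji|_]; rewrite ?mulr0 //.
by rewrite ji ir in jr.
Qed.

Section Sections.
Variables (k : closedFieldType) (V W : vectType k) (n' : nat).
Local Notation n := n'.+1.
Variables (ba : n.-tuple V) (bb : n.-tuple W) (pos : 'I_n -> nat) (Lam : seq nat).
Variable X : set (biproj V W).
Hypothesis ad : adapted ba bb pos Lam X.
Let hba : basis_of fullv ba. Proof. by case: ad. Qed.
Let hbb : basis_of fullv bb. Proof. by case: ad. Qed.
Let posM : forall i j : 'I_n, (i <= j)%N -> (pos i <= pos j)%N.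
Proof. by case: ad. Qed.
Let hX : forall P u, rp ba bb P u -> X P <-> inX pos Lam u.
Proof. by case: ad. Qed.
Variables a b : nat.
Hypotheses (a_gt0 : (0 < a)%N) (b_gt0 : (0 < b)%N).
Implicit Types (u : 'I_(n + n) -> k) (w : 'I_n -> k) (m : 'X_{1..n}).
Implicit Types (c : 'X_{1..n} -> k) (P Q : biproj V W) (l : nat).
Local Notation rp := (rp ba bb).
Local Notation ofc := (ofc ba bb).
Local Notation cf := (cf ba bb).
Local Notation B := [seq s2m (tval t) | t <- enum (basis n (a + b))].
Local Notation full_comp := (full_comp ba bb pos).

Definition smono m : {mpoly k[n + n]} := std k b (m2s m).
Definition admm l m := adm pos b l (m2s m).
Definition ev c u := \sum_(m <- B) c m * (smono m).@[u].
Definition evp c : {mpoly k[n + n]} := \sum_(m <- B) c m *: smono m.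

Lemma evpE c u : (evp c).@[u] = ev c u.
Proof. by rewrite /evp raddf_sum; apply: eq_bigr => m _ /=; rewrite mevalZ. Qed.

Lemma size_m2sB m : m \in B -> size (m2s m) = (a + b)%N.
Proof. by rewrite -basis_cover size_m2s => /eqP. Qed.

Lemma hom2_smono m : m \in B -> hom2 a b (smono m).
Proof. by move=> /size_m2sB; apply: hom2_std. Qed.

Lemma hom2_evp c : hom2 a b (evp c).
Proof.
rewrite /evp big_seq; elim/big_ind: _; [exact: hom2_0|exact: hom2D|] => m mB.
by apply: hom2Z; apply: hom2_smono.
Qed.

Lemma ev_nz c u : ~ nz u -> ev c u = 0.
Proof.
move=> nu; rewrite -evpE.
have [x0|[s xs]] := zero_or_not (xc u).
  have -> : u = sc 0 1 u by apply: pt_ext => s; rewrite ?xc_sc ?yc_sc ?mul1r // mul0r.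
  by rewrite hom2_evp expr0n (gtn_eqF a_gt0) !mul0r.
have [y0|[t yt]] := zero_or_not (yc u).
  have -> : u = sc 1 0 u by apply: pt_ext => t; rewrite ?xc_sc ?yc_sc ?mul1r // mul0r.
  by rewrite hom2_evp expr0n (gtn_eqF b_gt0) mulr0 mul0r.
by case: nu; split; [exists s|exists t].
Qed.

(* The monomials whose standard form does not vanish on [cross_pt l l' w]. *)
Definition crossing l l' m := all (fun s => (l' <= pos s)%N) (drop b (m2s m)) &&
  all (fun s => (pos s <= l)%N) (take b (m2s m)).

Definition cross_poly l l' c : {mpoly k[n]} :=
  \sum_(m <- B) (c m * (crossing l l' m)%:R) *: 'X_[m].

Lemma ev_cross l l' c w : ev c (cross_pt pos l l' w) = (cross_poly l l' c).@[w].
Proof.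
rewrite /cross_poly raddf_sum; apply: eq_bigr => m _ /=.
rewrite mevalZ -mulrA; congr (_ * _); have [/andP[h1 h2]|h] := boolP (crossing l l' m).
  by rewrite mul1r std_cross // prod_s2m s2mK.
by rewrite mul0r std_cross0.
Qed.

Lemma mcoeff_cross l l' c m :
  (cross_poly l l' c)@_m = if m \in B then c m * (crossing l l' m)%:R else 0.
Proof.
rewrite /cross_poly raddf_sum /= -(sum_pick m (fun m => c m * (crossing l l' m)%:R)).
  by apply: eq_bigr => m' _; rewrite mcoeffZ mcoeffX.
exact: uniq_basis.
Qed.

Lemma inZ_cross l l' w : (l < l')%N ->
  inZ pos l (cross_pt pos l l' w) /\ inZ pos l' (cross_pt pos l l' w).
Proof.
move=> ll; split; split.
- by move=> s sl; rewrite xc_mkpt leqNgt (ltn_trans sl ll).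
- by move=> s sl; rewrite yc_mkpt leqNgt sl.
- by move=> s t sl tl; rewrite !xc_mkpt sl tl leqNgt ll !mul0r.
- by move=> s sl; rewrite xc_mkpt leqNgt sl.
- by move=> s sl; rewrite yc_mkpt leqNgt (ltn_trans ll sl).
- by move=> s t sl tl; rewrite !yc_mkpt sl tl leqNgt ll !mulr0.
Qed.

Lemma full_comp_X l P : l \in Lam -> full_comp l P -> X P.
Proof. by move=> lL h; apply/(XP ad); exists l. Qed.

Lemma ev_cross_inj l l' c c' m : l \in Lam -> l' \in Lam ->
  (forall w, ev c (cross_pt pos l l' w) = ev c' (cross_pt pos l l' w)) ->
  m \in B -> crossing l l' m -> c m = c' m.
Proof.
move=> lL lL' e mB cm.
have : cross_poly l l' c = cross_poly l l' c'.
  by apply: mpoly_eval_inj => w; rewrite -!ev_cross.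
by move/mpolyP/(_ m); rewrite !mcoeff_cross mB cm !mulr1.
Qed.

Definition spans l c s := forall P u, full_comp l P -> rp P u -> s (ofc u) = ev c u.

(** The coefficients are those of the polynomial in w. Its degree bounds make every monomial that
    occurs admissible, hence the restriction of a standard monomial. *)
Lemma section_on_component l s : l \in Lam -> is_section X setT a b s ->
  exists c, (forall m, c m != 0 -> m \in B /\ admm l m) /\ spans l c s.
Proof.
move=> lL /(section_frac hba hbb) sec.
pose sig u := s (ofc u).
have lf : local_fraction pos Lam a b sig.
  move=> u0 nu iu; have [P hP] := nz_rp hba hbb nu.
  have XP := iffRL (hX hP) iu.
  have [c [d [p [q [hp hq qP h]]]]] := sec P XP I.
  exists c, d, p, q; split=> // [|u nzu inu].
    by apply/eqP => q0; apply: qP; apply/(vanishes_rp hba hbb hq hP).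
  have [Q hQ] := nz_rp hba hbb nzu.
  by apply: (h Q) => //; apply/(hX hQ).
have [G [sG mG]] := sig_iota_mpoly a_gt0 b_gt0 lf lL.
pose c m := G@_m; exists c.
have hc m : c m != 0 -> m \in B /\ admm l m.
  rewrite -mcoeff_msupp => /mG [dm h1 h2]; have mB : m \in B by rewrite -basis_cover dm.
  split=> //; apply: (@adm_degrees _ _ a) => //.
  - exact: size_m2sB.
  - exact: srt_m2s.
  - by rewrite -sum_s2m s2mK.
  - by rewrite -sum_s2m s2mK.
split=> //.
have eG w : ev c (iota_pt pos l w) = G.@[w].
  rewrite ev_cross; congr (_.@[w]); apply/mpolyP => m; rewrite mcoeff_cross.
  have [c0|cn] := eqVneq (c m) 0; first by rewrite c0 mul0r; case: ifP; rewrite -c0.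
  by have [mB am] := hc m cn; rewrite mB -[crossing l l m]/(admm l m) am mulr1.
move=> P u fP hP; have [c1 [d1 [p [q [hp hq qP h]]]]] := sec P (full_comp_X lL fP) I.
have qu : q.@[u] != 0.
  by apply/eqP => q0; apply: qP; apply/(vanishes_rp hba hbb hq hP).
(* Clearing the denominator gives a form that vanishes on the parametrized points, hence on their
   closure. *)
have hF : hom2 (a + c1) (b + d1) (p - evp c * q).
  by apply: hom2D => //; apply: hom2N; apply: hom2M => //; apply: hom2_evp.
have : vanishes ba bb (p - evp c * q) P.
  move: fP; rewrite (full_comp_closure ad); apply: (closure_vanishes hba hbb hF).
  move=> Q [w [_ hQ]]; apply/(vanishes_rp hba hbb hF hQ).
  have XQ : X Q by apply/(hX hQ); exists l => //; apply: inZ_iota.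
  rewrite mevalB mevalM evpE eG -(h Q) // -sG sig0_nz ?subrr //.
  exact: (rp_nz hba hbb hQ).
have XP := full_comp_X lL fP.
move/(vanishes_rp hba hbb hF hP)/eqP; rewrite mevalB mevalM evpE -(h P) //.
by rewrite -mulrBl mulf_eq0 (negPf qu) orbF subr_eq0 => /eqP.
Qed.

(** A monomial admissible on two components does not vanish on the points common to them, where both
    expansions equal the section. *)
Lemma section_consistent l l' c c' s m : l \in Lam -> l' \in Lam -> (l < l')%N ->
  spans l c s -> spans l' c' s -> m \in B -> admm l m -> admm l' m -> c m = c' m.
Proof.
move=> lL lL' ll hc hc' mB /andP[_ am] /andP[am' _].
apply: (@ev_cross_inj l l') => // [w|]; last by rewrite /crossing am am'.
have [nzu|nzu] := pselect (nz (cross_pt pos l l' w)); last by rewrite !ev_nz.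
have [i1 i2] := inZ_cross w ll; have [P hP] := nz_rp hba hbb nzu.
rewrite -(hc P) // -?(hc' P) //; exact/(full_compP ad _ hP).
Qed.

Definition visible m := has (fun l => admm l m) Lam.

Lemma ev_visible c c' l u : inZ pos l u -> (forall m, m \in B -> admm l m -> c m = c' m) ->
  ev c u = ev c' u.
Proof.
move=> iu h; apply: eq_big_seq => m mB; have [am|am] := boolP (admm l m).
  by rewrite h.
by rewrite /smono (std_inZ iu am) !mulr0.
Qed.

(** The coefficient of a monomial is taken from any component on which it is admissible; monomials
    visible nowhere get 0. *)
Lemma section_ev s : is_section X setT a b s -> exists c,
  (forall m, c m != 0 -> m \in B /\ visible m) /\
  forall P u, X P -> rp P u -> s (ofc u) = ev c u.
Proof.
move=> sec.
have /choice[C hC] : forall l, exists c, l \in Lam ->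
    (forall m, c m != 0 -> m \in B /\ admm l m) /\ spans l c s.
  move=> l; have [lL|_] := boolP (l \in Lam); last by exists (fun=> 0).
  by have [c hc] := section_on_component lL sec; exists c.
pose l0 m := nth 0%N Lam (find (fun l => admm l m) Lam).
have l0P m : visible m -> l0 m \in Lam /\ admm (l0 m) m.
  move=> vm; split; first by rewrite mem_nth // -has_find.
  exact: (@nth_find _ _ (fun l => admm l m)).
pose c m := if visible m then C (l0 m) m else 0; exists c; split.
  move=> m; rewrite /c; case: ifP => [vm|_]; last by rewrite eqxx.
  by have [lL _] := l0P m vm; move=> /(hC _ lL).1 [].
move=> P u /(XP ad)[l lL fP] hP; rewrite ((hC _ lL).2 P) //.
apply: (ev_visible (l := l)) => [|m mB am]; first exact/(full_compP ad _ hP).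
have vm : visible m by apply/hasP; exists l.
have [lL0 am0] := l0P m vm; rewrite /c vm.
have [ll|ll|->//] := ltngtP l (l0 m).
  exact: (section_consistent lL lL0 ll (hC _ lL).2 (hC _ lL0).2).
exact: esym (section_consistent lL0 lL ll (hC _ lL0).2 (hC _ lL).2 mB am0 am).
Qed.

Lemma ev_inj c c' : (forall P u, X P -> rp P u -> ev c u = ev c' u) ->
  forall m, m \in B -> visible m -> c m = c' m.
Proof.
move=> h m mB /hasP[l lL am]; apply: (@ev_cross_inj l l) => // w.
have [nzu|nzu] := pselect (nz (cross_pt pos l l w)); last by rewrite !ev_nz.
have [P hP] := nz_rp hba hbb nzu; apply: (h P) => //.
by apply/(hX hP); exists l => //; apply: inZ_iota.
Qed.

(** The component at the position of the smallest index given to x is suitable: it separates the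
    sorted list exactly where y ends and x begins. *)
Lemma visible_all m : (forall s, pos s \in Lam) -> m \in B -> visible m.
Proof.
move=> allL /size_m2sB sz.
have sd : size (drop b (m2s m)) = a by rewrite size_drop sz addnK.
have srt := srt_m2s m.
case E : (drop b (m2s m)) sd => [|s r] sd; first by move: (a_gt0); rewrite -sd.
apply/hasP; exists (pos s) => //.
move: srt; rewrite -(cat_take_drop b (m2s m)) E map_cat.
rewrite (sorted_pairwise leq_trans) pairwise_cat /= => /and3P[/allrelP h _ /andP[/allP h' _]].
rewrite /admm /adm E; apply/andP; split; apply/allP => t tm.
  move: tm; rewrite inE => /orP[/eqP->|tr]; first exact: leqnn.
  by apply: posM; apply: h'; apply: map_f.
by apply: posM; apply: h; [apply: map_f|rewrite mem_head].
Qed.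

Lemma invisible m r : pos r \notin Lam -> (forall s, s \in m2s m -> s = r) -> m \in B ->
  ~~ visible m.
Proof.
move=> nr mr /size_m2sB sz; apply: contra nr => /hasP[l lL /andP[/allP h1 /allP h2]].
have sd : size (drop b (m2s m)) = a by rewrite size_drop sz addnK.
have st : size (take b (m2s m)) = b by rewrite size_takel // sz leq_addl.
have x1 : nth r (drop b (m2s m)) 0 \in drop b (m2s m) by rewrite mem_nth // sd.
have x2 : nth r (take b (m2s m)) 0 \in take b (m2s m) by rewrite mem_nth // st.
have := h1 _ x1; have := h2 _ x2.
rewrite (mr _ (mem_drop x1)) (mr _ (mem_take x2)) => g1 g2.
by have -> : pos r = l by apply/eqP; rewrite eqn_leq g1.
Qed.

Lemma section_evp c : is_section X setT a b (fun z => ev c (cf z)).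
Proof.
apply/(section_frac hba hbb) => P XP _; exists 0%N, 0%N, (evp c), 1; split.
- by rewrite !addn0; apply: hom2_evp.
- exact: hom2_1.
- have [u hu] := rp_ex hba hbb P.
  by move/(vanishes_rp hba hbb (@hom2_1 _ _) hu)/eqP; rewrite meval1 oner_eq0.
by move=> Q u _ _ _; rewrite meval1 mulr1 evpE ofcK.
Qed.

Lemma section_0 : is_section X setT a b (fun=> 0).
Proof.
have e : (fun=> 0) = (fun z => ev (fun=> 0) (cf z)).
  by apply/funext => z; rewrite /ev big1 // => m _; rewrite mul0r.
by rewrite e; apply: section_evp.
Qed.

End Sections.

(** * The bivariate Hilbert function *)

Section Hilbert.
Variables (k : closedFieldType) (V W : vectType k) (n' : nat).
Local Notation n := n'.+1.
Variables (ba : n.-tuple V) (bb : n.-tuple W) (pos : 'I_n -> nat) (Lam : seq nat).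
Variable X : set (biproj V W).
Hypothesis ad : adapted ba bb pos Lam X.
Let hba : basis_of fullv ba. Proof. by case: ad. Qed.
Let hbb : basis_of fullv bb. Proof. by case: ad. Qed.
Local Notation mon a b := [seq s2m (tval t) | t <- enum (basis n (a + b))].

Lemma size_mon a b : size (mon a b) = 'C(a + b + n - 1, n - 1).
Proof.
rewrite size_basis !subn1 addnS /= -(bin_sub (leq_addl (a + b) n')) addnK.
by [].
Qed.

Lemma hilbert_adapted : (forall s, pos s \in Lam) ->
  eventual_hilbert_function X (fun a b => 'C(a + b + n - 1, n - 1)).
Proof.
move=> allL; exists 1%N => a b a0 b0; rewrite -size_mon.
set B := mon a b; pose mn (t : 'I_(size B)) := nth 0%MM B t.
have mnB t : mn t \in B by apply: mem_nth.
have uB : uniq B by apply: uniq_basis.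
pose e t (z : V * W) := (smono k b (mn t)).@[cf ba bb z].
have evE (c : 'rV[k]_(size B)) (f : 'X_{1..n} -> k) u : (forall t, f (mn t) = c 0 t) ->
    \sum_t c 0 t * e t (ofc ba bb u) = ev a b f u.
  move=> fc; rewrite /ev -/B (big_nth 0%MM) big_mkord; apply: eq_bigr => t _.
  by rewrite /e ofcK // -fc.
have lift (c : 'rV[k]_(size B)) : exists f : 'X_{1..n} -> k, forall t, f (mn t) = c 0 t.
  exists (fun m => if insub (index m B) is Some t then c 0 t else 0) => t.
  by rewrite /mn index_uniq // valK.
exists e; split=> [t|s sec].
  have -> : e t = (fun z => ev a b (fun m => (m == mn t)%:R) (cf ba bb z)).
    apply/funext => z; rewrite /ev (bigD1_seq (mn t)) //= eqxx mul1r.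
    by rewrite big1 ?addr0 // => m /negPf ->; rewrite mul0r.
  exact: (section_evp ad).
have [f [_ hf]] := section_ev ad a0 b0 sec.
exists (\row_t f (mn t)); split=> [P z XP Pz|c hc].
  rewrite -{1 2}(cfK hba hbb z) (evE _ f) => [|t]; last by rewrite mxE.
  by apply: (hf P) => //; rewrite /rp cfK.
have [g hg] := lift c; apply/rowP => t; rewrite mxE -hg.
apply: (ev_inj ad a0 b0) (mnB t) (visible_all ad a0 allL (mnB t)) => P u XP hu.
by rewrite -(hf P) // (hc P) // (evE _ g).
Qed.

(** A position missing from [Lam] leaves fewer visible monomials than the prescribed dimension. The
    basis sections are then linearly dependent, contradicting the uniqueness of the coordinates of
    the zero section. *)
Lemma hilbert_adapted_converse :
  eventual_hilbert_function X (fun a b => 'C(a + b + n - 1, n - 1)) ->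
  forall s, pos s \in Lam.
Proof.
case=> N0 /(_ N0.+1 N0.+1 (leqnSn _) (leqnSn _)) H r; apply: contrapT => /negP nr.
move: H; rewrite -size_mon; set a := N0.+1; set B := mon a a => -[e [he hs]].
have uB : uniq B by apply: uniq_basis.
(* All indices equal r: admissibility on l would need both l <= pos r and pos r <= l. Taking both
   degrees to be N0 + 1 makes them positive. *)
pose m0 := (U_(r) *+ (a + a))%MM.
have m0B : m0 \in B by rewrite -basis_cover mdegMn mdeg1 mul1n.
have m0r s : s \in m2s m0 -> s = r.
  rewrite -has_pred1 has_count; have -> : count_mem s (m2s m0) = m0 s.
    by rewrite -[in RHS](s2mK m0) mnmE.
  by rewrite mulmnE mnm1E; case: eqP => [->|]; rewrite ?mul0n.
have nv := invisible (a := a) (b := a) isT isT nr m0r m0B.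
pose B' := rem m0 B.
have sB : size B = (size B').+1 by rewrite size_rem // prednK // -has_predT; apply/hasP; exists m0.
have /choice[c hc] : forall t, exists c : 'X_{1..n} -> k,
    (forall m, c m != 0 -> m \in B /\ visible pos Lam a m) /\
    forall P u, X P -> rp ba bb P u -> e t (ofc ba bb u) = ev a a c u.
  by move=> t; apply: (section_ev ad).
pose M := \matrix_(t < size B, q < size B') c t (nth 0%MM B' q).
have : kermx M != 0.
  rewrite -mxrank_eq0 mxrank_ker subn_eq0 -ltnNge.
  by apply: leq_ltn_trans (rank_leq_col M) _; rewrite sB.
case/rowV0Pn => v /sub_kermxP vM v0.
have [c0 [_ uq]] := hs _ (section_0 ad a a).
have E0 : c0 = 0 by apply: uq => P z _ _; rewrite big1 // => t _; rewrite mxE mul0r.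
have E1 : c0 = v.
  apply: uq => P z XP Pz; symmetry.
  have hz : rp ba bb P (cf ba bb z) by rewrite /rp cfK.
  rewrite -[z](cfK hba hbb) (eq_bigr (fun t => v 0 t * ev a a (c t) (cf ba bb z))).
    rewrite /ev; under eq_bigr => t _ do rewrite big_distrr /=.
    rewrite exchange_big /= big_seq big1 // => m mB.
    under eq_bigr => t _ do rewrite mulrA.
    rewrite -big_distrl /=; have [me|mn] := eqVneq m m0.
      rewrite big1 ?mul0r // => t _; have [->|] := eqVneq (c t m) 0; first by rewrite mulr0.
      by move=> /(hc t).1 [_]; rewrite me (negPf nv).
    have mB' : m \in B' by rewrite mem_rem_uniq // inE mn.
    have iq : (index m B' < size B')%N by rewrite index_mem.
    have /rowP/(_ (Ordinal iq)) := vM; rewrite !mxE => h.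
    rewrite (eq_bigr (fun t => v 0 t * M t (Ordinal iq))) ?h ?mul0r // => t _.
    by rewrite mxE /= nth_index.
  by move=> t _; rewrite ((hc t).2 P).
by move: v0; rewrite -E1 E0 eqxx.
Qed.

End Hilbert.

(** * Adapted bases *)

Lemma mem_zip (T U : eqType) (s : seq T) (t : seq U) p :
  p \in zip s t -> p.1 \in s /\ p.2 \in t.
Proof.
elim: s t => [|x s IH] [|y t] //=; rewrite inE => /orP[/eqP->|/IH[h1 h2]].
  by split; apply: mem_head.
by rewrite !inE h1 h2 !orbT.
Qed.

Section PairMaps.
Variables (k : fieldType) (V W : vectType k).

Definition pair_left (x : V) : V * W := (x, 0).
Definition pair_right (y : W) : V * W := (0, y).
Fact pair_left_linear : linear pair_left.
Proof. by move=> c x y; apply/pair_equal_spec; rewrite /= scaler0 addr0. Qed.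
Fact pair_right_linear : linear pair_right.
Proof. by move=> c x y; apply/pair_equal_spec; rewrite /= scaler0 addr0. Qed.
HB.instance Definition _ := GRing.isLinear.Build k V (V * W)%type _ pair_left pair_left_linear.
HB.instance Definition _ := GRing.isLinear.Build k W (V * W)%type _ pair_right pair_right_linear.

Definition proj_left : 'Hom((V * W)%type, V) := linfun fst.
Definition proj_right : 'Hom((V * W)%type, W) := linfun snd.
Definition inj_left : 'Hom(V, (V * W)%type) := linfun pair_left.
Definition inj_right : 'Hom(W, (V * W)%type) := linfun pair_right.

Implicit Type E : {vspace (V * W)%type}.

(** E is regarded as a linear relation from V to W: [dom] and [ran] are its domain and range, [dom0]
    its kernel and [ran0] the set of values of 0. *)
Definition dom E := (proj_left @: E)%VS.
Definition ran E := (proj_right @: E)%VS.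
Definition dom0 E := (inj_left @^-1: E)%VS.
Definition ran0 E := (inj_right @^-1: E)%VS.

Lemma mem_dom0 E x : (x \in dom0 E) = ((x, 0) \in E).
Proof. by rewrite -memv_preim lfunE. Qed.

Lemma mem_ran0 E y : (y \in ran0 E) = ((0, y) \in E).
Proof. by rewrite -memv_preim lfunE. Qed.

Lemma domP E x : reflect (exists y, (x, y) \in E) (x \in dom E).
Proof.
apply: (iffP memv_imgP) => [[[x' y] h ->]|[y h]]; first by exists y; rewrite lfunE.
by exists (x, y); rewrite ?lfunE.
Qed.

Lemma ranP E y : reflect (exists x, (x, y) \in E) (y \in ran E).
Proof.
apply: (iffP memv_imgP) => [[[x y'] h ->]|[x h]]; first by exists x; rewrite lfunE.
by exists (x, y); rewrite ?lfunE.
Qed.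

Lemma dim_dom_ran0 E : (\dim (dom E) + \dim (ran0 E) = \dim E)%N.
Proof.
rewrite -(limg_ker_dim proj_left E) addnC; congr addn.
rewrite -(@limg_dim_eq _ _ _ inj_right); last first.
  apply/eqP; rewrite -subv0; apply/subvP => y; rewrite memv_cap memv_ker lfunE memv0.
  by case/andP=> _ /eqP[->].
congr (\dim _); apply/vspaceP => -[x y]; rewrite memv_cap memv_ker lfunE /=.
apply/memv_imgP/andP => [[y' y'E]|[xyE /eqP x0]].
  by rewrite lfunE => -[-> ->]; rewrite -mem_ran0.
by subst x; exists y; rewrite ?lfunE ?mem_ran0.
Qed.

Lemma dim_ran_dom0 E : (\dim (ran E) + \dim (dom0 E) = \dim E)%N.
Proof.
rewrite -(limg_ker_dim proj_right E) addnC; congr addn.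
rewrite -(@limg_dim_eq _ _ _ inj_left); last first.
  apply/eqP; rewrite -subv0; apply/subvP => y; rewrite memv_cap memv_ker lfunE memv0.
  by case/andP=> _ /eqP[->].
congr (\dim _); apply/vspaceP => -[x y]; rewrite memv_cap memv_ker lfunE /=.
apply/memv_imgP/andP => [[x' x'E]|[xyE /eqP y0]].
  by rewrite lfunE => -[-> ->]; rewrite -mem_dom0.
by subst y; exists x; rewrite ?lfunE ?mem_dom0.
Qed.

End PairMaps.

Section Adapt.
Variables (k : fieldType) (V W : vectType k) (n m : nat) (E : nat -> {vspace (V * W)%type}).
Hypotheses (dimV : \dim {:V} = n) (dimW : \dim {:W} = n).
Hypothesis dimE : forall l, (l <= m)%N -> \dim (E l) = n.
Hypothesis Edn : forall l x y, (l < m)%N -> (x, y) \in E l.+1 -> (x, 0) \in E l.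
Hypothesis Eup : forall l x y, (l < m)%N -> (x, y) \in E l -> (0, y) \in E l.+1.
Hypotheses (E0 : dom (E 0) = fullv) (Em : ran (E m) = fullv).

(** The two flags are interleaved: the step from 2l to 2l + 1 happens inside E_l, the step from 2l +
    1 to 2l + 2 is the gap between E_l and E_(l+1). At each index the two dimensions add up to n. *)
Definition desc q := if odd q then dom0 (E q./2) else dom (E q./2).
Definition asc q := if odd q then ran (E q./2) else ran0 (E q./2).
Let Q := m.*2.+1.

Lemma half_le q : (q <= Q)%N -> (q./2 <= m)%N.
Proof. by rewrite /Q; lia. Qed.

Lemma dim_desc_asc q : (q <= Q)%N -> (\dim (desc q) + \dim (asc q) = n)%N.
Proof.
move=> /half_le h; rewrite /desc /asc -(dimE h); case: ifP => _.
  by rewrite addnC dim_ran_dom0.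
exact: dim_dom_ran0.
Qed.

Lemma desc_step q : (q < Q)%N -> (desc q.+1 <= desc q)%VS.
Proof.
move=> qQ; rewrite /desc oddS -[q.+1./2]/(uphalf q) uphalf_half; case: (boolP (odd q)) => oq /=.
  apply/subvP => x /domP[y h]; rewrite mem_dom0; apply: Edn h.
  by move: qQ oq; rewrite /Q; lia.
by apply/subvP => x; rewrite mem_dom0 => h; apply/domP; exists 0.
Qed.

Lemma asc_step q : (q < Q)%N -> (asc q <= asc q.+1)%VS.
Proof.
move=> qQ; rewrite /asc oddS -[q.+1./2]/(uphalf q) uphalf_half; case: (boolP (odd q)) => oq /=.
  apply/subvP => y /ranP[x h]; rewrite mem_ran0; apply: Eup h.
  by move: qQ oq; rewrite /Q; lia.
by apply/subvP => x; rewrite mem_ran0 => h; apply/ranP; exists 0.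
Qed.

Lemma desc_le q q' : (q <= q')%N -> (q' <= Q)%N -> (desc q' <= desc q)%VS.
Proof.
move=> /subnKC <-; elim: (q' - q)%N => [|d IH]; first by rewrite addn0.
by rewrite addnS => h; apply: subv_trans (desc_step h) (IH (ltnW h)).
Qed.

Lemma asc_le q q' : (q <= q')%N -> (q' <= Q)%N -> (asc q <= asc q')%VS.
Proof.
move=> /subnKC <-; elim: (q' - q)%N => [|d IH]; first by rewrite addn0.
by rewrite addnS => h; apply: subv_trans (IH (ltnW h)) (asc_step h).
Qed.

Lemma desc_first : desc 0 = fullv. Proof. exact: E0. Qed.
Lemma asc_last : asc Q = fullv.
Proof. by rewrite /asc /Q /= odd_double /= uphalf_double. Qed.

Lemma asc_first : asc 0 = 0%VS.
Proof.
apply/eqP; rewrite -dimv_eq0; have := dim_desc_asc (leq0n Q).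
by rewrite desc_first dimV; lia.
Qed.

Lemma desc_last : desc Q = 0%VS.
Proof.
apply/eqP; rewrite -dimv_eq0; have := dim_desc_asc (leqnn Q).
by rewrite asc_last dimW; lia.
Qed.

Lemma dim_diff (U : vectType k) (A B : {vspace U}) : (B <= A)%VS ->
  \dim (A :\: B) = (\dim A - \dim B)%N.
Proof.
by move=> /capv_idPr BA; rewrite -[\dim A](dimv_cap_compl A B) BA addKn.
Qed.

(** For even q the relation identifies the quotients dom / dom0 and ran / ran0, so a basis of a
    complement is paired with chosen images. For odd q the two quotients merely have the same
    dimension, and bases of complements are paired arbitrarily. *)
Lemma adapted_piece q : (q < Q)%N -> exists r : seq (V * W), [/\
  size r = (\dim (desc q) - \dim (desc q.+1))%N,
  (desc q <= <<map fst r>> + desc q.+1)%VS,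
  (asc q.+1 <= <<map snd r>> + asc q)%VS &
  forall p, p \in r -> [/\ p.1 \in desc q, p.2 \in asc q.+1 & ~~ odd q -> p \in E q./2]].
Proof.
move=> qQ; pose U := (desc q :\: desc q.+1)%VS.
have dU := dim_diff (desc_step qQ).
have Usub : (U <= desc q)%VS by apply: diffvSl.
have Uspan : (desc q <= U + desc q.+1)%VS by rewrite addv_diff addvSl.
have [oq|oq] := boolP (odd q).
  pose U' := (asc q.+1 :\: asc q)%VS.
  have dU' : \dim U' = \dim U.
    rewrite dU dim_diff ?asc_step //.
    by have := dim_desc_asc qQ; have := dim_desc_asc (ltnW qQ); lia.
  exists (zip (vbasis U) (vbasis U')).
  have s1 : size (vbasis U) = \dim U by rewrite size_tuple.
  have s2 : size (vbasis U') = \dim U by rewrite size_tuple dU'.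
  rewrite size1_zip ?s1 ?s2 // -/(unzip1 _) -/(unzip2 _) unzip1_zip ?unzip2_zip ?s1 ?s2 //.
  rewrite !(span_basis (vbasisP _)); split=> //; first by rewrite addv_diff addvSl.
  move=> p /mem_zip[h1 h2]; split=> //; first by apply: (subvP Usub); apply: vbasis_mem.
  by apply: (subvP (diffvSl _ _)); apply: vbasis_mem h2.
have eD : desc q = dom (E q./2) by rewrite /desc (negPf oq).
have eC : asc q = ran0 (E q./2) by rewrite /asc (negPf oq).
have eD1 : desc q.+1 = dom0 (E q./2) by rewrite /desc oddS oq /= uphalf_half (negPf oq).
have eC1 : asc q.+1 = ran (E q./2) by rewrite /asc oddS oq /= uphalf_half (negPf oq).
have /choice[f hf] : forall x, exists y, x \in desc q -> (x, y) \in E q./2.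
  move=> x; have [|_] := boolP (x \in desc q); last by exists 0.
  by rewrite eD => /domP[y h]; exists y.
pose r := [seq (x, f x) | x <- vbasis U].
have rE p : p \in r -> p \in E q./2.
  by case/mapP=> x xU ->; apply: hf; apply: (subvP Usub); apply: vbasis_mem.
have r1 : map fst r = vbasis U by rewrite -map_comp map_id.
exists r; rewrite size_map size_tuple r1 (span_basis (vbasisP _)); split=> //.
  rewrite eC1 eC; apply/subvP => y /ranP[x xy].
  have : x \in (U + desc q.+1)%VS by apply: (subvP Uspan); rewrite eD; apply/domP; exists y.
  case/memv_addP=> u uU [x' x'D xE].
  have : u \in (proj_left V W @: <<r>>)%VS.
    rewrite limg_span (eq_map (g := fst)) ?r1 ?(span_basis (vbasisP _)) // => p.
    by rewrite lfunE.
  case/memv_imgP=> -[u' y'] pr; rewrite lfunE /= => e; rewrite -{u'}e in pr.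
  have pE : (u, y') \in E q./2 by apply: (subvP _ _ pr); apply/span_subvP.
  apply/memv_addP; exists y'; last first.
    exists (y - y'); last by rewrite addrC subrK.
    rewrite mem_ran0; have -> : (0, y - y') = (x, y) - (x', 0) - (u, y') :> V * W.
      by apply/pair_equal_spec; rewrite /= subr0 xE addrK subrr.
    by rewrite !rpredB // -mem_dom0 -eD1.
  have -> : y' = proj_right V W (u, y') by rewrite lfunE.
  rewrite (eq_map (g := proj_right V W)) -?limg_span ?memv_img // => p.
  by rewrite lfunE.
move=> p pr; have pE := rE p pr; split=> //.
- by rewrite eD; apply/domP; exists p.2; case: p {pr} pE.
- by rewrite eC1; apply/ranP; exists p.1; case: p {pr} pE.
Qed.

Theorem adapted_bases : exists (ba : n.-tuple V) (bb : n.-tuple W) (pos : 'I_n -> nat),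
  [/\ basis_of fullv ba, basis_of fullv bb,
      forall s t : 'I_n, (s <= t)%N -> (pos s <= pos t)%N,
      forall s, (pos s <= m.*2)%N &
      forall l s, (l <= m)%N -> [/\ (l.*2 < pos s)%N -> (ba`_s, 0) \in E l,
        (pos s < l.*2)%N -> (0, bb`_s) \in E l &
        pos s = l.*2 -> (ba`_s, bb`_s) \in E l]].
Proof.
have /choice[r hr] : forall q, exists r : seq (V * W), (q < Q)%N -> [/\
  size r = (\dim (desc q) - \dim (desc q.+1))%N,
  (desc q <= <<map fst r>> + desc q.+1)%VS,
  (asc q.+1 <= <<map snd r>> + asc q)%VS &
  forall p, p \in r -> [/\ p.1 \in desc q, p.2 \in asc q.+1 & ~~ odd q -> p \in E q./2]].
  move=> q; have [qQ|_] := boolP (q < Q)%N; last by exists [::].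
  by have [r hr] := adapted_piece qQ; exists r.
(* Each pair is tagged with its step in the flags; the tag becomes its position, and sorting by it
   makes the position nondecreasing. *)
pose T0 : seq (nat * (V * W)) := flatten [seq [seq (q, p) | p <- r q] | q <- iota 0 Q].
pose T := sort (relpre fst leq) T0.
have memT q p : ((q, p) \in T) = (q < Q)%N && (p \in r q).
  rewrite mem_sort; apply/flatten_mapP/andP => [[q' q'Q /mapP[p' p'r [-> ->]]]|[qQ pr]].
    by move: q'Q; rewrite mem_iota.
  by exists q; [rewrite mem_iota|apply: map_f].
have szT : size T = n.
  rewrite size_sort size_flatten /shape -map_comp sumnE big_map.
  rewrite -{1}(subn0 Q) -/(index_iota 0 Q).
  rewrite (eq_big_nat _ _ (F2 := fun q => (\dim (desc q) - \dim (desc q.+1))%N)).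
    have h d : (d <= Q)%N ->
        (\sum_(0 <= q < d) (\dim (desc q) - \dim (desc q.+1)) + \dim (desc d) = n)%N.
      elim: d => [_|d IH dQ]; first by rewrite big_geq // add0n desc_first.
      rewrite big_nat_recr //= -addnA subnK; first exact: IH (ltnW dQ).
      exact: dimvS (desc_step dQ).
    by have := h Q (leqnn Q); rewrite desc_last dimv0 addn0.
  by move=> q /andP[_ qQ] /=; rewrite size_map; case: (hr q qQ).
have [x0] : exists x0 : nat * (V * W), True by exists (0%N, (0, 0)).
pose pr s := (nth x0 T s).2; move=> _.
pose pa := map (fst \o snd) T; pose pb := map (snd \o snd) T.
have sza : size pa = n by rewrite size_map szT.
have szb : size pb = n by rewrite size_map szT.
(* The descending flag ends at 0, so the span is accumulated from the last step backwards; n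
   spanning vectors then form a basis. *)
have sa : (fullv <= <<pa>>)%VS.
  rewrite -desc_first.
  have h d : (d <= Q)%N -> (desc (Q - d) <= <<pa>>)%VS.
    elim: d => [_|d IH dQ]; first by rewrite subn0 desc_last sub0v.
    have qQ : (Q - d.+1 < Q)%N by lia.
    have [_ s _ _] := hr _ qQ; apply: subv_trans s _; rewrite subv_add.
    have -> : (Q - d.+1).+1 = (Q - d)%N by lia.
    rewrite IH ?andbT; last exact: ltnW.
    apply: sub_span => x /mapP[p pr' ->]; apply/mapP; exists ((Q - d.+1)%N, p) => //.
    by rewrite memT qQ.
  by have := h Q (leqnn Q); rewrite subnn.
have sb : (fullv <= <<pb>>)%VS.
  rewrite -asc_last.
  have h d : (d <= Q)%N -> (asc d <= <<pb>>)%VS.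
    elim: d => [_|d IH dQ]; first by rewrite asc_first sub0v.
    have [_ _ s _] := hr _ dQ; apply: subv_trans s _; rewrite subv_add IH ?andbT; last exact: ltnW.
    apply: sub_span => x /mapP[p pr' ->]; apply/mapP; exists (d, p) => //.
    by rewrite memT dQ.
  exact: h (leqnn Q).
have szA : size pa == n by rewrite sza.
have szB : size pb == n by rewrite szb.
exists (Tuple szA), (Tuple szB), (fun s => (nth x0 T s).1).
have inT (s : 'I_n) : nth x0 T s \in T by rewrite mem_nth // szT.
have inT' (s : 'I_n) : ((nth x0 T s).1, (nth x0 T s).2) \in T.
  by case: (nth x0 T s) (inT s).
split.
- by rewrite basisEdim sa /= sza dimV.
- by rewrite basisEdim sb /= szb dimW.
- move=> s t st.
  have srt : sorted (relpre fst leq) T by apply: sort_sorted => x y; apply: leq_total.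
  have tr : transitive (relpre (@fst nat (V * W)) leq) by move=> x y z; apply: leq_trans.
  have rf : reflexive (relpre (@fst nat (V * W)) leq) by move=> x; apply: leqnn.
  have Hn := sorted_leq_nth tr rf x0 srt.
  by apply: Hn st; rewrite -topredE /= szT.
- by move=> s; have := inT' s; rewrite memT /Q ltnS => /andP[].
move=> l s lm; have := inT' s; rewrite memT => /andP[qQ pr'].
have [_ _ _ /(_ _ pr')[h1 h2 h3]] := hr _ qQ.
have -> : (Tuple szA)`_s = (nth x0 T s).2.1 by rewrite /= (nth_map x0) ?szT.
have -> : (Tuple szB)`_s = (nth x0 T s).2.2 by rewrite /= (nth_map x0) ?szT.
split=> hl.
- have := subvP (desc_le hl (ltnW qQ)) _ h1.
  by rewrite /desc oddS odd_double /= uphalf_double mem_dom0.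
- have := subvP (asc_le hl _) _ h2; rewrite /asc odd_double doubleK mem_ran0; apply.
  by rewrite /Q; lia.
by move: h3; rewrite hl odd_double doubleK => /(_ isT); case: (_.2).
Qed.

End Adapt.

(** * Linked sequences *)

Lemma int_up_ind (l : int) (P : int -> Prop) : P l ->
  (forall j, l <= j -> P j -> P (j + 1)) -> forall j, l <= j -> P j.
Proof.
move=> P0 PS j lj; have -> : j = l + (absz (j - l)%R)%:Z.
  by rewrite gez0_abs ?subr_ge0 // subrKC.
elim: (absz _) => [|d IH]; first by rewrite addr0.
by rewrite -ls_up_idx; apply: PS; rewrite // lerDl.
Qed.

Lemma int_down_ind (l : int) (P : int -> Prop) : P l ->
  (forall j, j < l -> P (j + 1) -> P j) -> forall j, j <= l -> P j.
Proof.
move=> P0 PS j jl; have -> : j = l - (absz (l - j)%R)%:Z.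
  by rewrite gez0_abs ?subr_ge0 // subKr.
elim: (absz _) => [|d IH]; first by rewrite subr0.
by apply: PS; rewrite ?gtrBl // -ls_dn_idx.
Qed.

Section LinkedMaps.
Variables (k : fieldType) (n : nat) (L : linked_seq k n).
Implicit Types (i j l : int).

Lemma ls_map_up1 l : ls_map L l (l + 1) = ls_up L l.
Proof. by rewrite ls_mapS // ls_mapxx comp_lfun1r. Qed.

Lemma ls_map_dn1 l : ls_map L (l + 1) l = ls_dn L l.
Proof. by rewrite ls_map_dn ?ltrDl // ls_mapxx comp_lfun1r. Qed.

(** Splits off the first map of the composite, where [ls_mapS] splits off the last one. *)
Lemma ls_map_via_up l j : l < j -> ls_map L l j = (ls_map L (l + 1) j \o ls_up L l)%VF.
Proof.
rewrite -lezD1; move: j; apply: int_up_ind => [|j lj IH].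
  by rewrite ls_map_up1 ls_mapxx comp_lfun1l.
rewrite ls_mapS ?IH ?ls_mapS ?comp_lfunA //.
by apply: le_trans lj; rewrite lerDl.
Qed.

Lemma ls_map_via_dn l j : j <= l -> ls_map L (l + 1) j = (ls_map L l j \o ls_dn L l)%VF.
Proof.
move: j; apply: int_down_ind => [|j jl IH].
  by rewrite ls_map_dn1 ls_mapxx comp_lfun1l.
rewrite ls_map_dn ?IH ?(ls_map_dn L jl) ?comp_lfunA //.
by apply: lt_trans jl _; rewrite ltrDl.
Qed.

Lemma ls_ker0 l (v : L (l + 1)) : ls_up L (l + 1) v = 0 -> ls_dn L l v = 0 -> v = 0.
Proof.
move=> h1 h2; apply/eqP; rewrite -memv0 -(ls_ker L l) memv_cap !memv_ker h1 h2.
by rewrite !eqxx.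
Qed.

(** What comes from an h^i is killed by the map back, so by condition (b) the next upward map can
    kill it only if it is already zero. *)
Lemma ls_map_up_neq0 l j (v : L l) : l < j -> ls_up L l v != 0 -> ls_map L l j v != 0.
Proof.
move=> lj v0; have [j' jE] : exists j', j = j' + 1 by exists (j - 1); rewrite subrK.
subst j; move: lj; rewrite ltzD1; move: j'; apply: int_up_ind => [|j lj IH].
  by rewrite ls_map_up1.
rewrite ls_mapS; last by rewrite ler_wpDr.
rewrite comp_lfunE; apply: contraNneq IH => u0; apply/eqP; apply: ls_ker0 u0 _.
by rewrite ls_mapS // comp_lfunE ls_dn_up.
Qed.

Lemma ls_map_dn_neq0 l i (v : L (l + 1)) : i <= l -> ls_dn L l v != 0 ->
  ls_map L (l + 1) i v != 0.
Proof.
move=> il v0; move: i il; apply: int_down_ind => [|i il IH].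
  by rewrite ls_map_dn1.
rewrite ls_map_dn; last by rewrite ltzD1 ltW.
rewrite comp_lfunE; apply: contraNneq IH => u0; apply/eqP; apply: ls_ker0 u0.
by rewrite ls_map_dn ?ltrD2r // comp_lfunE ls_up_dn.
Qed.

End LinkedMaps.

Lemma ls_map_refl_eq0 (k : fieldType) (n : nat) (L : linked_seq k n) (i l : int) (v : L l) :
  i = l -> (ls_map L l i v == 0) = (v == 0).
Proof. by move=> il; subst i; rewrite ls_mapxx id_lfunE. Qed.

Section Range.
Variables (k : fieldType) (n : nat) (L : linked_seq k n) (i j : int).
Hypothesis le_ij : i <= j.
Hypothesis dnB : forall l, l < i -> bijective (ls_dn L l).
Hypothesis upB : forall l, j <= l -> bijective (ls_up L l).
Implicit Type l : int.

Lemma lfun_inj0 (U U' : vectType k) (f : 'Hom(U, U')) v : injective f -> f v = 0 -> v = 0.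
Proof. by move=> fi f0; apply: fi; rewrite f0 linear0. Qed.

(** Together with [ls_dn_eq0], turns the conditions on v in the open piece into the nonvanishing of
    its two images; at l = j the bijectivity of h^j is used. *)
Lemma ls_up_eq0 l (v : L l) : l <= j -> (ls_up L l v == 0) = (ls_map L l j v == 0).
Proof.
rewrite le_eqVlt => /predU1P[lj|lj].
  rewrite ls_map_refl_eq0 //; apply/eqP/eqP => [|->]; last exact: linear0.
  by apply: lfun_inj0; apply: bij_inj; apply: upB; rewrite lj.
apply/eqP/eqP => h; first by rewrite ls_map_via_up // comp_lfunE h linear0.
by apply/eqP; apply: contraTT isT => v0; have := ls_map_up_neq0 lj v0; rewrite h eqxx.
Qed.

Lemma ls_dn_eq0 l (v : L l) : i <= l ->
  (ls_map L l (l - 1) v == 0) = (ls_map L l i v == 0).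
Proof.
have [l' lE] : exists l', l = l' + 1 by exists (l - 1); rewrite subrK.
subst l; rewrite addrK ls_map_dn1 le_eqVlt => /predU1P[il|].
  rewrite ls_map_refl_eq0 //; apply/eqP/eqP => [|->]; last exact: linear0.
  by apply: lfun_inj0; apply: bij_inj; apply: dnB; rewrite il ltrDl.
rewrite ltzD1 => il; apply/eqP/eqP => h.
  by rewrite ls_map_via_dn // comp_lfunE h linear0.
by apply/eqP; apply: contraTT isT => v0; have := ls_map_dn_neq0 il v0; rewrite h eqxx.
Qed.

Let V := L i.
Let W := L j.

Definition both l : 'Hom(L l, (V * W)%type) :=
  ((inj_left V W \o ls_map L l i)%VF + (inj_right V W \o ls_map L l j)%VF).

Lemma bothE l v : both l v = (ls_map L l i v, ls_map L l j v).
Proof.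
rewrite /both add_lfunE !comp_lfunE !lfunE /=; apply/pair_equal_spec.
by rewrite /= addr0 add0r.
Qed.

(** Condition (b) again: a vector with both images zero is killed by both maps leaving V^(l). *)
Lemma both_inj l : i <= l -> l <= j -> injective (both l).
Proof.
move=> il lj; apply/lker0P; rewrite -subv0; apply/subvP => v.
rewrite memv_ker bothE memv0 => /eqP[/eqP h1 /eqP h2].
move: h1 h2; rewrite -ls_dn_eq0 // -ls_up_eq0 //.
have [l' lE] : exists l', l = l' + 1 by exists (l - 1); rewrite subrK.
by subst l; rewrite addrK ls_map_dn1 => /eqP h1 /eqP h2; apply/eqP; apply: ls_ker0 h2 h1.
Qed.

Definition img l := limg (both l).

Lemma imgP l z : reflect (exists v, z = both l v) (z \in img l).
Proof.
apply: (iffP memv_imgP) => [[v _ ->]|[v ->]]; first by exists v.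
by exists v; rewrite ?memvf.
Qed.

Lemma dim_img l : i <= l -> l <= j -> \dim (img l) = n.
Proof.
move=> il lj; rewrite limg_dim_eq ?ls_dim //.
have /lker0P/eqP -> : injective (both l) by exact: both_inj.
by rewrite capv0.
Qed.

Lemma both_dn l (v : L (l + 1)) : i <= l -> l < j ->
  both l (ls_dn L l v) = (ls_map L (l + 1) i v, 0).
Proof.
move=> il lj; rewrite bothE (ls_map_via_dn L il) (ls_map_via_up L lj) !comp_lfunE.
by rewrite ls_up_dn linear0.
Qed.

Lemma both_up l (v : L l) : i <= l -> l < j ->
  both (l + 1) (ls_up L l v) = (0, ls_map L l j v).
Proof.
move=> il lj; rewrite bothE (ls_map_via_dn L il) (ls_map_via_up L lj) !comp_lfunE.
by rewrite ls_dn_up linear0.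
Qed.

Lemma img_dn l x y : i <= l -> l < j -> (x, y) \in img (l + 1) -> (x, 0) \in img l.
Proof.
move=> il lj /imgP[v]; rewrite bothE => -[-> _].
by apply/imgP; exists (ls_dn L l v); rewrite both_dn.
Qed.

Lemma img_up l x y : i <= l -> l < j -> (x, y) \in img l -> (0, y) \in img (l + 1).
Proof.
move=> il lj /imgP[v]; rewrite bothE => -[_ ->].
by apply/imgP; exists (ls_up L l v); rewrite both_up.
Qed.

Lemma dom_img : dom (img i) = fullv.
Proof.
apply/eqP; rewrite eqEsubv subvf /=; apply/subvP => x _; apply/domP.
by exists (ls_map L i j x); apply/imgP; exists x; rewrite bothE ls_mapxx id_lfunE.
Qed.

Lemma ran_img : ran (img j) = fullv.
Proof.
apply/eqP; rewrite eqEsubv subvf /=; apply/subvP => x _; apply/ranP.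
by exists (ls_map L j i x); apply/imgP; exists x; rewrite bothE ls_mapxx id_lfunE.
Qed.

(** Outside the range one of the two maps is bijective; the composites being zero, the other map is
    zero, and exactness is automatic. *)
Lemma ls_exact_range : ls_exact L <-> forall l, i <= l -> l < j ->
  lker (ls_dn L l) = limg (ls_up L l) /\ lker (ls_up L l) = limg (ls_dn L l).
Proof.
split=> [ex l _ _|ex l]; first exact: ex.
have iso (U U' : vectType k) (f : 'Hom(U, U')) (g : 'Hom(U', U)) :
    bijective f -> (forall v, g (f v) = 0) -> lker f = limg g /\ lker g = limg f.
  move=> bf gf; have kf : lker f = 0%VS by apply/eqP/lker0P; apply: bij_inj.
  have g0 v : g v = 0 by case: bf => f' _ fK; rewrite -(fK v).
  rewrite kf; split; apply/esym/eqP.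
    by rewrite -subv0; apply/subvP => _ /memv_imgP[v _ ->]; rewrite g0 mem0v.
  rewrite eqEsubv; apply/andP; split; apply/subvP => v _; first by rewrite memv_ker g0.
  by case: bf => f' _ fK; rewrite -(fK v) memv_img ?memvf.
have [li|il] := ltP l i; first by apply: iso; [exact: dnB|exact: ls_up_dn].
have [lj|jl] := ltP l j; first exact: ex.
by have [h1 h2] := iso _ _ _ _ (upB jl) (@ls_dn_up _ _ L l).
Qed.

End Range.

Section Coordinates.
Variables (k : closedFieldType) (V W : vectType k) (n : nat).
Variables (ba : n.-tuple V) (bb : n.-tuple W) (pos : 'I_n -> nat).
Hypotheses (hba : basis_of fullv ba) (hbb : basis_of fullv bb).

(** The n given vectors of E are independent, since each coefficient can be read off in x or in y;
    by dimension they form a basis of E. *)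
Lemma iota_image (E : {vspace (V * W)%type}) (c : nat) : \dim E = n ->
  (forall s, [/\ (c < pos s)%N -> (ba`_s, 0) \in E, (pos s < c)%N -> (0, bb`_s) \in E &
     pos s = c -> (ba`_s, bb`_s) \in E]) ->
  forall z, z \in E <-> exists w, z = ofc ba bb (iota_pt pos c w).
Proof.
move=> dE hE.
pose Z := [tuple ofc ba bb (iota_pt pos c (fun t => (t == s)%:R)) | s < n].
have ZE (s : 'I_n) : Z`_s = (if (c <= pos s)%N then ba`_s else 0,
                    if (pos s <= c)%N then bb`_s else 0).
  rewrite -tnth_nth tnth_mktuple /ofc; apply/pair_equal_spec; split.
    rewrite (bigD1 s) //= xc_iota eqxx big1 ?addr0 => [|t /negPf ts].
      by case: ifP; rewrite ?scale1r ?scale0r.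
    by rewrite xc_iota ts if_same scale0r.
  rewrite (bigD1 s) //= yc_iota eqxx big1 ?addr0 => [|t /negPf ts].
    by case: ifP; rewrite ?scale1r ?scale0r.
  by rewrite yc_iota ts if_same scale0r.
have sumZ (w : 'I_n -> k) : \sum_s w s *: Z`_s = ofc ba bb (iota_pt pos c w).
  have f1 : (\sum_s w s *: Z`_s).1 = (ofc ba bb (iota_pt pos c w)).1.
    rewrite (raddf_sum fst); apply: eq_bigr => s _; rewrite ZE xc_iota /=.
    by case: ifP; rewrite ?scaler0 ?scale0r.
  have f2 : (\sum_s w s *: Z`_s).2 = (ofc ba bb (iota_pt pos c w)).2.
    rewrite (raddf_sum snd); apply: eq_bigr => s _; rewrite ZE yc_iota /=.
    by case: ifP; rewrite ?scaler0 ?scale0r.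
  by rewrite [LHS]surjective_pairing f1 f2 -surjective_pairing.
have Zin (s : 'I_n) : Z`_s \in E.
  rewrite ZE; have [h1 h2 h3] := hE s.
  by case: (ltngtP c (pos s)) => [/h1|/h2|/esym/h3].
have Zfree : free Z.
  apply/freeP => w; rewrite sumZ => w0 s.
  have e : cf ba bb (ofc ba bb (iota_pt pos c w)) = cf ba bb (ofc ba bb (fun=> 0)).
    rewrite w0; congr (cf ba bb _).
    by rewrite /ofc !big1 // => t _; rewrite /xc /yc scale0r.
  rewrite !ofcK // in e.
  have [cs|cs] := leqP c (pos s).
    by have := congr1 (fun u => xc u s) e; rewrite /= xc_iota cs.
  by have := congr1 (fun u => yc u s) e; rewrite /= yc_iota (ltnW cs).
have spanZ : <<Z>>%VS = E.
  apply/eqP; rewrite eqEdim dE; apply/andP; split.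
    by apply/span_subvP => z /(nthP 0)[s]; rewrite size_tuple => sn <-; apply: (Zin (Ordinal sn)).
  by move: Zfree; rewrite /free => /eqP ->; rewrite size_tuple.
move=> z; split=> [zE|[w ->]].
  exists (fun s => coord Z s z); rewrite -sumZ; apply: coord_span.
  by rewrite spanZ.
by rewrite -sumZ; apply: memv_suml => s _; apply: memvZ.
Qed.

End Coordinates.

Section Adapted.
Variables (k : closedFieldType) (n' : nat) (L : linked_seq k n'.+1) (i j : int).
Local Notation n := n'.+1.
Hypothesis le_ij : i <= j.
Hypothesis dnB : forall l, l < i -> bijective (ls_dn L l).
Hypothesis upB : forall l, j <= l -> bijective (ls_up L l).
Variables (ba : n.-tuple (L i)) (bb : n.-tuple (L j)) (pos : 'I_n -> nat) (m : nat).
Hypotheses (hba : basis_of fullv ba) (hbb : basis_of fullv bb).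
Hypothesis jE : j = i + m%:Z.
Hypothesis posM : forall s t : 'I_n, (s <= t)%N -> (pos s <= pos t)%N.
Hypothesis pos_le : forall s, (pos s <= m.*2)%N.
Hypothesis imgE : forall p z, (p <= m)%N -> z \in img L i j (i + p%:Z) <->
  exists w, z = ofc ba bb (iota_pt pos p.*2 w).

Definition cuts := [seq p.*2 | p <- iota 0 m.+1].

Lemma mem_cuts c : (c \in cuts) = ~~ odd c && (c <= m.*2)%N.
Proof.
apply/mapP/andP => [[p pm ->]|[oc cm]].
  by move: pm; rewrite mem_iota odd_double leq_double ltnS => /andP[_ ->].
by exists c./2; [rewrite mem_iota|]; lia.
Qed.

Lemma in_range p : (p <= m)%N -> i <= i + p%:Z /\ i + p%:Z <= j.
Proof. by move=> pm; rewrite jE lerDl lerD2l lez_nat. Qed.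

Lemma rangeP l : i <= l -> l <= j -> exists2 p, (p <= m)%N & l = i + p%:Z.
Proof.
move=> il lj; exists (absz (l - i)%R); last by rewrite gez0_abs ?subr_ge0 // subrKC.
by rewrite -lez_nat gez0_abs ?subr_ge0 // lerBlDl -jE.
Qed.

Lemma ls_proj_open_param p : (p <= m)%N ->
  ls_proj_open L i j (i + p%:Z) = param_set ba bb pos [set: 'I_n]%SET p.*2.
Proof.
move=> pm; have [il lj] := in_range pm; apply/seteqP; split=> P.
  case=> v [v1 v2 e1 e2].
  rewrite (ls_up_eq0 upB) // in v1; rewrite (ls_dn_eq0 dnB) // in v2.
  have : both L i j (i + p%:Z) v \in img L i j (i + p%:Z) by apply/imgP; exists v.
  move/(imgE _ pm) => [w hw]; exists w; split; first by move=> s; rewrite finset.in_setT.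
  by rewrite /rp -hw bothE; split; rewrite /= ?e1 ?e2 ?memv_line.
case=> w [_ hP].
have : ofc ba bb (iota_pt pos p.*2 w) \in img L i j (i + p%:Z) by apply/imgE => //; exists w.
case/imgP=> v hv; move: hP; rewrite /rp hv bothE => -[/= h1 h2 h3 h4].
exists v; split; rewrite ?(ls_up_eq0 upB) ?(ls_dn_eq0 dnB) //.
  exact: dim1_vline (valP P.1) h1 h2.
exact: dim1_vline (valP P.2) h3 h4.
Qed.

Lemma adapted_linked : adapted ba bb pos cuts (ls_proj L i j).
Proof.
split=> // P u hu; split.
  case=> l /= /andP[il lj]; have [p pm ->] := rangeP il lj.
  rewrite /ls_proj_comp ls_proj_open_param // closure_param_set // => /(comp_setP _ _ _ _ _ hu).
  case=> // iu _; exists p.*2 => //; first by rewrite mem_cuts odd_double leq_double.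
case=> c; rewrite mem_cuts => /andP[oc cm] iu.
have [p pm cE] : exists2 p, (p <= m)%N & c = p.*2 by exists c./2; lia.
have [il lj] := in_range pm; exists (i + p%:Z); first by rewrite /= il lj.
rewrite /ls_proj_comp ls_proj_open_param // closure_param_set //.
by apply/(comp_setP hba hbb _ _ _ hu); rewrite -cE; split=> // s; rewrite finset.in_setT.
Qed.

Lemma cf_pair1 x y s : xc (cf ba bb (x, y)) s = coord ba s x.
Proof. by rewrite /cf xc_mkpt. Qed.
Lemma cf_pair2 x y s : yc (cf ba bb (x, y)) s = coord bb s y.
Proof. by rewrite /cf yc_mkpt. Qed.

(** If [pos s] is 2p + 1, then (a_s, 0) lies in E_p and comes from a vector killed by h^(i+p), but
    a_s is not in the domain of E_(p+1), so this vector is not in the image of h_(i+p). If no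
    position is odd, the parameter of a vector killed by one of the maps also parametrizes its
    preimage in the neighbouring space. *)
Lemma ls_exact_cuts : ls_exact L <-> forall s, pos s \in cuts.
Proof.
rewrite (ls_exact_range dnB upB); split=> [ex s|all_even l il lj].
  rewrite mem_cuts pos_le andbT; apply/negP => os.
  have [p pm pE] : exists2 p, (p < m)%N & pos s = p.*2.+1.
    by exists (pos s)./2; have := pos_le s; lia.
  have [il lj] := in_range (ltnW pm).
  have {}lj : i + p%:Z < j by rewrite jE ltrD2l ltz_nat.
  have : (ba`_s, 0) \in img L i j (i + p%:Z).
    apply/imgE; first exact: ltnW.
    exists (fun t => (t == s)%:R); rewrite -[LHS](cfK hba hbb); congr (ofc ba bb _).
    apply: pt_ext => t; rewrite ?cf_pair1 ?cf_pair2 ?xc_iota ?yc_iota.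
      rewrite coord_free ?(basis_free hba) // (eq_sym s).
      case: eqVneq => [->|ts]; last by rewrite if_same.
      by rewrite pE leqnSn.
    rewrite linear0; case: (eqVneq t s) => [->|ts]; first by rewrite pE ltnn.
    by rewrite if_same.
  case/imgP=> v; rewrite bothE => -[hx hy].
  have : v \in lker (ls_up L (i + p%:Z)).
    by rewrite memv_ker (ls_up_eq0 upB) ?(ltW lj) // -hy.
  rewrite (ex _ il lj).2 => /memv_imgP[v' _ vE].
  have : both L i j (i + p%:Z + 1) v' \in img L i j (i + p.+1%:Z).
    by rewrite -ls_up_idx; apply/imgP; exists v'.
  move/(imgE _ pm) => [w]; rewrite bothE ls_map_via_dn // comp_lfunE -vE -hx.
  move/(congr1 (cf ba bb)); rewrite ofcK // => /(congr1 (fun u => xc u s)).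
  rewrite /= cf_pair1 coord_free ?(basis_free hba) // eqxx xc_iota pE doubleS ltnn.
  by move/eqP; rewrite oner_eq0.
have [p pm lE] := rangeP il (ltW lj); subst l.
have {}pm : (p < m)%N by move: lj; rewrite jE ltrD2l ltz_nat.
have not_odd s : pos s <> p.*2.+1.
  by move=> e; have := all_even s; rewrite mem_cuts e /= odd_double.
have cfE l (v : L l) : cf ba bb (both L i j l v) =
    mkpt (fun s => coord ba s (ls_map L l i v)) (fun s => coord bb s (ls_map L l j v)).
  by rewrite bothE.
split; apply/eqP; rewrite eqEsubv; apply/andP; split; apply/subvP => v.
- rewrite memv_ker => /eqP hv.
  have : both L i j (i + p%:Z + 1) v \in img L i j (i + p.+1%:Z).
    by rewrite -ls_up_idx; apply/imgP; exists v.
  move/(imgE _ pm) => [w hw].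
  have x0 : ls_map L (i + p%:Z + 1) i v = 0 by rewrite ls_map_via_dn // comp_lfunE hv linear0.
  have w0 s : (p.*2.+2 <= pos s)%N -> w s = 0.
    move=> ps; have := congr1 (fun z => xc (cf ba bb z) s) hw.
    by rewrite /= bothE cf_pair1 x0 linear0 ofcK // xc_iota doubleS ps.
  (* The same w, read at index p, gives the preimage: the two points differ only at positions 2p + 1
     and 2p + 2 of y, where either no position occurs or w is 0. *)
  have : ofc ba bb (iota_pt pos p.*2 w) \in img L i j (i + p%:Z).
    by apply/(imgE _ (ltnW pm)); exists w.
  case/imgP=> v' hv'; have -> : v = ls_up L _ v'; last by rewrite memv_img ?memvf.
  apply: (both_inj dnB upB) => //.
  + by apply: le_trans il _; rewrite lerDl.
  + by rewrite lezD1.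
  rewrite both_up // bothE x0; congr pair.
  have := congr1 snd hw; rewrite bothE /= => ->; have := congr1 snd hv'; rewrite bothE /= => <-.
  apply: eq_bigr => s _; rewrite !yc_iota doubleS.
  case: (leqP (pos s) p.*2) => h1; first by rewrite leqW // leqW.
  case: ifP => // h2; rewrite w0 ?scale0r //.
  by have := not_odd s; lia.
- by case/memv_imgP=> v' _ ->; rewrite memv_ker ls_dn_up.
- rewrite memv_ker => /eqP hv.
  have : both L i j (i + p%:Z) v \in img L i j (i + p%:Z) by apply/imgP; exists v.
  move/(imgE _ (ltnW pm)) => [w hw].
  have y0 : ls_map L (i + p%:Z) j v = 0 by rewrite ls_map_via_up // comp_lfunE hv linear0.
  have w0 s : (pos s <= p.*2)%N -> w s = 0.
    move=> ps; have := congr1 (fun z => yc (cf ba bb z) s) hw.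
    by rewrite /= bothE cf_pair2 y0 linear0 ofcK // yc_iota ps.
  (* Here w is read one index higher: w vanishes up to position 2p and position 2p + 1 does not
     occur, so the x-part does not change. *)
  have : ofc ba bb (iota_pt pos p.+1.*2 w) \in img L i j (i + p.+1%:Z).
    by apply/imgE => //; exists w.
  rewrite -ls_up_idx; case/imgP=> v' hv'.
  have -> : v = ls_dn L _ v'; last by rewrite memv_img ?memvf.
  apply: (both_inj dnB upB) => //; first exact: ltW.
  rewrite both_dn // bothE y0; congr pair.
  have := congr1 fst hw; rewrite bothE /= => ->; have := congr1 fst hv'; rewrite bothE /= => <-.
  apply: eq_bigr => s _; rewrite !xc_iota doubleS.
  case: (leqP p.*2.+2 (pos s)) => h1; first by rewrite (leq_trans _ h1) // -addn2 leq_addr.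
  case: ifP => // h2; rewrite w0 ?scale0r //.
  by have := not_odd s; lia.
by case/memv_imgP=> v' _ ->; rewrite memv_ker ls_up_dn.
Qed.

End Adapted.

Theorem proposition5p4 (k : closedFieldType) (n : nat) (n_ge1 : (1 <= n)%N)
    (L : linked_seq k n) (i0 iinf i j : int)
    (i0P : ls_lower_bound L i0) (iinfP : ls_upper_bound L iinf)
    (le_i_i0 : i <= i0) (le_iinf_j : iinf <= j) (le_i_j : i <= j) :
  (ls_exact L ->
     [/\ ls_proj L i j !=set0 /\ connected (ls_proj L i j),
         cohen_macaulay (ls_proj L i j),
         pure_dimension (ls_proj L i j) n.-1 &
         eventual_hilbert_function (ls_proj L i j)
           (fun a b => 'C(a + b + n - 1, n - 1))]) /\
  (eventual_hilbert_function (ls_proj L i j)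
     (fun a b => 'C(a + b + n - 1, n - 1)) ->
   ls_exact L).
Proof.
case: n n_ge1 L i0P iinfP => // n' _ L [dnB _] [upB _].
have {}dnB l : l < i -> bijective (ls_dn L l).
  by move=> li; apply: dnB; apply: lt_le_trans li le_i_i0.
have {}upB l : j <= l -> bijective (ls_up L l).
  by move=> jl; apply: upB; apply: le_trans le_iinf_j jl.
have [m jE] : exists m : nat, j = i + m%:Z.
  by exists (absz (j - i)%R); rewrite gez0_abs ?subr_ge0 // subrKC.
have in_range p : (p <= m)%N -> i <= i + p%:Z /\ i + p%:Z <= j.
  by move=> pm; rewrite jE lerDl lerD2l lez_nat.
have lt_range p : (p < m)%N -> i + p%:Z < j by move=> pm; rewrite jE ltrD2l ltz_nat.
pose E p := img L i j (i + p%:Z).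
have dimE p : (p <= m)%N -> \dim (E p) = n'.+1.
  by move=> /in_range[h1 h2]; apply: (dim_img dnB upB).
have [||||ba [bb [pos [hba hbb posM pos_le hE]]]] :=
  @adapted_bases _ _ _ _ m E (ls_dim L i) (ls_dim L j) dimE.
- move=> p x y pm; rewrite /E -ls_up_idx; apply: img_dn; last exact: lt_range.
  exact: (in_range _ (ltnW pm)).1.
- move=> p x y pm; rewrite /E -ls_up_idx; apply: img_up; last exact: lt_range.
  exact: (in_range _ (ltnW pm)).1.
- by rewrite /E addr0; apply: dom_img.
- by rewrite /E -jE; apply: ran_img.
have imgE p z : (p <= m)%N -> z \in E p <-> exists w, z = ofc ba bb (iota_pt pos p.*2 w).
  by move=> pm; apply: iota_image => // [|s]; [exact: dimE|exact: hE].
have ad := adapted_linked le_i_j dnB upB hba hbb jE posM imgE.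
have exE := ls_exact_cuts le_i_j dnB upB hba hbb jE pos_le imgE.
split=> [ex|H]; last first.
  by apply/exE; apply: (hilbert_adapted_converse ad).
have all_pos := iffLR exE ex; split.
- by split; [apply: (X_nonempty ad)|apply: (X_connected ad)].
- exact: (cohen_macaulay_adapted ad).
- exact: (pure_dimension_adapted ad).
- exact: (hilbert_adapted ad).
Qed.
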